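(* Let $p(\cdot)$ be a fixed polynomial of constant degree $d$. In the geometric amoebot model with reconfigurable circuits there is a protocol by which a connected amoebot structure of $n$ amoebots can detect a parallelogram with polynomial side ratio $l=p(h)$, i.e. decide whether it forms a parallelogram of height $h$ and length $l$ with $l=p(h)$. It requires $\Theta(\log n)$ rounds, with high probability.
   Context: Parallelograms. $G_{eqt}=(V,E)$ is the infinite regular triangular grid graph. Parallelograms $\mathcal P$ considered have their corners at nodes of $G_{eqt}$ and their sides parallel to grid axes. An amoebot structure $S\subseteq V$ forms $\mathcal P$ iff $\mathcal P\cap V=S$. The length of a side is its number of grid edges; $h$ (height) and $l$ (length) denote the lengths of the two pairs of parallel sides, where $h\le l$. Amoebot model with circuits. A set of $n$ amoebots occupies a finite set $S\subseteq V$ of nodes, $|S|=n$, exactly one amoebot per node of $S$; the induced graph $G_S=G_{eqt}|_S$ is connected; amoebots do not move. Amoebots on adjacent nodes are neighbors and are joined by a bond. All amoebots are anonymous and run the same randomized finite state machine (constant memory, independent of $n$; it may depend on the polynomial $p$). Each amoebot has a compass orientation (one of the six grid directions) and a chirality (which sense of rotation it regards as clockwise), and labels its incident edges accordingly; no agreement on either is assumed initially. Every edge incident to an amoebot carries the same constant number ($\ge 2$) of pins in a fixed linear order; the pins on a bond are shared by the two neighbors; each amoebot labels the pins of an edge in order according to its own chirality, so two neighbors label the shared pins in opposite orders iff they have the same chirality. Each amoebot chooses a pin configuration: an arbitrary set of undirected wires between pins on its own incident edges. If $P$ is the set of all pins and $C$ the set of all wires, a circuit is a connected component of the graph $(P,C)$;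 an amoebot is part of a circuit iff the circuit contains a pin on one of its bonds. Time proceeds in synchronous rounds; in each round every amoebot reads its memory and the beeps received on its circuits, computes and updates its memory, and then may reconfigure its wires and send a beep on any of its circuits. A beep sent on a circuit is received in the next round by all amoebots of that circuit; an amoebot only learns whether at least one beep was sent on the circuit, not the origin nor the number of senders. Running time is the number of rounds. With high probability: with probability at least $1-1/n^c$ where the constant $c$ can be made arbitrarily large. *)

(* Defs.v *)
From HB Require Import structures.
From mathcomp Require Import all_boot all_order all_algebra finmap.
From mathcomp Require Import boolp reals exp.
Set Implicit Arguments.
Unset Strict Implicit.
Unset Printing Implicit Defensive.
Import Order.TTheory GRing.Theory Num.Theory.
Local Open Scope ring_scope.

(* The triangular grid in axial coordinates: (x, y) stands for the point
   x * (1, 0) + y * (1/2, sqrt 3 / 2) of the Euclidean plane. *)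
Definition node : Type := (int * int)%type.

(* The six unit vectors, counterclockwise; [d] and [d + 3] are opposite. *)
Definition dir (d : 'Z_6) : node :=
  nth (0, 0) [:: (1, 0); (0, 1); (-1, 1); (-1, 0); (0, -1); (1, -1)] d.

Definition adjacent (u v : node) : bool := [exists d : 'Z_6, v == u + dir d].

Definition connected_structure (S : {fset node}) : Prop :=
  S != fset0 /\
  forall u v : S, connect (fun x y : S => adjacent (val x) (val y)) u v.

(* The closed parallelogram with corner [v] and sides of [l] edges in direction
   [d] and [h] edges in direction [e], as a region of the real plane, in the
   same (affine) coordinates as the nodes. *)
Definition parallelogram (R : realType) (v : node) (d e : 'Z_6) (l h : nat) :
    R * R -> Prop :=
  fun z => exists s t : R, [/\ 0 <= s <= l%:R, 0 <= t <= h%:R,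
     z.1 = v.1%:~R + s * (dir d).1%:~R + t * (dir e).1%:~R &
     z.2 = v.2%:~R + s * (dir d).2%:~R + t * (dir e).2%:~R].

Definition forms (R : realType) (S : {fset node}) (P : R * R -> Prop) : Prop :=
  forall u : node, u \in S <-> P (u.1%:~R, u.2%:~R).

(* Sides have positive length, so a line of amoebots is not a parallelogram. *)
Definition forms_parallelogram (R : realType) (S : {fset node}) (h l : nat) :
    Prop :=
  (0 < h <= l)%N /\
  exists (v : node) (d e : 'Z_6),
    [/\ e != d, e != d + 3 & forms S (@parallelogram R v d e l h)].

Definition has_side_ratio (R : realType) (p : {poly R}) (S : {fset node}) :
    Prop :=
  exists h l : nat, @forms_parallelogram R S h l /\ l%:R = p.[h%:R].

(* An amoebot's own name for a pin: edge label and position on that edge. *)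
Definition label (k : nat) : finType := ('Z_6 * 'I_k)%type.

(* The machine run by every amoebot, with [k] pins per edge.  In each round it
   moves to [step q r x], where [q] is its memory, [r] the set of its pins on
   which a beep was received, and [x] a fresh coin of law [coin_law] (a coin
   with arbitrary finite law gives every randomized finite state machine).  The
   wires and the beeps it then sets up are read off the new memory.
   [verdict q = Some b] means that it has terminated with decision [b]. *)
Record protocol (R : realType) (k : nat) := Protocol {
  memory : finType;
  coin : finType;
  coin_law : coin -> R;
  coin_law_ge0 : forall x, 0 <= coin_law x;
  coin_law_sum1 : \sum_x coin_law x = 1;
  start : memory;
  step : memory -> {set label k} -> coin -> memory;
  wires : memory -> {set label k * label k};
  beeps : memory -> {set label k};
  verdict : memory -> option bool;
  start_silent : beeps start = set0;
  verdict_final : forall q, verdict q != None ->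
    beeps q = set0 /\ forall r x, step q r x = q }.

(* [compass v] is the grid direction of the edge that [v] labels 0, and [cw v]
   tells whether the sense of rotation that [v] regards as clockwise is the
   true one; [v] labels its edges clockwise in its own sense. *)
Definition edge_dir (compass : node -> 'Z_6) (cw : node -> bool) (v : node)
    (m : 'Z_6) : 'Z_6 :=
  if cw v then compass v - m else compass v + m.

Definition pin_name (S : {fset node}) (k : nat) : finType :=
  (S * label k)%type.

Definition name_dir (compass : node -> 'Z_6) (cw : node -> bool)
    (S : {fset node}) (k : nat) (x : pin_name S k) : 'Z_6 :=
  edge_dir compass cw (val x.1) x.2.1.

(* The physical pin named by [x].  An edge is represented by its endpoint from
   which it leaves in one of the directions 0, 1, 2, and its pins are numbered
   clockwise as seen from that endpoint, hence counterclockwise as seen from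
   the other one. *)
Definition pin_at (compass : node -> 'Z_6) (cw : node -> bool)
    (S : {fset node}) (k : nat) (x : pin_name S k) : node * 'Z_6 * 'I_k :=
  let v := val x.1 in
  let d := name_dir compass cw x in
  let i := if (d < 3)%N == cw v then x.2.2 else rev_ord x.2.2 in
  if (d < 3)%N then (v, d, i) else (v + dir d, d + 3, i).

Definition on_bond (compass : node -> 'Z_6) (cw : node -> bool)
    (S : {fset node}) (k : nat) (x : pin_name S k) : bool :=
  val x.1 + dir (name_dir compass cw x) \in S.

Definition config (R : realType) (k : nat) (A : protocol R k)
    (S : {fset node}) : finType := {ffun S -> memory A}.

(* Two names are linked if they name the same pin or if their amoebot joins
   them by a wire. *)
Definition link (R : realType) (k : nat) (A : protocol R k)
    (compass : node -> 'Z_6) (cw : node -> bool) (S : {fset node})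
    (C : config A S) (x y : pin_name S k) : bool :=
  (pin_at compass cw x == pin_at compass cw y) ||
  (x.1 == y.1) && (((x.2, y.2) \in wires (C x.1)) ||
                   ((y.2, x.2) \in wires (C x.1))).

Definition same_circuit (R : realType) (k : nat) (A : protocol R k)
    (compass : node -> 'Z_6) (cw : node -> bool) (S : {fset node})
    (C : config A S) : rel (pin_name S k) :=
  connect (link compass cw C).

(* Amoebot [v] is part of the circuit of the pin [x]. *)
Definition part_of (R : realType) (k : nat) (A : protocol R k)
    (compass : node -> 'Z_6) (cw : node -> bool) (S : {fset node})
    (C : config A S) (v : S) (x : pin_name S k) : bool :=
  [exists y, [&& y.1 == v, on_bond compass cw y
               & same_circuit compass cw C y x]].

Definition received (R : realType) (k : nat) (A : protocol R k)
    (compass : node -> 'Z_6) (cw : node -> bool) (S : {fset node})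
    (C : config A S) (v : S) : {set label k} :=
  [set a | part_of compass cw C v (v, a) &&
     [exists y : pin_name S k,
        [&& y.2 \in beeps (C y.1), part_of compass cw C y.1 y
          & same_circuit compass cw C y (v, a)]]].

Definition coins (R : realType) (k : nat) (A : protocol R k)
    (S : {fset node}) : finType := {ffun S -> coin A}.

Definition round (R : realType) (k : nat) (A : protocol R k)
    (compass : node -> 'Z_6) (cw : node -> bool) (S : {fset node})
    (C : config A S) (x : coins A S) : config A S :=
  [ffun v => step (C v) (received compass cw C v) (x v)].

(* The configuration after [t] rounds, for [t <= size w]. *)
Definition run (R : realType) (k : nat) (A : protocol R k)
    (compass : node -> 'Z_6) (cw : node -> bool) (S : {fset node})
    (w : seq (coins A S)) (t : nat) : config A S :=
  foldl (@round R k A compass cw S) [ffun => start A] (take t w).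

Definition terminated (R : realType) (k : nat) (A : protocol R k)
    (S : {fset node}) (C : config A S) : bool :=
  [forall v, verdict (C v) != None].

Definition running_time (R : realType) (k : nat) (A : protocol R k)
    (compass : node -> 'Z_6) (cw : node -> bool) (S : {fset node})
    (w : seq (coins A S)) (T : nat) : Prop :=
  [/\ (T <= size w)%N, terminated (run compass cw w T) &
      forall t, (t < T)%N -> ~~ terminated (run compass cw w t)].

Definition decides (R : realType) (k : nat) (A : protocol R k)
    (compass : node -> 'Z_6) (cw : node -> bool) (S : {fset node})
    (w : seq (coins A S)) (T : nat) (Q : Prop) : Prop :=
  forall v, verdict (run compass cw w T v) = Some `[< Q >].

(* Probability of an event determined by the coins of the first [N] rounds, all
   amoebots and rounds being independent. *)
Definition Pr (R : realType) (k : nat) (A : protocol R k) (S : {fset node})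
    (N : nat) (E : N.-tuple (coins A S) -> Prop) : R :=
  \sum_(w : N.-tuple (coins A S) | `[< E w >])
    \prod_(x <- w) \prod_(v : S) coin_law (x v).

(* Main.v *)
From HB Require Import structures.
Require Import Defs.
From mathcomp Require Import all_boot all_order all_algebra finmap.
From mathcomp Require Import boolp reals exp.
From mathcomp Require Import zify ring lra.
Set Implicit Arguments.
Unset Strict Implicit.
Unset Printing Implicit Defensive.
Import Order.TTheory GRing.Theory Num.Theory.
Local Open Scope ring_scope.

(* Let every amoebot compare its neighbourhood with those that occur in a
   parallelogram, and let the corners beep along their sides.  These local tests,
   together with the absence of a side whose two corners are of the same kind,
   characterize the parallelograms.  In a parallelogram the two acute corners
   toss coins until they differ, which elects one of them as leader.  The leader
   marks the two sides that start at it (the arms); each arm learns its way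
   towards the leader from two beeps on nets of period three.

   The condition l = p(h) is equivalent to an equation D l + M(h) = P(h) between
   polynomials with natural coefficients.  Both sides are evaluated by Horner's
   rule, bit by bit: the product of a number x by the length m of an arm is the
   sum of m copies of x, and the m serial adders along the arm together transmit
   one bit of all partial sums in one round, since the sum bit is the input bit,
   changed or not by every adder, and this is the choice between two crossed or
   parallel tracks.  All numbers have O(log n) bits.

   For the lower bound, an amoebot stays alive as long as its coins show heads,
   and the structure terminates only when no amoebot is alive. *)

(** * Frames of the grid *)

(** Compass and chirality differ from amoebot to amoebot, so every common convention has to be read
    off the structure. A bit on a bond of a side is coded by the interior or the exterior track.
    Parity of labels survives a change of frame up to exchange, so wiring labels of equal parity is
    frame-free; it confines circuits to the classes of a 3-colouring of the bonds, hence the period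
    three. One net would mark an arm by a pattern that is the same read backwards; the second net
    orients it.

    Why the tests suffice: exterior angles are 120 degrees at acute and 60 at obtuse corners and add
    up to 360, which leaves triangles, quadrilaterals, pentagons and hexagons; only a parallelogram
    has corners alternating in kind.

    Neither the arm that is the height nor the number of bits is known. Both roles are tested at
    once, and the loop stops when no carry is pending and no constant has bits left, which certifies
    that all higher bits vanish.

    The coefficients of [p] are real; only its natural values at positive integers matter, and this
    makes an equation over the naturals possible. Without the wait for the coins, a failed local
    test would be reported after constantly many rounds. *)

Ltac cases6 d := case: d => -[|[|[|[|[|[|?]]]]]] // ?.
Ltac calc6 := apply/eqP; vm_compute; reflexivity.

Lemma dir_add3 d : dir (d + 3) = - dir d.
Proof. cases6 d; calc6. Qed.

(* A frame [(c, s)] of the grid has its direction 0 along [c] and is mirrored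
   if [s] holds; [turn s c m] is the grid direction of its direction [m]. *)
Definition turn (s : bool) (c m : 'Z_6) : 'Z_6 := if s then c - m else c + m.

Definition turnV (s : bool) (c m : 'Z_6) : 'Z_6 := if s then c - m else m - c.

Lemma turnVK s c : cancel (turnV s c) (turn s c).
Proof. by case: s => m; rewrite /turn /turnV ?subKr // addrC subrK. Qed.

Lemma turnKV s c : cancel (turn s c) (turnV s c).
Proof. by case: s => m; rewrite /turn /turnV ?subKr // addrC addKr. Qed.

Lemma turn_inj s c : injective (turn s c).
Proof. exact: can_inj (turnKV s c). Qed.

Lemma turnA s c s' c' m :
  turn s c (turn s' c' m) = turn (s (+) s') (turn s c c') m.
Proof. by case: s; case: s'; rewrite /turn /= ?opprB ?opprD ?addrA //; ring. Qed.

Lemma turnD s c a b : turn s c (a + b) = turn s (turn s c a) b.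
Proof. by case: s; rewrite /turn ?opprD addrA. Qed.

Lemma turn0 s c : turn s c 0 = c.
Proof. by case: s; rewrite /turn ?subr0 ?addr0. Qed.

Lemma turn_add3 s c a : turn s c (a + 3) = turn s c a + 3.
Proof.
rewrite turnD; case: s => //; rewrite /turn; congr (_ + _).
by apply/val_inj.
Qed.

(** The maps [tilt c s] are the twelve symmetries of the grid that fix the origin; they carry
    statements about one corner or side over to the others. *)
Definition tilt (c : 'Z_6) (s : bool) (z : node) : node :=
  dir c *~ z.1 + dir (turn s c 1) *~ z.2.

Lemma tiltD c s y z : tilt c s (y + z) = tilt c s y + tilt c s z.
Proof. by rewrite /tilt /= !mulrzDr addrACA. Qed.

Lemma mulrz_pair (z : node) (n : int) : z *~ n = (z.1 *~ n, z.2 *~ n).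
Proof.
rewrite [LHS]surjective_pairing (raddfMz (@fst int int)) (raddfMz (@snd int int)).
reflexivity.
Qed.

Lemma tiltZ c s z n : tilt c s (z *~ n) = tilt c s z *~ n.
Proof.
case: z => x y; rewrite /tilt [(x, y) *~ n]mulrz_pair /=.
by rewrite [RHS]mulrzDl !mulrzz !mulrzA.
Qed.

Lemma tilt_dir c s j : tilt c s (dir j) = dir (turn s c j).
Proof. cases6 c; case: s; cases6 j; calc6. Qed.

Lemma tilt_dirs c s a b : tilt c s a = dir 0 -> tilt c s b = dir 1 ->
  forall u : node, tilt c s (a *~ u.1 + b *~ u.2) = u.
Proof.
move=> Ha Hb [x y]; rewrite tiltD !tiltZ Ha Hb /= !mulrz_pair /=.
by congr pair; rewrite /= !mulrzz; ring.
Qed.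

Lemma tiltK c s : cancel (tilt (turnV s c 0) s) (tilt c s).
Proof.
move=> u; rewrite /tilt -/(tilt c s _); apply: tilt_dirs; rewrite tilt_dir.
  by rewrite turnVK.
congr dir; rewrite turnA addbb turnVK; exact: add0r.
Qed.

Lemma tiltVK c s : cancel (tilt c s) (tilt (turnV s c 0) s).
Proof.
have {1}-> : c = turnV s (turnV s c 0) 0.
  by case: s; rewrite /turnV ?subr0 ?sub0r ?opprK.
exact: tiltK.
Qed.

Definition pt (v : node) (c : 'Z_6) (s : bool) (z : node) : node := v + tilt c s z.

Lemma pt_inj v c s : injective (pt v c s).
Proof. by move=> y z /addrI/(can_inj (tiltVK c s)). Qed.

Lemma pt_surj v c s u : exists z, u = pt v c s z.
Proof. by exists (tilt (turnV s c 0) s (u - v)); rewrite /pt tiltK addrC subrK. Qed.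

Lemma pt_dir v c s z j : pt v c s (z + dir j) = pt v c s z + dir (turn s c j).
Proof. by rewrite /pt tiltD tilt_dir addrA. Qed.

Lemma turn_back s c : turn (~~ s) (turn s c 1) 1 = c.
Proof. by case: s; rewrite /turn /= ?subrK ?addrK. Qed.

Lemma turn3 s c : turn s (c + 3) 1 = turn s c 1 + 3.
Proof. by rewrite /turn; case: s; rewrite addrAC. Qed.

(** Together with the half turn [pt_rot], this exchange of axes generates the four changes of frame
    that bring any side of a parallelogram to the bottom. *)
Lemma pt_swap v c s x y : pt v (turn s c 1) (~~ s) (x, y) = pt v c s (y, x).
Proof. by rewrite /pt /tilt /= turn_back [_ *~ y + _]addrC. Qed.

Lemma pt_rot v c s y z : pt (pt v c s y) (c + 3) s z = pt v c s (y - z).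
Proof.
rewrite /pt -addrA tiltD; congr (_ + (_ + _)).
by rewrite /tilt /= turn3 !dir_add3 !mulNrz !mulrNz.
Qed.

(** * Pins and circuits *)

Section Pins.
Variables (k0 : nat) (S : {fset node}) (compass : node -> 'Z_6) (cw : node -> bool).
Notation k := k0.+2.
Notation name := (pin_name S k).
Notation edir := (edge_dir compass cw).

Lemma edge_dirE v m : edir v m = turn (cw v) (compass v) m.
Proof. by []. Qed.

Definition elab (v : node) (d : 'Z_6) : 'Z_6 := turnV (cw v) (compass v) d.

Lemma elabK v : cancel (elab v) (edir v).
Proof. exact: turnVK. Qed.

Lemma edirK v : cancel (edir v) (elab v).
Proof. exact: turnKV. Qed.

(* [lk], [part] and [heard] are [link], [part_of] and [received], for amoebots
   with wires [W] and beeps [B]. *)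
Definition lk (W : S -> {set label k * label k}) (x y : name) : bool :=
  (pin_at compass cw x == pin_at compass cw y) ||
  (x.1 == y.1) && (((x.2, y.2) \in W x.1) || ((y.2, x.2) \in W x.1)).

Definition part W (v : S) (x : name) : bool :=
  [exists y : name, [&& y.1 == v, on_bond compass cw y & connect (lk W) y x]].

Definition heard W (B : S -> {set label k}) (v : S) : {set label k} :=
  [set a | part W v (v, a) &&
     [exists y : name, [&& y.2 \in B y.1, part W y.1 y
          & connect (lk W) y (v, a)]]].

Lemma lk_sym W : symmetric (lk W).
Proof.
move=> x y; rewrite /lk eq_sym; congr (_ || _).
by rewrite eq_sym; case: eqP => //= ->; rewrite orbC.
Qed.

Lemma connect_lk_sym W x y : connect (lk W) x y = connect (lk W) y x.
Proof. exact: (sym_connect_sym (lk_sym W)). Qed.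

(** Circuits are bounded from above by what no link changes, here and in [circuit_ind]; from below
    they are given by explicit paths. *)
Lemma circuit_inv W (T : Type) (f : name -> T) x y :
  (forall a b, lk W a b -> f a = f b) -> connect (lk W) x y -> f x = f y.
Proof.
move=> Hf /connectP[p Hp ->]; elim: p x Hp => //= z p IH x /andP[/Hf -> /IH].
exact.
Qed.

Lemma circuit_ind W (P : name -> Prop) x y :
  (forall a b, lk W a b -> P a -> P b) -> connect (lk W) x y -> P x -> P y.
Proof.
move=> Hf /connectP[p Hp ->]; elim: p x Hp => //= z p IH x /andP[/Hf Hz /IH H].
by move/Hz.
Qed.

Lemma part_bond W (v : S) a : on_bond compass cw ((v, a) : name) -> part W v (v, a).
Proof. by move=> H; apply/existsP; exists (v, a); rewrite eqxx H connect0. Qed.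

Lemma heardP W (B : S -> {set label k}) (v : S) a : on_bond compass cw ((v, a) : name) ->
  reflect (exists y : name, [/\ y.2 \in B y.1, part W y.1 y & connect (lk W) y (v, a)])
    (a \in heard W B v).
Proof.
move=> H; rewrite inE part_bond //=.
by apply: (iffP existsP) => -[y]; [case/and3P => *; exists y | case => *; exists y; apply/and3P].
Qed.

Definition ndir (x : name) : 'Z_6 := edir (val x.1) x.2.1.

Definition mate (x y : name) : bool :=
  [&& val y.1 == val x.1 + dir (ndir x), ndir y == ndir x + 3 &
      y.2.2 == (if cw (val x.1) == cw (val y.1) then rev_ord x.2.2 else x.2.2)].

Lemma lt3_add3 (d : 'Z_6) : ((d + 3)%R < 3)%N = ~~ (d < 3)%N.
Proof. by cases6 d; vm_compute. Qed.

Lemma add33 (d : 'Z_6) : d + 3 + 3 = d.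
Proof. by cases6 d; apply/val_inj; vm_compute. Qed.

Lemma add3_neq (d : 'Z_6) : d + 3 != d.
Proof. by cases6 d; vm_compute. Qed.

(** A pin has at most one name at each end of its bond. The four cases tell whether [x] and [y] sit
    at the representing end of their edges. *)
Lemma pin_atE x y : (pin_at compass cw x == pin_at compass cw y) = (x == y) || mate x y.
Proof.
rewrite /pin_at /mate -/(ndir x) -/(ndir y).
case: x y => [u [m i]] [v [m' i']] /=.
rewrite -!/(ndir (_, (_, _))) /ndir /=.
set d := edir _ m; set e := edir _ m'.
have E : ((u, (m, i)) == (v, (m', i')) :> name) = [&& val u == val v, d == e & i == i'].
  apply/eqP/and3P => [H|[/eqP/val_inj Huv /eqP Hde /eqP ->]].
    have /= Hu := congr1 fst H; have /= Hm := congr1 (fun x => x.2.1) H.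
    have /= Hi := congr1 (fun x => x.2.2) H.
    by rewrite /d /e Hu Hm Hi !eqxx.
  by congr (_, (_, _)) => //; apply: (can_inj (edirK (val u))); rewrite -/d Hde /e Huv.
have rK : involutive (@rev_ord k) := @rev_ordK k.
have XE (T1 T2 T3 : eqType) (a a' : T1) (b b' : T2) (c c' : T3) :
  ((a, b, c) == (a', b', c')) = [&& a == a', b == b' & c == c'] by rewrite andbA.
have add3E (x y : 'Z_6) : (x == y + 3) = (y == x + 3).
  by apply/eqP/eqP => ->; rewrite add33.
have Ed : name_dir compass cw ((u, (m, i)) : name) = d by [].
have Ee : name_dir compass cw ((v, (m', i')) : name) = e by [].
rewrite E Ed Ee; case Hd : (d < 3)%N; case He : (e < 3)%N; rewrite XE.
- have -> : e == d + 3 = false by apply/eqP => He'; move: He; rewrite He' lt3_add3 Hd.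
  rewrite !andbF orbF; case: eqP => //= ->; case: (d == e) => //=.
  by case: (cw _) => //=; rewrite (inj_eq (inv_inj rK)).
- have -> : d == e = false by apply/eqP => He'; move: He; rewrite -He' Hd.
  rewrite !andbF /= add3E; case: (e =P d + 3) => [He'|]; last by rewrite !andbF.
  rewrite He' !andTb dir_add3 -subr_eq opprK [X in X && _]eq_sym.
  congr (_ && _).
  by case: (cw (val u)); case: (cw (val v)) => //=; rewrite ?(inj_eq (inv_inj rK)) eq_sym // (inv_eq rK).
- have -> : d == e = false by apply/eqP => He'; move: Hd; rewrite He' He.
  rewrite !andbF /= [e == d + 3]eq_sym; case: (d + 3 =P e) => [He'|]; last by rewrite !andbF.
  rewrite [val v == _]eq_sym; congr (_ && _).
  by case: (cw (val u)); case: (cw (val v)) => //=; rewrite ?(inj_eq (inv_inj rK)) eq_sym // (inv_eq rK).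
- have -> : e == d + 3 = false by apply/eqP => He'; move: He; rewrite He' lt3_add3 Hd.
  rewrite !andbF orbF (inj_eq (addIr _)); case: (d =P e) => [->|]; last by rewrite !andbF.
  rewrite (inj_eq (addIr _)); case: eqP => //= ->.
  by case: (cw _) => //=; rewrite (inj_eq (inv_inj rK)).
Qed.

Lemma lkE W x y : lk W x y = [|| x == y, mate x y |
  (x.1 == y.1) && (((x.2, y.2) \in W x.1) || ((y.2, x.2) \in W x.1))].
Proof. by rewrite /lk pin_atE orbA. Qed.

End Pins.

Section Circuits.
Variables (k0 : nat) (S : {fset node}) (compass : node -> 'Z_6) (cw : node -> bool).
Notation k := k0.+2.
Notation name := (pin_name S k).
Notation edir := (edge_dir compass cw).
Notation elab := (elab compass cw).
Notation lk := (@lk k0 S compass cw).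
Notation heard := (@heard k0 S compass cw).
Notation part := (@part k0 S compass cw).
Notation mate := (@mate k0 S compass cw).

(** Tracks use only the first and the last pin of an edge: reversing the order exchanges these two,
    whatever the number of pins is. *)
Definition pin (b : bool) : 'I_k := if b then ord_max else ord0.

Lemma rev_pin b : rev_ord (pin b) = pin (~~ b).
Proof. by case: b; apply/val_inj => //=; rewrite subnn. Qed.

Lemma pin_inj : injective pin.
Proof. by case; case => // /(congr1 val). Qed.

Definition is_track (i : 'I_k) : bool := (i == pin false) || (i == pin true).

Lemma is_trackP i : reflect (exists b, i = pin b) (is_track i).
Proof.
apply: (iffP orP) => [[/eqP|/eqP] ->|[[] ->]]; try by eexists.
  by right.
by left.
Qed.

(* The track pin of the edge in direction [d] that lies on its left side, seen
   from [v], if [b] holds, and on its right side otherwise. *)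
Definition side_pin (v : S) (d : 'Z_6) (b : bool) : name :=
  (v, (elab (val v) d, pin (b (+) cw (val v)))).

Lemma lk_mate W x y : mate x y -> lk W x y.
Proof. by rewrite lkE => ->; rewrite orbT. Qed.

Lemma mate_side_pin v d b y : mate (side_pin v d b) y ->
  val y.1 = val v + dir d /\ y = side_pin y.1 (d + 3) (~~ b).
Proof.
case: y => u [m i]; rewrite /mate /ndir /= elabK => /and3P[/eqP Hu /eqP Hm /eqP Hi].
split => //; rewrite /side_pin /=; congr (_, (_, _)).
  by rewrite -Hm edirK.
rewrite Hi rev_pin; case: (cw (fsval v)); case: (cw (fsval u)) => //=; case: b {Hi} => //.
Qed.

Lemma side_pin_mate (v u : S) d b : val u = val v + dir d ->
  mate (side_pin v d b) (side_pin u (d + 3) (~~ b)).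
Proof.
move=> Hu; rewrite /mate /ndir /= !elabK Hu !eqxx rev_pin /=.
by apply/eqP; case: (cw (fsval v)); case: (cw _) => //=; case: b.
Qed.

Lemma side_pin_eta (x : name) : is_track x.2.2 ->
  exists b, x = side_pin x.1 (edir (val x.1) x.2.1) b.
Proof.
case: x => v [m i] /is_trackP[b /= ->]; exists (b (+) cw (val v)).
by rewrite /side_pin edirK -addbA addbb addbF.
Qed.

Lemma side_pin_inj a d b a' d' b' :
  side_pin a d b = side_pin a' d' b' -> a = a' /\ d = d' /\ b = b'.
Proof.
move=> H; have /= Ea := congr1 fst H; have /= El := congr1 (fun z : name => z.2.1) H.
have /= /pin_inj Ep := congr1 (fun z : name => z.2.2) H.
rewrite Ea in El Ep; split => //; split; first exact: (can_inj (turnVK _ _) El).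
exact: addIb Ep.
Qed.

(** * Tracks along a straight chain of amoebots *)

Section Chain.
Variables (W : S -> {set label k * label k}) (u : nat -> S) (t : 'Z_6) (m : nat).
Variable fl : nat -> bool.
Hypothesis Hu : forall j, (j < m)%N -> val (u j.+1) = val (u j) + dir t.
Hypothesis Hend : W (u 0%N) = set0 /\ W (u m) = set0.
Hypothesis Hmid : forall j, (0 < j < m)%N -> forall a b : label k,
  ((a, b) \in W (u j)) =
  [&& ((edir (val (u j)) a.1 == t) && (edir (val (u j)) b.1 == t + 3))
      || ((edir (val (u j)) a.1 == t + 3) && (edir (val (u j)) b.1 == t)),
      is_track a.2, is_track b.2 & (a.2 == b.2) == fl j].

(** [tr j] is the side of the bond from [u j] to [u j.+1] on which the track runs; from the far end
    the side appears negated. Equal own indices on opposite edges lie on different sides of the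
    line, because an amoebot counts pins around itself; so [fl j] means that the tracks cross at
    [u j]. *)
Definition on_track (tr : nat -> bool) (y : name) : Prop :=
  exists2 j, (j < m)%N & y = side_pin (u j) t (tr j) \/
                         y = side_pin (u j.+1) (t + 3) (~~ tr j).

Variable tr : nat -> bool.
Hypothesis Htr : forall j, (0 < j < m)%N -> tr j.-1 = tr j (+) fl j.

Lemma dir_mulrn_eq0 d n : dir d *+ n = 0 -> n = 0%N.
Proof.
rewrite pmulrn mulrz_pair => -[].
by cases6 d; rewrite /= ?mulNrz ?mulrzz; lia.
Qed.

Lemma chain_val i j : (i + j <= m)%N -> val (u (i + j)%N) = val (u i) + dir t *+ j.
Proof.
elim: j => [|j IH] Hij; first by rewrite addn0 mulr0n addr0.
by rewrite addnS in Hij *; rewrite Hu // IH ?mulrSr ?addrA // ltnW.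
Qed.

Lemma chain_inj i j : (i <= m)%N -> (j <= m)%N -> u i = u j -> i = j.
Proof.
wlog Hij : i j / (i <= j)%N => [H Hi Hj E|Hi Hj E].
  by case: (leqP i j) => [|/ltnW] /H; [apply|move=> ->].
have := @chain_val i (j - i); rewrite subnKC // => /(_ Hj).
rewrite E -{1}[val (u j)]addr0 => /addrI/esym/dir_mulrn_eq0; lia.
Qed.

(** The track cannot leave the chain: the two ends have no wires, and an inner amoebot joins only
    track pins of its two edges along the chain. *)
Lemma on_track_closed x y : lk W x y -> on_track tr x -> on_track tr y.
Proof.
rewrite lkE => Hxy [j Hj Hx]; case/or3P: Hxy => [/eqP <-|Hm|]; first by exists j.
- exists j => //; case: Hx => Hx; rewrite Hx in Hm;
    have [Hv ->] := mate_side_pin Hm; [right|left].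
    by have -> : y.1 = u j.+1 by apply/val_inj; rewrite Hv Hu.
  rewrite negbK add33; have -> // : y.1 = u j.
  by apply/val_inj; rewrite Hv Hu // dir_add3 addrK.
- case/andP => /eqP Hx1 Hw.
  have [[i Hi Hxi]|Hw0] : (exists2 i, (0 < i < m)%N & x.1 = u i) \/ W x.1 = set0.
  + case: Hx => ->; rewrite /side_pin /=.
      case: (posnP j) => [->|Hj0]; first by right; case: Hend.
      by left; exists j => //; rewrite Hj0.
    case: (ltnP j.+1 m) => Hj1; first by left; exists j.+1.
    by right; have -> : j.+1 = m by [lia]; case: Hend.
  + have {}Hw : (x.2, y.2) \in W (u i).
      rewrite -Hxi; case/orP: Hw => //; rewrite Hxi !Hmid //.
      case/and4P => H1 H2 H3 H4; rewrite H2 H3 [y.2.2 == _]eq_sym in H4 *; rewrite H4 !andbT.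
      by case/orP: H1 => /andP[-> ->]; rewrite ?orbT.
    move: Hw; rewrite Hmid // => /and4P[Hd Hx2 Hy2 /eqP Hf].
    have [bx Ex] := side_pin_eta Hx2; have [by_ Ey] := side_pin_eta Hy2.
    move: Hd Hx; rewrite Ex Ey -!Hx1 !Hxi /= !elabK => Hd Hx.
    have Hf' : (bx == by_) = fl i.
      move: Hf; rewrite Ex Ey /side_pin /= -!Hx1 Hxi (inj_eq pin_inj) => <-.
      by case: bx {Ex Hx}; case: by_ {Ey}; case: (cw _).
    have Hi' : (i <= m)%N by case/andP: Hi => _ /ltnW.
    case: Hx => /side_pin_inj[H1 [H2 H3]].
    * have Hi2 : j = i by apply/esym/chain_inj => //; exact: ltnW.
      move: Hd; rewrite H2 eqxx [t == t + 3]eq_sym (negPf (add3_neq t)) orbF andTb => /eqP ->.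
      exists i.-1; first by case/andP: Hi => H H'; rewrite prednK // ltnW.
      right; rewrite prednK; last by case/andP: Hi.
      congr side_pin; rewrite Htr // -Hf' H3 Hi2.
      by case: (tr i); case: by_ {Ey Hf Hf'}.
    * have Hi2 : j.+1 = i by apply/esym/chain_inj.
      move: Hd; rewrite H2 eqxx (negPf (add3_neq t)) orFb andTb => /eqP ->.
      exists i; first by case/andP: Hi.
      left; congr side_pin; have := Htr Hi; rewrite -{1}Hi2 /= => Htr'; rewrite Htr' in H3.
      move: Hf'; rewrite H3.
      by case: (tr i); case: (fl i); case: by_ {Ey Hf H3}.
  + by move: Hw; rewrite Hw0 !inE.
Qed.

Lemma on_track_connect x y : on_track tr x -> on_track tr y -> connect (lk W) x y.
Proof.
have step1 j : (j < m)%N ->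
    connect (lk W) (side_pin (u j) t (tr j)) (side_pin (u j.+1) (t + 3) (~~ tr j)).
  by move=> Hj; apply/connect1/lk_mate/side_pin_mate/Hu.
have step2 j : (0 < j < m)%N ->
    connect (lk W) (side_pin (u j) (t + 3) (~~ tr j.-1)) (side_pin (u j) t (tr j)).
  move=> Hj; apply/connect1; rewrite lkE; apply/or3P/Or33; rewrite eqxx /= Hmid //=.
  rewrite !elabK !eqxx orbT /=; apply/orP; left; apply/and3P; split; try by apply/is_trackP; eexists.
  rewrite (inj_eq pin_inj) Htr //.
  by case: (tr j); case: (fl j); case: (cw _).
have H0 x' : on_track tr x' -> connect (lk W) (side_pin (u 0%N) t (tr 0%N)) x'.
  case=> j; elim: j x' => [|j IH] x' Hj [] ->; try exact: connect0; try exact: step1.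
    apply: connect_trans (step2 j.+1 _); last by rewrite Hj.
    by apply: IH; [exact: ltnW | right].
  apply: connect_trans (step1 _ Hj).
  apply: connect_trans (step2 j.+1 _); last by rewrite Hj.
  by apply: IH; [exact: ltnW | right].
move=> /H0; rewrite connect_lk_sym => Hx /H0; exact: connect_trans.
Qed.

Lemma chain_circuit x y : on_track tr x -> connect (lk W) x y <-> on_track tr y.
Proof.
move=> Hx; split; last exact: on_track_connect.
move=> H; exact: (circuit_ind on_track_closed H Hx).
Qed.
End Chain.

Lemma mate_ex (x : name) (u : S) : val u = val x.1 + dir (ndir compass cw x) ->
  exists2 y, mate x y & y.1 = u.
Proof.
move=> Hu; exists (u, (elab (val u) (ndir compass cw x + 3),
   if cw (val x.1) == cw (val u) then rev_ord x.2.2 else x.2.2)) => //.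
by rewrite /mate /ndir /= elabK -/(ndir compass cw x) Hu !eqxx.
Qed.

Lemma part_ex W B (v : S) a : a \in heard W B v ->
  exists y : name, [/\ y.2 \in B y.1 & connect (lk W) y (v, a)].
Proof. by rewrite inE => /andP[_ /existsP[y /and3P[H1 _ H2]]]; exists y. Qed.

Lemma on_bondP (x : name) : reflect (exists u : S, val u = val x.1 + dir (ndir compass cw x))
  (on_bond compass cw x).
Proof.
apply: (iffP idP) => [H|[u Hu]]; first by exists [` H]%fset.
by rewrite /on_bond -[name_dir _ _ _]/(ndir compass cw x) -Hu; exact: valP.
Qed.

(** * The global circuit and isolated pins *)

Section Global.
Variable W : S -> {set label k * label k}.
Hypothesis WT : forall v, W v = setT.
Hypothesis HS : connected_structure S.

Lemma global_connect x y : connect (lk W) x y.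
Proof.
have same a b : a.1 = b.1 -> connect (lk W) a b.
  by move=> H; apply: connect1; rewrite lkE H eqxx WT inE !orbT.
have [_ /(_ x.1 y.1) /connectP[p Hp Hy]] := HS.
elim: p x Hp Hy => [|u p IH] x /= => [_ Hy|/andP[/existsP[d /eqP Hd] Hp] Hy]; first exact: same.
have [z Hz Hzu] : exists2 z, mate (x.1, (elab (val x.1) d, ord0)) z & z.1 = u.
  by apply: mate_ex; rewrite /ndir /= elabK.
apply: connect_trans (_ : connect _ x (x.1, (elab (val x.1) d, ord0))) _; first exact: same.
apply: connect_trans (connect1 (lk_mate _ Hz)) _.
by apply: IH; rewrite Hzu.
Qed.

Lemma has_neighbor (v : S) : (1 < #|` S|)%N -> exists d (u : S), val u = val v + dir d.
Proof.
rewrite cardfE => /card_gt1P[a [b [_ _ Hab]]].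
have [u Hu] : exists u, u != v.
  by case: (a =P v) Hab => [-> H|/eqP H]; [exists b; rewrite eq_sym | exists a].
have [_ /(_ v u) /connectP[[|w p] /= Hp Hw]] := HS; first by rewrite Hw eqxx in Hu.
by case/andP: Hp => /existsP[d /eqP Hd] _; exists d, w.
Qed.

(** One bit is broadcast to the whole structure. A second amoebot guarantees that everyone has a
    bond, without which no circuit has a listener. *)
Lemma heard_global B (v : S) : (1 < #|` S|)%N ->
  (heard W B v != set0) = [exists u, B u != set0].
Proof.
move=> H1.
have HP w x : part W w x.
  have [d [u Hu]] := has_neighbor w H1; apply/existsP.
  exists (w, (elab (val w) d, ord0)); rewrite eqxx global_connect andbT /=.
  by apply/on_bondP; exists u; rewrite /ndir /= elabK.
apply/set0Pn/existsP => [[a /part_ex[y [Hy _]]]|[u /set0Pn[a Ha]]].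
  by exists y.1; apply/set0Pn; exists y.2.
by exists a; rewrite inE HP; apply/existsP; exists (u, a); rewrite /= Ha HP global_connect.
Qed.
End Global.

(** Without wires a circuit is a single pin under its one or two names, and an amoebot takes part in
    it only if the pin lies on a bond. When all amoebots beep everywhere, each one therefore learns
    which neighbours exist. *)
Lemma heard_unwired W B (v : S) a : (forall u, W u = set0) -> (forall u, B u = setT) ->
  (a \in heard W B v) = on_bond compass cw ((v, a) : name).
Proof.
move=> W0 BT; apply/idP/idP => [|H]; last first.
  by apply/heardP => //; exists (v, a); rewrite BT inE part_bond // connect0.
rewrite inE => /andP[/existsP[y /and3P[/eqP Hy Hb Hc]] _].
have Hp := circuit_inv (f := pin_at compass cw (S := S) (k := k)) _ Hc.
have {Hp}/eqP : pin_at compass cw y = pin_at compass cw ((v, a) : name).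
  by apply: Hp => x z; rewrite /lk W0 !inE andbF orbF => /eqP.
rewrite pin_atE => /orP[/eqP <- //|/and3P[/eqP Hm _ _]].
move: Hm; rewrite /= -Hy -{1}[fsval _]addr0 => /addrI/esym/eqP.
by rewrite -[dir _]mulr1n => /eqP/dir_mulrn_eq0.
Qed.

(** * Nets: labels of equal parity joined *)

Section Net.
Variable W : S -> {set label k * label k}.
Hypothesis WN : forall v, W v = [set ab : label k * label k | odd ab.1.1 == odd ab.2.1].

(* Joining all labels of equal parity, the circuits are confined to the bonds of
   one colour, where the colour of a bond is that of its even end. *)
Definition color (z : node) : 'Z_3 := (z.1 - z.2)%:~R.
Definition bond_color (v : node) (d : 'Z_6) : 'Z_3 :=
  if odd d then color (v + dir d) else color v.

(** [x - y] modulo 3 is the proper 3-colouring of the triangular grid; even directions raise it and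
    odd ones lower it, so at each node all edges of one parity have one bond colour. *)
Lemma color_dir v d : color (v + dir d) = color v + (if odd d then -1 else 1).
Proof.
rewrite /color -[(v + dir d).1]/(v.1 + (dir d).1) -[(v + dir d).2]/(v.2 + (dir d).2).
rewrite opprD addrACA [LHS]intrD; congr (_ + _).
by cases6 d; apply/val_inj; vm_compute.
Qed.

(** All frames split the six edges of a node into the same two classes, at most with the names even
    and odd exchanged. *)
Lemma odd_turn s (c m : 'Z_6) : odd (turn s c m) = odd c (+) odd m.
Proof. by case: s; cases6 c; cases6 m; vm_compute. Qed.

Lemma net_inv x y : lk W x y ->
  bond_color (val x.1) (ndir compass cw x) = bond_color (val y.1) (ndir compass cw y).
Proof.
rewrite lkE => /or3P[/eqP -> //|/and3P[/eqP Hv /eqP Hd _]|/andP[/eqP H]].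
  rewrite /bond_color Hv Hd.
  have -> : odd (ndir compass cw x + 3)%R = ~~ odd (ndir compass cw x).
    by case: (ndir _ _ _) => -[|[|[|[|[|[|?]]]]]] // ?; vm_compute.
  by rewrite dir_add3 addrK; case: odd.
have E (z : name) : bond_color (val z.1) (ndir compass cw z) =
    color (val z.1) + (if odd (compass (val z.1)) (+) odd z.2.1 then -1 else 0).
  by rewrite /bond_color color_dir /ndir edge_dirE odd_turn; case: (_ (+) _); rewrite ?addr0.
rewrite !WN !inE /= => Hp; rewrite !E H.
by have -> : odd x.2.1 = odd y.2.1 by case/orP: Hp => /eqP.
Qed.

Lemma net_connect_color x y : connect (lk W) x y ->
  bond_color (val x.1) (ndir compass cw x) = bond_color (val y.1) (ndir compass cw y).
Proof. apply: (circuit_inv (f := fun x => bond_color (val x.1) (ndir compass cw x))); exact: net_inv. Qed.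

Definition net_reach (x : name) (v : S) (d : 'Z_6) : Prop :=
  forall y : name, y.1 = v -> ndir compass cw y = d -> connect (lk W) x y.

Lemma net_same x : net_reach x x.1 (ndir compass cw x).
Proof.
move=> y Hy Hd; apply: connect1; rewrite lkE Hy eqxx WN inE /=.
apply/or3P/Or33/orP; left; apply/eqP; congr (odd _).
by move: Hd; rewrite /ndir Hy => /(can_inj (turnKV _ _)) ->.
Qed.

Lemma net_turn x v (d d' : 'Z_6) : odd d = odd d' -> net_reach x v d -> net_reach x v d'.
Proof.
move=> Hdd H y Hy Hd.
apply: connect_trans (_ : connect _ x (v, (elab (val v) d, ord0))) _.
  by apply: H => //; rewrite /ndir /= elabK.
apply: connect1; rewrite lkE Hy eqxx WN inE /=; apply/or3P/Or33/orP; left; apply/eqP.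
have : odd (edir (val v) (elab (val v) d)) = odd (edir (val v) y.2.1).
  by rewrite elabK Hdd -Hd /ndir Hy.
by rewrite !edge_dirE !odd_turn => /addbI.
Qed.

Lemma net_cross x (v u : S) d : val u = val v + dir d -> net_reach x v d ->
  net_reach x u (d + 3).
Proof.
move=> Hu H y Hy Hd.
have [z Hz Hzv] : exists2 z, mate y z & z.1 = v.
  by apply: mate_ex; rewrite Hd Hy dir_add3 Hu addrK.
apply: connect_trans (H z Hzv _) _.
  by case/and3P: Hz => _ /eqP -> _; rewrite Hd add33.
by rewrite connect_lk_sym; apply/connect1/lk_mate.
Qed.
End Net.
End Circuits.

(** * Parallelograms in the grid *)

Definition sector (i : 'Z_6) (n : nat) : {set 'Z_6} := [set m : 'Z_6 | (nat_of_ord (m - i)%R < n)%N].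

(* The sets of directions of the neighbours that occur in a parallelogram: in
   its interior, at an acute corner, at an obtuse corner, and on a side. *)
Definition convex_type (A : {set 'Z_6}) : bool :=
  (A == setT) || [exists i, [|| A == sector i 2, A == sector i 3 | A == sector i 4]].

(** For a sector these are its two extreme directions, the edges that run along the boundary; an
    interior amoebot has none. *)
Definition is_end (A : {set 'Z_6}) (m : 'Z_6) : bool :=
  (m \in A) && ~~ ((m + 1 \in A) && (m - 1 \in A)).

Definition pre (s : bool) (c : 'Z_6) (A : {set 'Z_6}) : {set 'Z_6} :=
  [set m | turn s c m \in A].

Lemma convex_typeP A : reflect (A = setT \/ exists i n, (1 < n < 5)%N /\ A = sector i n) (convex_type A).
Proof.
apply: (iffP orP) => [[/eqP ->|/existsP[i /or3P[]/eqP ->]]|[->|[i [[|[|[|[|[|n]]]]] [//]]]]].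
- by left.
- by right; exists i, 2.
- by right; exists i, 3.
- by right; exists i, 4.
- by left; rewrite eqxx.
- by move=> _ ->; right; apply/existsP; exists i; rewrite eqxx ?orbT.
- by move=> _ ->; right; apply/existsP; exists i; rewrite eqxx ?orbT.
- by move=> _ ->; right; apply/existsP; exists i; rewrite eqxx ?orbT.
Qed.

Lemma pre_sector s c i n : (0 < n < 7)%N -> pre s c (sector i n) = sector (turnV s c (if s then i + n.-1%:R else i)) n.
Proof.
move=> Hn; apply/setP => m; rewrite !inE /turn /turnV.
case: s; last by congr (nat_of_ord _ < n)%N; ring.
have -> : c - m - i = n.-1%:R - (m - (c - (i + n.-1%:R))) by ring.
move: (m - _) => x; move: n Hn => [|[|[|[|[|[|[|n]]]]]]] // _; cases6 x; vm_compute.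
Qed.

Lemma convex_type_pre s c A : convex_type A -> convex_type (pre s c A).
Proof.
move/convex_typeP => [->|[i [n [Hn ->]]]]; apply/convex_typeP.
  by left; apply/setP => m; rewrite !inE.
right; exists (turnV s c (if s then i + n.-1%:R else i)), n; split => //; apply: pre_sector.
by case/andP: Hn => H1 H2; rewrite (ltn_trans _ H1) //= (ltn_trans H2).
Qed.

Lemma card_pre s c A : #|pre s c A| = #|A|.
Proof.
rewrite -(card_imset (pre s c A) (@turn_inj s c)); congr #|pred_of_set _|; apply/setP => m.
apply/imsetP/idP => [[x Hx ->]|Hm]; first by rewrite inE in Hx.
by exists (turnV s c m); rewrite ?inE turnVK.
Qed.

Lemma is_end_pre s c A m : is_end (pre s c A) m = is_end A (turn s c m).
Proof.
rewrite /is_end !inE !turnD; case: s; rewrite /turn //= opprK.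
by rewrite [X in ~~ X]andbC.
Qed.

Lemma card_sector i n : (n < 7)%N -> #|sector i n| = n.
Proof.
have -> : sector i n = pre false (- i) (sector 0 n).
  by apply/setP => m; rewrite !inE /turn subr0 addrC.
rewrite card_pre -sum1dep_card big_mkcond !big_ord_recl big_ord0.
by move: n => [|[|[|[|[|[|[|]]]]]]] //; rewrite !subr0.
Qed.

(** This and the next three lemmas list how a neighbourhood can continue when the part already
    scanned is known: on the bottom row, on the right side, further inside a row, and at the lowest
    leftmost node. *)
Lemma convex_234 A : convex_type A -> 2 \in A -> 3 \in A -> 4 \notin A ->
  [\/ A = sector 2 2, A = sector 1 3 | A = sector 0 4].
Proof.
move/convex_typeP => [->|[i [n [Hn ->]]]]; first by rewrite !inE.
rewrite !inE; move: n Hn => [|[|[|[|[|]]]]] // _; cases6 i => H2 H3 H4.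
all: first [ by exfalso; move: H2 H3 H4; vm_compute | idtac].
- by apply: Or31; congr sector; apply/val_inj.
- by apply: Or32; congr sector; apply/val_inj.
- by apply: Or33; congr sector; apply/val_inj.
Qed.

Lemma convex_345 A : convex_type A -> 3 \in A -> 4 \in A -> 5 \notin A ->
  [\/ A = sector 3 2, A = sector 2 3 | A = sector 1 4].
Proof.
move/convex_typeP => [->|[i [n [Hn ->]]]]; first by rewrite !inE.
rewrite !inE; move: n Hn => [|[|[|[|[|]]]]] // _; cases6 i => H2 H3 H4.
all: first [ by exfalso; move: H2 H3 H4; vm_compute | idtac].
- by apply: Or31; congr sector; apply/val_inj.
- by apply: Or32; congr sector; apply/val_inj.
- by apply: Or33; congr sector; apply/val_inj.
Qed.

Lemma convex_3450 A : convex_type A -> 3 \in A -> 4 \in A -> 5 \in A -> 0 \in A ->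
  A = sector 3 4 \/ A = setT.
Proof.
move/convex_typeP => [->|[i [n [Hn ->]]]]; first by right.
rewrite !inE; move: n Hn => [|[|[|[|[|]]]]] // _; cases6 i => H2 H3 H4 H5.
all: first [ by exfalso; move: H2 H3 H4 H5; vm_compute | idtac].
by left; congr sector; apply/val_inj.
Qed.

Lemma convex_corner A : convex_type A -> 3 \notin A -> 4 \notin A -> 5 \notin A ->
  [\/ A = sector 0 2, A = sector 1 2 | A = sector 0 3].
Proof.
move/convex_typeP => [->|[i [n [Hn ->]]]]; first by rewrite !inE.
rewrite !inE; move: n Hn => [|[|[|[|[|]]]]] // _; cases6 i => H2 H3 H4.
all: first [ by exfalso; move: H2 H3 H4; vm_compute | idtac].
- by apply: Or31; congr sector; apply/val_inj.
- by apply: Or32; congr sector; apply/val_inj.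
- by apply: Or33; congr sector; apply/val_inj.
Qed.

Section Geometry.
Variable S : {fset node}.

Definition nbr (z : node) : {set 'Z_6} := [set d | z + dir d \in S].

Definition is_region (v : node) (c : 'Z_6) (s : bool) (A B : nat) : Prop :=
  forall x y : int, (pt v c s (x, y) \in S) = (0 <= x <= A%:Z) && (0 <= y <= B%:Z).

Definition walk (v : node) (t : 'Z_6) (j : nat) : node := v + dir t *+ j.

Definition is_side (v : node) (t : 'Z_6) (m : nat) : Prop :=
  [/\ (0 < m)%N, forall j, (j <= m)%N -> walk v t j \in S,
      forall j, (0 < j < m)%N -> [/\ #|nbr (walk v t j)| = 4,
         is_end (nbr (walk v t j)) t & is_end (nbr (walk v t j)) (t + 3)],
      is_end (nbr v) t && (#|nbr v| < 4)%N &
      is_end (nbr (walk v t m)) (t + 3) && (#|nbr (walk v t m)| < 4)%N].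

Section Frame.
Variables (v : node) (c : 'Z_6) (s : bool).

Definition inS (x y : int) : bool := pt v c s (x, y) \in S.
Definition rnbr (x y : int) : {set 'Z_6} := pre s c (nbr (pt v c s (x, y))).

Lemma in_rnbr x y j : (j \in rnbr x y) = inS (x + (dir j).1) (y + (dir j).2).
Proof. by rewrite !inE -pt_dir. Qed.

Lemma rnbrE x y : ((0 \in rnbr x y) = inS (x + 1) y) * ((1 \in rnbr x y) = inS x (y + 1)) *
  ((2 \in rnbr x y) = inS (x - 1) (y + 1)) * ((3 \in rnbr x y) = inS (x - 1) y) *
  ((4 \in rnbr x y) = inS x (y - 1)) * ((5 \in rnbr x y) = inS (x + 1) (y - 1)).
Proof. by rewrite !in_rnbr /= ?addr0. Qed.

Lemma pt_row (x : nat) y z : pt v c s (y + x%:Z, z) = walk (pt v c s (y, z)) c x.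
Proof.
have -> : (y + x%:Z, z) = (y, z) + dir 0 *+ x :> node.
  rewrite pmulrn mulrz_pair /= -[RHS]/(_, _) /= !mulrzz mul1r mul0r addr0.
  by [].
by rewrite /pt tiltD addrA pmulrn tiltZ -pmulrn tilt_dir turn0.
Qed.

Lemma infinite_row (x y : int) : ~ (forall j : nat, inS (x + j%:Z) y).
Proof.
move=> H.
have Hi : injective (fun j : 'I_#|` S|.+1 => [` H j]%fset : S).
  move=> i j /(congr1 val) /= /pt_inj/(congr1 fst)/= /addrI [] /val_inj; exact.
have := leq_card _ Hi; rewrite card_ord -cardfE ltnn; exact.
Qed.

Hypothesis Hconv : forall z, z \in S -> convex_type (nbr z).

Lemma rnbr_convex x y : inS x y -> convex_type (rnbr x y).
Proof. by move=> H; apply/convex_type_pre/Hconv. Qed.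

Lemma end_rnbr x y j : is_end (nbr (pt v c s (x, y))) (turn s c j) = is_end (rnbr x y) j.
Proof. by rewrite is_end_pre. Qed.

Lemma card_rnbr x y : #|nbr (pt v c s (x, y))| = #|rnbr x y|.
Proof. by rewrite card_pre. Qed.

Lemma in_sector i n m : (m \in sector i n) = (nat_of_ord (m - i)%R < n)%N.
Proof. by rewrite inE. Qed.

(** [Q j] is what is known on arriving at [j] from the left. It passes to the next node as long as
    the neighbourhood is that of a straight side, and finiteness of the structure forces a corner
    eventually. *)
Lemma bottom_run : inS 0 0 -> 0 \in rnbr 0 0 -> 1 \in rnbr 0 0 -> 5 \notin rnbr 0 0 ->
  exists m : nat, [/\ (0 < m)%N, forall j : nat, (j <= m)%N -> inS j 0,
    forall j : nat, (0 < j < m)%N -> rnbr j 0 = sector 0 4 &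
    rnbr m 0 = sector 1 3 \/ rnbr m 0 = sector 2 2].
Proof.
rewrite !rnbrE !add0r => H0 H10 H01 Hm.
pose Q (j : nat) := [/\ inS j 0, inS (j%:Z - 1) 0, inS (j%:Z - 1) 1 & ~~ inS j (- 1)].
have Q1 : Q 1%N by split.
have Qcase j : Q j -> [\/ rnbr j 0 = sector 2 2, rnbr j 0 = sector 1 3 | rnbr j 0 = sector 0 4].
  by case=> Hj H3 H2 H4; apply: convex_234; rewrite ?rnbrE ?add0r //; apply: rnbr_convex.
have Qnext j : Q j -> rnbr j 0 = sector 0 4 -> Q j.+1.
  move=> [Hj _ _ _] E; have -> : Q j.+1 = [/\ inS (j%:Z + 1) 0, inS j 0, inS j 1 & ~~ inS (j%:Z + 1) (-1)].
    have -> : j%:Z + 1 = j.+1%:Z by lia.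
    by rewrite /Q; have -> : j.+1%:Z - 1 = j by lia.
  have := rnbrE j 0; rewrite !add0r E !in_sector => H.
  by split; rewrite -?H.
have Qall j : (forall i, (0 < i <= j)%N -> rnbr i 0 = sector 0 4) -> forall i, (0 < i <= j.+1)%N -> Q i.
  move=> H; elim=> [//|[|i] IH] Hi //.
  by apply: Qnext; [apply: IH; lia | apply: H; lia].
have Hex : exists m, (0 < m)%N && (rnbr m 0 != sector 0 4).
  apply: contrapT => Hno; apply: (@infinite_row 0 0) => -[|j]; rewrite add0r //.
  have [] // : Q j.+1; apply: (Qall j) => [i /andP[Hi _]|]; last by rewrite leqnn.
  by apply/eqP/negPn/negP => Hi'; apply: Hno; exists i; rewrite Hi.
have [m /andP[Hm0 Hm1] Hmin] := ex_minnP Hex.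
have Hlt i : (0 < i < m)%N -> rnbr i 0 = sector 0 4.
  move=> /andP[Hi0 Him]; apply/eqP; apply: contraTT Him => Hi.
  by rewrite -leqNgt; apply: Hmin; rewrite Hi0.
have HQ i : (0 < i <= m)%N -> Q i.
  move=> Hi; apply: (Qall m.-1); last lia.
  by move=> i' Hi'; apply: Hlt; lia.
exists m; split => //.
- by move=> [|j] Hj //; have [] : Q j.+1 by apply: HQ.
- have /Qcase[] : Q m by apply: HQ; rewrite Hm0 leqnn.
  + by right. + by left. + by move=> E; rewrite E eqxx in Hm1.
Qed.

Lemma walk_pt j y z : walk (pt v c s (y, z)) c j = pt v c s (y + j%:Z, z).
Proof. by rewrite pt_row. Qed.

Lemma sector_end :
  (is_end (sector 0 2) 0 * is_end (sector 0 2) 1) *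
  (is_end (sector 0 3) 0 * is_end (sector 0 3) 2) *
  (is_end (sector 0 4) 0 * is_end (sector 0 4) 3) *
  (is_end (sector 1 3) 1 * is_end (sector 1 3) 3) * (is_end (sector 2 2) 3).
Proof. by rewrite /is_end !in_sector; do !split; vm_compute. Qed.

Lemma bottom_side m : inS 0 0 -> is_end (rnbr 0 0) 0 -> (#|rnbr 0 0| < 4)%N -> (0 < m)%N ->
  (forall j : nat, (j <= m)%N -> inS j 0) ->
  (forall j : nat, (0 < j < m)%N -> rnbr j 0 = sector 0 4) ->
  rnbr m 0 = sector 1 3 \/ rnbr m 0 = sector 2 2 ->
  is_side (pt v c s (0, 0)) c m.
Proof.
move=> H0 H1 H2 Hm HS Hmid Hend.
have end0 x y : is_end (nbr (pt v c s (x, y))) c = is_end (rnbr x y) 0.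
  by rewrite -end_rnbr turn0.
have end3 x y : is_end (nbr (pt v c s (x, y))) (c + 3) = is_end (rnbr x y) 3.
  by rewrite -end_rnbr; congr is_end; rewrite -{2}[3]add0r turn_add3 turn0.
split => //.
- by move=> j Hj; rewrite walk_pt add0r; exact: HS.
- move=> j Hj; rewrite walk_pt add0r card_rnbr end0 end3 Hmid // card_sector //.
  by split; rewrite ?sector_end.
- by rewrite card_rnbr H2 end0 H1.
- rewrite walk_pt add0r card_rnbr end3.
  by case: Hend => ->; rewrite card_sector // sector_end.
Qed.
End Frame.

Lemma inS_swap v c s x y : inS v (turn s c 1) (~~ s) x y = inS v c s y x.
Proof. by rewrite /inS pt_swap. Qed.

Lemma leave_box (a b A B : nat) (d e : int) : (a <= A)%N -> (b <= B)%N ->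
  -1 <= d <= 1 -> -1 <= e <= 1 ->
  ~~ ((0 <= a%:Z + d <= A%:Z) && (0 <= b%:Z + e <= B%:Z)) ->
  (d = 1 /\ a = A) \/ (d = -1 /\ a = 0%N) \/ (e = 1 /\ b = B) \/ (e = -1 /\ b = 0%N).
Proof. lia. Qed.

(** * From the local tests to a parallelogram *)

Section Soundness.
Hypothesis HS : connected_structure S.
Hypothesis Hconv : forall z, z \in S -> convex_type (nbr z).
Hypothesis Hside : forall v t m, is_side v t m -> #|nbr v| != #|nbr (walk v t m)|.

(** By [Hside] both sides that start at the acute corner end at obtuse corners, which fixes [A] and
    [B]. The rows are then filled from below, each from left to right, and connectedness excludes
    all nodes outside the box. *)
Lemma acute_frame_region v c s : inS v c s 0 0 -> rnbr v c s 0 0 = sector 0 2 ->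
  exists A B : nat, [/\ (0 < A)%N, (0 < B)%N & is_region v c s A B].
Proof.
move=> H00 E00.
have run d r : inS v d r 0 0 -> rnbr v d r 0 0 = sector 0 2 -> exists m : nat, [/\ (0 < m)%N,
    forall j : nat, (j <= m)%N -> inS v d r j 0,
    forall j : nat, (0 < j < m)%N -> rnbr v d r j 0 = sector 0 4 & rnbr v d r m 0 = sector 1 3].
  move=> H0 E0; have [|||m [m0 H1 H2 H3]] := bottom_run Hconv H0; try by rewrite E0 in_sector.
  exists m; split => //; case: H3 => // H3.
  have := @bottom_side v d r m H0; rewrite E0 card_sector // sector_end => /(_ isT isT m0 H1 H2 (or_intror H3)) /Hside.
  by rewrite walk_pt add0r !card_rnbr E0 H3 !card_sector.
have [A [A0 HA1 HA2 HA3]] := run c s H00 E00.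
pose c' := turn s c 1; pose s' := ~~ s.
have H00' : inS v c' s' 0 0 by rewrite inS_swap.
have swapE x y j : (j \in rnbr v c' s' x y) = (1 - j \in rnbr v c s y x).
  rewrite !in_rnbr inS_swap; congr inS; congr (_ + _); cases6 j; calc6.
have E00' : rnbr v c' s' 0 0 = sector 0 2.
  apply/setP => j; rewrite swapE E00 !in_sector; cases6 j; calc6.
have [B [B0 HB1 HB2 HB3]] := run c' s' H00' E00'.
have caseD w d (r : bool) M : (forall j : nat, (0 < j < M)%N -> rnbr w d r j 0 = sector 0 4) ->
    rnbr w d r M 0 = sector 1 3 -> rnbr w d r 0 0 = sector 0 2 -> forall j : nat, (j <= M)%N ->
    [/\ inS w d r j 1, ~~ inS w d r j (-1), ~~ inS w d r (j%:Z + 1) (-1) &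
       (j < M)%N = inS w d r (j%:Z + 1) 0].
  move=> H1 H2 H3 j Hj; have := rnbrE w d r j 0; rewrite add0r sub0r => R.
  have [E|[E|E]] : j = 0%N \/ (0 < j < M)%N \/ j = M by lia.
  - have M0 : (0 < M)%N.
      by case: M H1 H2 Hj => // _; rewrite H3 => /setP/(_ 0); rewrite !in_sector.
    by rewrite E in R *; rewrite H3 !in_sector in R; split; rewrite -?R // M0.
  - by rewrite H1 // !in_sector in R; case/andP: E => _ ->; split; rewrite -?R.
  - by rewrite E in R *; rewrite H2 !in_sector in R; rewrite ltnn; split; rewrite -?R.
have bot := caseD v c s A HA2 HA3 E00.
have left b : (b <= B)%N -> [/\ inS v c s 0 b, ~~ inS v c s (-1) b, ~~ inS v c s (-1) (b%:Z + 1) &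
    (b < B)%N = inS v c s 0 (b%:Z + 1)].
  move=> Hb; have [] := caseD v c' s' B HB2 HB3 E00' b Hb; rewrite !inS_swap => _ -> -> ->; split => //.
  by have := HB1 b Hb; rewrite inS_swap.
pose top (b : nat) := forall a : nat, (a <= A)%N -> inS v c s a (b%:Z + 1) = (b < B)%N.
pose row (b : nat) := [/\ forall a : nat, (a <= A)%N -> inS v c s a b,
   ~~ inS v c s (A%:Z + 1) b, top b & ((0 < b < B)%N -> rnbr v c s A b = sector 1 4)].
have rows b : (b <= B)%N -> forall b', (b' <= b)%N -> row b'.
  elim: b => [|b IH] Hb b'.
    rewrite leqn0 => /eqP ->; split => //.
    - by have [_ _ _ <-] := bot A (leqnn A); rewrite ltnn.
    - by move=> a Ha; rewrite B0; have [] := bot a Ha.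
  rewrite leq_eqVlt => /orP[/eqP -> {b'}|]; last by apply: IH; exact: ltnW.
  have [R1 R2 R3 R4] := IH (ltnW Hb) b (leqnn b).
  have E1 : b.+1%:Z = b%:Z + 1 by lia.
  have E2 : b.+1%:Z - 1 = b%:Z by lia.
  have P1 (a : nat) : (a <= A)%N -> inS v c s a b.+1 by move=> Ha; rewrite E1 R3.
  have T1 (a : nat) : (a < A)%N -> inS v c s a (b.+1%:Z + 1) = (b.+1 < B)%N.
    elim: a => [|a IHa] Ha; first by have [] := left b.+1 Hb.
    have F1 : a.+1%:Z - 1 = a by lia.
    have F2 : a.+1%:Z + 1 = a.+2 by lia.
    have := rnbrE v c s a.+1 b.+1; rewrite E2 F1 F2 P1 // P1; last lia.
    rewrite R1; last lia. rewrite R1; last lia. rewrite IHa; last lia. move=> R.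
    (* With these four neighbours present, the two upper ones are both present or both absent; so
       the left end of the row decides whether a further row exists. *)
    have [||||E|E] := convex_3450 (rnbr_convex Hconv (P1 a.+1 (ltnW Ha))); rewrite ?R //.
      by move: R; rewrite E !in_sector => -[[[[[_ H1] H2] _] _] _]; rewrite -H1 -H2.
    by move: R; rewrite E !inE => -[[[[[_ H1] H2] _] _] _]; rewrite -H1 -H2.
  have F1 : A%:Z - 1 = A.-1 by lia.
  have := rnbrE v c s A b.+1; rewrite E2 F1 (negPf R2) (P1 A.-1); last lia. rewrite R1 // (T1 A.-1); last lia. move=> R.
  (* Otherwise the side from the obtuse corner [(A, 0)] would stop here at a second obtuse
     corner. *)
  have corner : rnbr v c s A b.+1 = sector 2 3 -> False.
    move=> E.
    have wE j : walk (pt v c s (A%:Z, 0)) (turn s c 1) j = pt v c s (A%:Z, j%:Z).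
      by rewrite -(pt_swap v c s 0 A%:Z) walk_pt pt_swap add0r.
    have e1 x y : is_end (nbr (pt v c s (x, y))) (turn s c 1) = is_end (rnbr v c s x y) 1.
      by rewrite end_rnbr.
    have e4 x y : is_end (nbr (pt v c s (x, y))) (turn s c 1 + 3) = is_end (rnbr v c s x y) 4.
      by rewrite -end_rnbr -turn_add3; congr is_end; congr turn; exact/val_inj.
    have : is_side (pt v c s (A%:Z, 0)) (turn s c 1) b.+1.
      split => //.
      - move=> j Hj; rewrite wE; move: Hj; rewrite leq_eqVlt => /orP[/eqP ->|Hj]; first exact: P1.
        by have [H _ _ _] := IH (ltnW Hb) j Hj; exact: H.
      - move=> j Hj; rewrite wE e1 e4 card_rnbr.
        have Hj' : (j <= b)%N by lia.
        have [_ _ _ ->] := IH (ltnW Hb) j Hj'; last lia.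
        by rewrite card_sector //; split; rewrite // /is_end !in_sector; vm_compute.
      - by rewrite e1 card_rnbr HA3 card_sector // sector_end.
      - by rewrite wE e4 card_rnbr E card_sector // /is_end !in_sector; vm_compute.
    by move/Hside; rewrite wE !card_rnbr E HA3 !card_sector.
  have [|||E|E|E] := convex_345 (rnbr_convex Hconv (P1 A (leqnn A))); rewrite ?R //.
  - move: R; rewrite E !in_sector => -[[[[[H0 H1] H2] _] _] _]; split => //.
    + by rewrite -H0.
    + move=> a; rewrite leq_eqVlt => /orP[/eqP ->|]; last exact: T1.
      by rewrite -H1 -H2.
    + by rewrite -H2 andbF.
  - move: R; rewrite E !in_sector => -[[[[[H0 H1] H2] _] _] _]; split => //.
    + by rewrite -H0.
    + move=> a; rewrite leq_eqVlt => /orP[/eqP ->|]; last exact: T1.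
      by rewrite -H1 -H2.
have {}rows b : (b <= B)%N -> row b by move=> Hb; apply: (rows b Hb).
have inR (a b : nat) : (a <= A)%N -> (b <= B)%N -> inS v c s a b.
  by move=> Ha Hb; have [H _ _ _] := rows b Hb; exact: H.
pose R (z : node) := (0 <= z.1 <= A%:Z) && (0 <= z.2 <= B%:Z).
(* No step within the structure leaves the box, so a path from the corner to any node stays
   inside. *)
have closed z j : R z -> pt v c s (z + dir j) \in S -> R (z + dir j).
  case: z => x y /andP[/= Hx Hy].
  have [a Ea] : exists a : nat, x = a by exists `|x|%N; lia.
  have [b Eb] : exists b : nat, y = b by exists `|y|%N; lia.
  rewrite {x}Ea {y}Eb in Hx Hy *.
  have Ha : (a <= A)%N by lia.
  have Hb : (b <= B)%N by lia.
  have [_ L2 L3 _] := left b Hb; have [_ B2 B3 _] := bot a Ha.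
  have [_ R2 R3 _] := rows b Hb.
  have E x y x' y' : (x, y) + (x', y') = (x + x', y + y') :> node by [].
  move=> Hin; apply: contraT; move: Hin; rewrite [dir j]surjective_pairing E -/(inS _ _ _ _ _) /R /=.
  move=> Hin Hout; have := leave_box Ha Hb _ _ Hout; move: Hin; clear Hout.
  cases6 j; rewrite /= ?addr0 => Hin /(_ isT isT) [[]|[[]|[[]|[]]]] // _ E0.
  - by rewrite E0 (negPf R2) in Hin.
  - by rewrite R3 // E0 ltnn in Hin.
  - by rewrite E0 add0r (negPf L3) in Hin.
  - case: (posnP a) => [Ea|Ea]; first by rewrite Ea add0r (negPf L3) in Hin.
    by rewrite -predn_int // R3 ?E0 ?ltnn // in Hin; apply: leq_trans Ha; exact: leq_pred.
  - by rewrite E0 add0r (negPf L2) in Hin.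
  - by rewrite E0 add0r (negPf B2) in Hin.
  - case: (posnP b) => [Eb|Eb]; first by rewrite Eb add0r (negPf B3) in Hin.
    have [_ R2' _ _] : row b.-1 by apply: rows; apply: leq_trans Hb; exact: leq_pred.
    by rewrite -predn_int // E0 (negPf R2') in Hin.
  - by rewrite E0 add0r (negPf B3) in Hin.
exists A, B; split => // x y; apply/idP/idP => [Hin|/andP[Hx Hy]]; last first.
  have -> : x = `|x|%N by lia.
  have -> : y = `|y|%N by lia.
  by apply: inR; lia.
have [_ /(_ [` H00]%fset [` Hin]%fset) /connectP[p]] := HS.
have main : forall p (w : S) z, val w = pt v c s z -> R z ->
    path (fun x y : S => adjacent (val x) (val y)) w p ->
    forall z', val (last w p) = pt v c s z' -> R z'.
  elim=> [|w' p' IHp] w z Hw Hz /=; first by move=> _ z'; rewrite Hw => /pt_inj <-.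
  move=> /andP[/existsP[d /eqP Hd] Hp]; rewrite -/(val _) in Hd.
  have E : val w' = pt v c s (z + dir (turnV s c d)) by rewrite pt_dir turnVK -Hw; exact: Hd.
  apply: (IHp w' (z + dir (turnV s c d))) => //.
  by apply: closed => //; rewrite -E; exact: valP.
move=> Hp Hl; apply: (main p [` H00]%fset (0, 0) _ _ Hp (x, y)) => //.
by rewrite -Hl.
Qed.

Lemma pt00 v c s : pt v c s (0, 0) = v.
Proof. by rewrite /pt /tilt /= !mulr0z !addr0. Qed.

Lemma acute_region w i : w \in S -> nbr w = sector i 2 ->
  exists c s (A B : nat), [/\ (0 < A)%N, (0 < B)%N & is_region w c s A B].
Proof.
move=> Hw E; exists i, false; apply: acute_frame_region; first by rewrite /inS pt00.
by rewrite /rnbr pt00 E pre_sector // /turnV subrr.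
Qed.

(** The leftmost node of the lowest row. *)
Lemma corner_exists : exists2 z, z \in S & [/\ 3 \notin nbr z, 4 \notin nbr z & 5 \notin nbr z].
Proof.
have [/fset0Pn[z0 Hz0] _] := HS.
case: (Order.TotalTheory.arg_minP (fun u : S => (val u).2) (isT : predT [` Hz0]%fset)) => z1 _ H1.
case: (Order.TotalTheory.arg_minP (fun u : S => (val u).1)
  (eqxx _ : [pred u : S | (val u).2 == (val z1).2] z1)) => z2 /eqP E2 H2.
exists (val z2); first exact: valP.
have not_in d : (dir d).2 < 0 \/ (dir d).2 = 0 /\ (dir d).1 < 0 -> d \notin nbr (val z2).
  move=> Hd; apply/negP; rewrite inE => Hin.
  case: Hd => [Hd|[Hd2 Hd1]].
    have /= := H1 [` Hin]%fset isT; by rewrite -E2 lerDl leNgt Hd.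
  have /= := H2 [` Hin]%fset.
  by rewrite Hd2 addr0 E2 eqxx lerDl leNgt Hd1 => /(_ isT).
by split; apply: not_in; [right | left | left].
Qed.

(** If the lowest leftmost corner is obtuse, the other end of its bottom side is of the other kind,
    hence acute, and serves as origin instead. *)
Lemma convex_region : exists v c s (A B : nat), [/\ (0 < A)%N, (0 < B)%N & is_region v c s A B].
Proof.
have [z Hz [H3 H4 H5]] := corner_exists.
have [E|E|E] := convex_corner (Hconv Hz) H3 H4 H5; try by exists z; apply: acute_region E.
have H00 : inS z 0 false 0 0 by rewrite /inS pt00.
have E00 : rnbr z 0 false 0 0 = sector 0 3 by rewrite /rnbr pt00 E pre_sector.
have [|||m [m0 H1 H2 Hm]] := bottom_run Hconv H00; try by rewrite E00 in_sector.
have := @bottom_side z 0 false m H00; rewrite E00 card_sector // sector_end => /(_ isT isT m0 H1 H2 Hm) /Hside.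
rewrite walk_pt add0r !card_rnbr E00 card_sector //.
case: Hm => Hm; rewrite Hm card_sector // => _.
exists (pt z 0 false (m%:Z, 0)); apply: (@acute_region _ 2); first exact: H1 (leqnn m).
by rewrite -Hm; apply/setP => j; rewrite !inE /turn add0r.
Qed.
End Soundness.

(** * From a parallelogram to the local tests *)

Section Completeness.

Lemma region_swap v c s A B : is_region v c s A B -> is_region v (turn s c 1) (~~ s) B A.
Proof. by move=> H x y; rewrite pt_swap H andbC. Qed.

Lemma region_rot v c s A B : is_region v c s A B ->
  is_region (pt v c s (A%:Z, B%:Z)) (c + 3) s A B.
Proof.
move=> H x y; rewrite pt_rot -[(_, _) - (_, _)]/(A%:Z - x, B%:Z - y) H; lia.
Qed.

Variables (v : node) (c : 'Z_6) (s : bool) (A B : nat).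
Hypothesis HR : is_region v c s A B.
Hypothesis A0 : (0 < A)%N.
Hypothesis B0 : (0 < B)%N.

Lemma region_rnbr x y : ((0 \in rnbr v c s x y) = (0 <= x + 1 <= A%:Z) && (0 <= y <= B%:Z)) *
  ((1 \in rnbr v c s x y) = (0 <= x <= A%:Z) && (0 <= y + 1 <= B%:Z)) *
  ((2 \in rnbr v c s x y) = (0 <= x - 1 <= A%:Z) && (0 <= y + 1 <= B%:Z)) *
  ((3 \in rnbr v c s x y) = (0 <= x - 1 <= A%:Z) && (0 <= y <= B%:Z)) *
  ((4 \in rnbr v c s x y) = (0 <= x <= A%:Z) && (0 <= y - 1 <= B%:Z)) *
  ((5 \in rnbr v c s x y) = (0 <= x + 1 <= A%:Z) && (0 <= y - 1 <= B%:Z)).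
Proof. by rewrite !rnbrE /inS !HR. Qed.

Lemma set6P (X Y : {set 'Z_6}) : (0 \in X) = (0 \in Y) -> (1 \in X) = (1 \in Y) ->
  (2 \in X) = (2 \in Y) -> (3 \in X) = (3 \in Y) -> (4 \in X) = (4 \in Y) ->
  (5 \in X) = (5 \in Y) -> X = Y.
Proof.
move=> H0 H1 H2 H3 H4 H5; apply/setP => j.
have [->|[->|[->|[->|[->| ->]]]]] // : j = 0 \/ j = 1 \/ j = 2 \/ j = 3 \/ j = 4 \/ j = 5.
cases6 j; [left|right; left|do 2 right; left|do 3 right; left|do 4 right; left|do 5 right]; exact/val_inj.
Qed.

Ltac eval_rhs := match goal with |- _ = ?r =>
  let b := eval vm_compute in r in (have -> : r = b by vm_compute) end.

Lemma region_corner00 : rnbr v c s 0 0 = sector 0 2.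
Proof. by apply: set6P; rewrite region_rnbr in_sector; eval_rhs; lia. Qed.

Lemma region_cornerA0 : rnbr v c s A 0 = sector 1 3.
Proof. by apply: set6P; rewrite region_rnbr in_sector; eval_rhs; lia. Qed.

Lemma region_bottom (a : nat) : (0 < a < A)%N -> rnbr v c s a 0 = sector 0 4.
Proof. by move=> Ha; apply: set6P; rewrite region_rnbr in_sector; eval_rhs; lia. Qed.

Lemma region_inner (a b : nat) : (0 < a < A)%N -> (0 < b < B)%N -> rnbr v c s a b = setT.
Proof. by move=> Ha Hb; apply: set6P; rewrite region_rnbr inE; lia. Qed.

Lemma region_bottom_side : is_side v c A.
Proof.
rewrite -{1}(pt00 v c s); apply: bottom_side => //.
- by rewrite /inS HR; lia.
- by rewrite region_corner00 sector_end.
- by rewrite region_corner00 card_sector.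
- by move=> j Hj; rewrite /inS HR; lia.
- exact: region_bottom.
- by left; exact: region_cornerA0.
Qed.
End Completeness.

Lemma walk_back v t m j : (j <= m)%N -> walk (walk v t m) (t + 3) j = walk v t (m - j).
Proof.
move=> Hj; rewrite /walk dir_add3 -addrA mulNrn -mulrnBr //.
Qed.

Lemma is_side_rev v t m : is_side v t m -> is_side (walk v t m) (t + 3) m.
Proof.
case=> m0 H1 H2 H3 H4; split => //.
- by move=> j Hj; rewrite walk_back // H1 // leq_subr.
- move=> j Hj; rewrite walk_back; last lia.
  have Hm : (0 < m - j < m)%N by lia.
  by have [E1 E2 E3] := H2 _ Hm; split; rewrite // add33.
- by rewrite walk_back // subnn /walk mulr0n addr0 add33.
Qed.

(* Up to the symmetries of the parallelogram, a node is its corner [(0, 0)] or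
   [(A, 0)], an interior node of its bottom side, or an interior node. *)
Lemma region_cases v c s (A B : nat) z : is_region v c s A B -> (0 < A)%N -> (0 < B)%N -> z \in S ->
  exists v' c' s' (A' B' : nat), [/\ is_region v' c' s' A' B', (0 < A')%N, (0 < B')%N &
   [\/ z = pt v' c' s' (0, 0), z = pt v' c' s' (A'%:Z, 0),
       exists2 a : nat, (0 < a < A')%N & z = pt v' c' s' (a%:Z, 0) |
       exists a b : nat, [/\ (0 < a < A')%N, (0 < b < B')%N & z = pt v' c' s' (a%:Z, b%:Z)]]].
Proof.
move=> HR A0 B0 Hz; have [[x y] Ez] := pt_surj v c s z; rewrite Ez in Hz.
have Hr := HR x y; rewrite Hz in Hr.
have [a Ea] : exists a : nat, x = a by exists `|x|%N; lia.
have [b Eb] : exists b : nat, y = b by exists `|y|%N; lia.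
rewrite Ea Eb in Ez Hr; clear Ea Eb Hz x y.
have R2 := region_swap HR; have R3 := region_rot HR; have R4 := region_swap R3.
have [[E1 E2]|[[E1 E2]|[[E1 E2]|[[E1 E2]|[[E1 E2]|[[E1 E2]|[[E1 E2]|[[E1 E2]|[E1 E2]]]]]]]]] :
  (a = 0 /\ b = 0)%N \/ (a = A /\ b = 0)%N \/ (a = 0 /\ b = B)%N \/ (a = A /\ b = B)%N \/
  ((0 < a < A)%N /\ b = 0%N) \/ ((0 < a < A)%N /\ b = B) \/
  (a = 0%N /\ (0 < b < B)%N) \/ (a = A /\ (0 < b < B)%N) \/ ((0 < a < A)%N /\ (0 < b < B)%N) by lia.
- by exists v, c, s, A, B; split => //; apply: Or41; rewrite Ez E1 E2.
- by exists v, c, s, A, B; split => //; apply: Or42; rewrite Ez E1 E2.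
- exists v, (turn s c 1), (~~ s), B, A; split => //; apply: Or42.
  by rewrite Ez E1 E2 pt_swap.
- exists (pt v c s (A%:Z, B%:Z)), (c + 3), s, A, B; split => //; apply: Or41.
  by rewrite Ez E1 E2 pt00.
- by exists v, c, s, A, B; split => //; apply: Or43; exists a; rewrite // Ez E2.
- exists (pt v c s (A%:Z, B%:Z)), (c + 3), s, A, B; split => //; apply: Or43; exists (A - a)%N; first lia.
  by rewrite Ez E2 pt_rot /=; congr pt; congr pair => /=; lia.
- exists v, (turn s c 1), (~~ s), B, A; split => //; apply: Or43; exists b => //.
  by rewrite Ez E1 pt_swap.
- exists (pt v c s (A%:Z, B%:Z)), (turn s (c + 3) 1), (~~ s), B, A; split => //; apply: Or43; exists (B - b)%N; first lia.
  by rewrite Ez E1 pt_swap pt_rot /=; congr pt; congr pair => /=; lia.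
- by exists v, c, s, A, B; split => //; apply: Or44; exists a, b.
Qed.

Lemma rnbr_full v c s x y n : #|rnbr v c s x y| = n -> #|nbr (pt v c s (x, y))| = n.
Proof. by rewrite card_pre. Qed.

Lemma region_convex v c s (A B : nat) z : is_region v c s A B -> (0 < A)%N -> (0 < B)%N -> z \in S ->
  convex_type (nbr z).
Proof.
move=> HR A0 B0 Hz.
have sec w d r x y i n : (1 < n < 5)%N -> rnbr w d r x y = sector i n -> convex_type (nbr (pt w d r (x, y))).
  move=> Hn E; have -> : nbr (pt w d r (x, y)) = pre r (turnV r d 0) (rnbr w d r x y).
    apply/setP => m; rewrite !inE turnA addbb.
    by have -> : turn r d (turnV r d 0) = 0 by [exact: turnVK]; rewrite /turn add0r.
  by rewrite E; apply: convex_type_pre; apply/convex_typeP; right; exists i, n.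
have [v' [c' [s' [A' [B' [HR' A0' B0']]]]]] := region_cases HR A0 B0 Hz.
case=> [->|->|[a Ha ->]|[a [b [Ha Hb ->]]]].
- exact: (sec _ _ _ _ _ _ 2%N _ (region_corner00 HR' A0' B0')).
- exact: (sec _ _ _ _ _ _ 3%N _ (region_cornerA0 HR' A0' B0')).
- exact: (sec _ _ _ _ _ _ 4%N _ (region_bottom HR' A0' B0' Ha)).
- apply/convex_typeP; left; apply/setP => m; rewrite [RHS]inE.
  have := region_inner HR' A0' B0' Ha Hb => /setP/(_ (turnV s' c' m)).
  by rewrite !inE turnVK.
Qed.

Lemma region_corner_cards v c s (A B : nat) : is_region v c s A B -> (0 < A)%N -> (0 < B)%N ->
  #|nbr v| = 2 /\ #|nbr (walk v c A)| = 3.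
Proof.
move=> HR A0 B0; rewrite -{1 2}(pt00 v c s) walk_pt add0r.
by split; apply: rnbr_full; rewrite ?(region_corner00 HR) ?(region_cornerA0 HR) // card_sector.
Qed.

Lemma end_sector_cases i n j : is_end (sector i n) j -> (1 < n < 5)%N -> j = i \/ j = i + n.-1%:R.
Proof.
rewrite /is_end !in_sector => /andP[H1 H2] Hn.
have : j - i = 0 \/ j - i = n.-1%:R.
  move: H1 H2; have -> : j + 1 - i = j - i + 1 by ring.
  have -> : j - 1 - i = j - i - 1 by ring.
  move: (j - i) => x; move: n Hn => [|[|[|[|[|]]]]] // _; cases6 x => H1 H2;
  first [ by exfalso; move: H1 H2; vm_compute | by left; apply/val_inj | by right; apply/val_inj].
by case=> [/eqP|/eqP]; rewrite subr_eq => /eqP ->; [left; rewrite add0r | right; rewrite addrC].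
Qed.

Lemma region_sides v c s (A B : nat) z t : is_region v c s A B -> (0 < A)%N -> (0 < B)%N -> z \in S ->
  (#|nbr z| < 4)%N -> is_end (nbr z) t ->
  exists2 m, is_side z t m & #|nbr z| != #|nbr (walk z t m)|.
Proof.
move=> HR A0 B0 Hz Hc Ht.
have [v' [c' [s' [A' [B' [HR' A0' B0']]]]]] := region_cases HR A0 B0 Hz.
pose j := turnV s' c' t; have Et : t = turn s' c' j by rewrite turnVK.
have Hbot := region_bottom_side HR' A0' B0'.
have [K1 K2] := region_corner_cards HR' A0' B0'.
case=> [Ez|Ez|[a Ha Ez]|[a [b [Ha Hb Ez]]]].
- move: Ht; rewrite Et Ez end_rnbr (region_corner00 HR') // => /end_sector_cases[] // ->.
    by rewrite pt00 turn0; exists A' => //; rewrite K1 K2.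
  have HR2 := region_swap HR'; have [K3 K4] := region_corner_cards HR2 B0' A0'.
  rewrite pt00 add0r /=; exists B'; first exact: region_bottom_side HR2 B0' A0'.
  by rewrite K3 K4.
- move: Ht; rewrite Et Ez end_rnbr (region_cornerA0 HR') // => /end_sector_cases[] // ->.
    have HR4 := region_swap (region_rot HR').
    have [K3 K4] := region_corner_cards HR4 B0' A0'.
    have HS4 := is_side_rev (region_bottom_side HR4 B0' A0').
    have Ew : walk (pt v' c' s' (A'%:Z, B'%:Z)) (turn s' (c' + 3) 1) B' = pt v' c' s' (A'%:Z, 0).
      rewrite -{1}(pt00 (pt v' c' s' (A'%:Z, B'%:Z)) (turn s' (c' + 3) 1) (~~ s')) walk_pt add0r pt_swap pt_rot;
      by congr pt; congr pair => /=; lia.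
    rewrite Ew in K4; rewrite Ew turn3 add33 in HS4.
    exists B' => //; rewrite K4.
    rewrite -Ew -{1}[turn s' c' 1]add33 -turn3 walk_back // subnn.
    by rewrite [walk _ _ 0]/walk mulr0n addr0 K3.
  have -> : turn s' c' (1 + 3.-1%:R) = c' + 3.
    by case: (s'); rewrite /turn; congr (_ + _); exact/val_inj.
  have Ew : pt v' c' s' (A'%:Z, 0) = walk v' c' A' by rewrite -{2}(pt00 v' c' s') walk_pt add0r.
  rewrite Ew; exists A'; first exact: is_side_rev.
  by rewrite K2 walk_back // subnn [walk _ _ 0]/walk mulr0n addr0 K1.
- by move: Hc; rewrite Ez (rnbr_full (n := 4%N)) // (region_bottom HR') // card_sector.
- move: Hc; rewrite Ez (rnbr_full (n := 6%N)) // (region_inner HR') //.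
  by rewrite cardsT card_ord.
Qed.
End Geometry.

(** * The protocol *)

Section Protocol.
Variables (k0 K0 : nat).
Notation k := k0.+2.
Notation K := K0.+1.
Variables (keep : nat -> bool) (cst : nat -> nat) (cmax : nat).
Variables (iP iM iD iI : 'I_K).

Inductive phase := PStart | PDetect | PAcute | PObtuse | PVeto | PHeads | PTails
  | PNetA | PNetB | PArmA | PArmB | PUpdate | PActive | PResult
  | PInput of 'I_K | PAdd of 'I_K | PWait of bool | PDone of bool.

Definition phase_code (c : phase) : 'I_14 + ('I_K + 'I_K) + (bool + bool) :=
  match c with
  | PStart => inl (inl (inord 0)) | PDetect => inl (inl (inord 1))
  | PAcute => inl (inl (inord 2)) | PObtuse => inl (inl (inord 3))
  | PVeto => inl (inl (inord 4)) | PHeads => inl (inl (inord 5))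
  | PTails => inl (inl (inord 6)) | PNetA => inl (inl (inord 7))
  | PNetB => inl (inl (inord 8)) | PArmA => inl (inl (inord 9))
  | PArmB => inl (inl (inord 10)) | PUpdate => inl (inl (inord 11))
  | PActive => inl (inl (inord 12)) | PResult => inl (inl (inord 13))
  | PInput s => inl (inr (inl s)) | PAdd s => inl (inr (inr s))
  | PWait b => inr (inl b) | PDone b => inr (inr b)
  end.

Definition phase_decode (c : 'I_14 + ('I_K + 'I_K) + (bool + bool)) : phase :=
  match c with
  | inl (inl i) => nth PStart [:: PStart; PDetect; PAcute; PObtuse; PVeto; PHeads; PTails;
      PNetA; PNetB; PArmA; PArmB; PUpdate; PActive; PResult] i
  | inl (inr (inl s)) => PInput s | inl (inr (inr s)) => PAdd s
  | inr (inl b) => PWait b | inr (inr b) => PDone b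
  end.

Lemma phase_codeK : cancel phase_code phase_decode.
Proof. by case => //=; rewrite inordK. Qed.

HB.instance Definition _ := Finite.copy phase (can_type phase_codeK).

(* [alive]: all coins so far were heads; [nb]: edges with a neighbour; [fit]: the
   sides that end here have one acute and one obtuse end; [neta], [netb]: edges
   on the nets of the two arms of the leader; [out]: edge towards the leader, on
   an arm; [rest]: bits still to be read of the constants; [cmp]: for either
   choice of the arm in the role of the height, the carry of the sum to be
   tested, its test for equality, and the comparison of the two lengths. *)
Record state := State {
  ph : phase;
  alive : bool;
  nb : {set 'Z_6};
  fit : bool;
  flip : bool;
  heads : bool;
  lead : bool;
  neta : {set 'Z_6};
  netb : {set 'Z_6};
  out : option 'Z_6;
  xbit : bool;
  carry : {ffun 'I_K -> bool};
  rest : {ffun 'I_K -> 'I_cmax.+1};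
  zbit : {ffun bool * 'I_K -> bool};
  cmp : {ffun bool -> bool * bool * bool} }.

Definition state_code (q : state) := (ph q, alive q, nb q, fit q, flip q, heads q, lead q,
  neta q, netb q, out q, xbit q, carry q, rest q, zbit q, cmp q).

Definition state_decode c := let: (c1, c2, c3, c4, c5, c6, c7, c8, c9, c10, c11, c12, c13, c14, c15) := c in
  State c1 c2 c3 c4 c5 c6 c7 c8 c9 c10 c11 c12 c13 c14 c15.

Lemma state_codeK : cancel state_code state_decode.
Proof. by case. Qed.

HB.instance Definition _ := Finite.copy state (can_type state_codeK).

Definition hears (r : {set label k}) (m : 'Z_6) : bool := (m, pin k0 false) \in r.

Definition arm_label (A : {set 'Z_6}) (b : bool) : 'Z_6 :=
  odflt 0 [pick m | (m \in A) && ((m + 1 \in A) == ~~ b)].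

(** Only amoebots in the interior of a side are wired; corners stay open, so distinct sides have
    distinct circuits. Equal indices give crossing tracks, hence [f] asks for a crossing. *)
Definition track_wires (A : {set 'Z_6}) (f : bool) : {set label k * label k} :=
  if #|A| == 4 then
    [set ab : label k * label k | [&& is_end A ab.1.1, is_end A ab.2.1, ab.1.1 != ab.2.1,
       is_track ab.1.2, is_track ab.2.2 & (ab.1.2 == ab.2.2) == f]]
  else set0.

Definition net_wires : {set label k * label k} :=
  [set ab : label k * label k | odd ab.1.1 == odd ab.2.1].

Definition ends_hear (A : {set 'Z_6}) (r : {set label k}) : bool :=
  [forall m, is_end A m ==> hears r m].

(* The pin of the edge [m] of a boundary amoebot that lies towards the interior
   of the structure if [b] holds, and towards the exterior otherwise. *)
Definition bit_pin (A : {set 'Z_6}) (m : 'Z_6) (b : bool) : label k :=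
  (m, pin k0 ((m + 1 \in A) (+) ~~ b)).

(* Along an arm the bonds belong, starting at the leader, periodically to the
   arm's own net, to the silent net, and to the other arm's net. *)
Definition toward (own oth : {set 'Z_6}) (m m' : 'Z_6) : bool :=
  [|| (m \in oth) && (m' \in own), (m \in own) && (m' \notin oth) |
      (m' \in oth) && (m \notin own)].

(** Inside an arm both edges along it carry the beep of the leader, and the nets have to tell them
    apart. At the obtuse end of the arm only one of the two boundary edges carries it. *)
Definition arm_out (A own oth : {set 'Z_6}) (r : {set label k}) : option 'Z_6 :=
  if #|A| == 4 then [pick m | [&& is_end A m, hears r m & toward own oth m (m + 3)]]
  else if #|A| == 3 then [pick m | is_end A m && hears r m]
  else None.

Definition maj (a b c : bool) : bool := (a && b) || (a && c) || (b && c).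

(** The stages are treated in order for each bit, so the input of stage [s] is the output bit that
    stage [s.-1] has produced in the same pass; no number is ever stored as a whole. *)
Definition in_bit (q : state) (b : bool) (s : 'I_K) : bool :=
  [&& keep s, (0 < s)%N & zbit q (b, inord s.-1)].

Definition flipped (q : state) (s : 'I_K) : bool :=
  (out q != None) && (xbit q (+) carry q s).

Definition wiring (q : state) : {set label k * label k} :=
  match ph q with
  | PStart | PDetect => set0
  | PAcute | PObtuse | PArmA | PArmB | PInput _ => track_wires (nb q) false
  | PAdd s => track_wires (nb q) (flipped q s)
  | PNetA | PNetB => net_wires
  | _ => setT
  end.

Definition all_if (b : bool) : {set label k} := if b then setT else set0.

Definition busy (q : state) : bool :=
  [|| [exists s, carry q s], [exists s, nat_of_ord (rest q s) != 0%N] | [exists b, (cmp q b).1.1]].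

Definition accepts (q : state) : bool := [exists b, (cmp q b).1.2 && (cmp q b).2].

(** In [PAdd s] the obtuse end of an arm is the first adder: it adds the input bit and its carry to
    the current bit of the constant and beeps on the interior track for 1, on the exterior one for
    0. The leader reads the bit after the last adder. *)
Definition beeping (q : state) : {set label k} :=
  match ph q with
  | PDetect => setT
  | PAcute => if #|nb q| == 2 then [set a : label k | a.1 \in nb q] else set0
  | PObtuse => if #|nb q| == 3 then [set a : label k | is_end (nb q) a.1] else set0
  | PVeto => all_if (~~ (fit q && convex_type (nb q)))
  | PHeads => all_if ((#|nb q| == 2) && flip q)
  | PTails => all_if ((#|nb q| == 2) && ~~ flip q)
  | PNetA | PArmA => if lead q then [set a : label k | a.1 == arm_label (nb q) false] else set0
  | PNetB | PArmB => if lead q then [set a : label k | a.1 == arm_label (nb q) true] else set0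
  | PInput s => if lead q then
      [set a : label k | [exists b, (a.1 == arm_label (nb q) b) && in_bit q b s]] else set0
  | PAdd s => if (#|nb q| == 3, out q) is (true, Some m) then
      [set bit_pin (nb q) m (odd (rest q s) (+) xbit q (+) carry q s)] else set0
  | PActive => all_if (busy q)
  | PResult => all_if (lead q && ~~ accepts q)
  | PWait _ => all_if (alive q)
  | _ => set0
  end.

(** The schedule branches only on what is heard on the global circuit, so all amoebots are always in
    the same phase. *)
Definition next_phase (q : state) (r : {set label k}) : phase :=
  let sound := r != set0 in
  match ph q with
  | PStart => PDetect
  | PDetect => PAcute
  | PAcute => PObtuse
  | PObtuse => PVeto
  | PVeto => if sound then PWait false else PHeads
  | PHeads => PTails
  | PTails => if heads q && sound then PNetA else PHeads
  | PNetA => PNetB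
  | PNetB => PArmA
  | PArmA => PArmB
  | PArmB => PInput ord0
  | PInput s => PAdd s
  | PAdd s => if s == ord_max then PUpdate else PInput (inord s.+1)
  | PUpdate => PActive
  | PActive => if sound then PInput ord0 else PResult
  | PResult => PWait (~~ sound)
  | PWait b => if sound then PWait b else PDone b
  | PDone b => PDone b
  end.

Definition next_carry (q : state) (r : {set label k}) (s : 'I_K) : bool :=
  if out q is Some m then
    let sin := if #|nb q| == 3 then odd (rest q s) else bit_pin (nb q) (m + 3) true \in r in
    maj sin (xbit q) (carry q s)
  else carry q s.

(** The arm [b] plays the height and the other one the length. Bits arrive from the least
    significant one, so the latest differing pair decides which length is larger. *)
Definition next_cmp (q : state) (b : bool) : bool * bool * bool :=
  let: (c, e, l) := cmp q b in
  let x := zbit q (b, iM) in let y := zbit q (~~ b, iD) in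
  let u := zbit q (b, iI) in let v := zbit q (~~ b, iI) in
  (maj x y c, e && (x (+) y (+) c == zbit q (b, iP)), if u == v then l else v).

(** One coin per round feeds both [alive] and [flip]; the probabilities of failure are later simply
    added. *)
Definition advance (q : state) (r : {set label k}) (x : bool) : state := {|
  ph := next_phase q r;
  alive := if ph q is PDone _ then alive q else alive q && x;
  nb := if ph q is PDetect then [set m | hears r m] else nb q;
  fit := match ph q with
         | PAcute => (#|nb q| == 3) ==> ends_hear (nb q) r
         | PObtuse => fit q && ((#|nb q| == 2) ==> ends_hear (nb q) r)
         | _ => fit q end;
  flip := match ph q with PVeto | PTails => x | _ => flip q end;
  heads := if ph q is PHeads then r != set0 else heads q;
  lead := if ph q is PTails then (#|nb q| == 2) && flip q else lead q;
  neta := if ph q is PNetA then [set m | hears r m] else neta q;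
  netb := if ph q is PNetB then [set m | hears r m] else netb q;
  out := match ph q with
         | PArmA => arm_out (nb q) (neta q) (netb q) r
         | PArmB => if arm_out (nb q) (netb q) (neta q) r is Some m then Some m else out q
         | _ => out q end;
  xbit := if ph q is PInput _ then (if out q is Some m then hears r m else false) else xbit q;
  carry := match ph q with
           | PArmB => [ffun => false]
           | PAdd s => [ffun s' => if s' == s then next_carry q r s else carry q s']
           | _ => carry q end;
  rest := match ph q with
          | PArmB => [ffun s : 'I_K => inord (cst s)]
          | PUpdate => [ffun s => inord (rest q s)./2]
          | _ => rest q end;
  zbit := match ph q with
          | PArmB => [ffun => false]
          | PAdd s => if lead q then [ffun bs => if bs.2 == s
               then bit_pin (nb q) (arm_label (nb q) bs.1) true \in r else zbit q bs] else zbit q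
          | _ => zbit q end;
  cmp := match ph q with
         | PArmB => [ffun => (false, true, true)]
         | PUpdate => if lead q then [ffun b => next_cmp q b] else cmp q
         | _ => cmp q end |}.

Definition start_state : state := State PStart true set0 true true false false set0 set0 None false
  [ffun => false] [ffun => ord0] [ffun => false] [ffun => (false, true, true)].

Definition decision (q : state) : option bool := if ph q is PDone b then Some b else None.

Lemma start_state_silent : beeping start_state = set0.
Proof. by []. Qed.

Lemma decision_final q : decision q != None ->
  beeping q = set0 /\ forall r x, advance q r x = q.
Proof.
by rewrite /decision; case: q => -[] //= b *; split.
Qed.

Variable R : realType.

Lemma fair_coin_ge0 (x : bool) : 0 <= (2^-1 : R).
Proof. by rewrite invr_ge0 ler0n. Qed.

Lemma fair_coin_sum1 : \sum_(x : bool) (2^-1 : R) = 1.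
Proof. by rewrite big_bool /=; lra. Qed.

Definition detector : protocol R k :=
  @Protocol R k state bool (fun=> 2^-1) fair_coin_ge0 fair_coin_sum1 start_state advance wiring beeping decision
    start_state_silent decision_final.
End Protocol.

(** * Circuits along sides and nets *)

Section Sides.
Variables (k0 : nat) (S : {fset node}) (compass : node -> 'Z_6) (cw : node -> bool).
Notation k := k0.+2.
Notation name := (pin_name S k).
Notation edir := (edge_dir compass cw).
Notation lk := (@lk k0 S compass cw).
Notation heard := (@heard k0 S compass cw).

Definition lab (v : node) : {set 'Z_6} := pre (cw v) (compass v) (nbr S v).

Lemma card_lab v : #|lab v| = #|nbr S v|.
Proof. exact: card_pre. Qed.

Lemma is_end_lab v m : is_end (lab v) m = is_end (nbr S v) (edir v m).
Proof. exact: is_end_pre. Qed.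

Lemma in_lab v m : (m \in lab v) = (edir v m \in nbr S v).
Proof. by rewrite inE. Qed.

Hypothesis Hconv : forall z, z \in S -> convex_type (nbr S z).

Lemma convex_card A : convex_type A -> (#|A| < 4)%N -> #|A| = 2 \/ #|A| = 3.
Proof.
move/convex_typeP => [->|[i [n [Hn ->]]]]; first by rewrite cardsT card_ord.
by rewrite card_sector; lia.
Qed.

Lemma convex_ends4 A t d : convex_type A -> #|A| = 4 -> is_end A t -> is_end A (t + 3) ->
  is_end A d = (d == t) || (d == t + 3).
Proof.
move/convex_typeP => [->|[i [n [Hn ->]]]]; first by rewrite cardsT card_ord.
rewrite card_sector; last lia.
move=> En; rewrite {}En {Hn} => H1 H2; apply/idP/orP => [Hd|[/eqP ->|/eqP ->]] //.
have [] := end_sector_cases H1 isT; have [] := end_sector_cases Hd isT => -> ->; rewrite ?eqxx; try by [left|right].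
by right; have -> : 4.-1%:R = 3 :> 'Z_6 by []; rewrite add33 .
Qed.

Lemma side_nodes v t m : is_side S v t m ->
  exists u : nat -> S, forall j, (j <= m)%N -> val (u j) = walk v t j.
Proof.
case=> _ H _ _ _; exists (fun j => insubd [` H 0%N (leq0n m)]%fset (walk v t j)) => j Hj.
by rewrite val_insubd H.
Qed.

Variables (W : S -> {set label k * label k}) (fl : S -> bool).
Hypothesis HW : forall v, W v = track_wires k0 (lab (val v)) (fl v).

Variables (v : node) (t : 'Z_6) (m : nat) (u : nat -> S).
Hypothesis Hside : is_side S v t m.
Hypothesis Hu : forall j, (j <= m)%N -> val (u j) = walk v t j.

Lemma walkS w d j : walk w d j.+1 = walk w d j + dir d.
Proof. by rewrite /walk mulrSr addrA. Qed.

Lemma walk0 w d : walk w d 0 = w.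
Proof. by rewrite /walk mulr0n addr0. Qed.

Lemma side_step j : (j < m)%N -> val (u j.+1) = val (u j) + dir t.
Proof. by move=> Hj; rewrite !Hu ?walkS // ltnW. Qed.

Lemma side_ends : W (u 0%N) = set0 /\ W (u m) = set0.
Proof.
case: Hside => m0 _ _ /andP[_ H1] /andP[_ H2].
rewrite !HW /track_wires !card_lab !Hu // walk0; split; case: eqP => // E; first by rewrite E in H1.
by rewrite E in H2.
Qed.

Lemma side_mid j : (0 < j < m)%N -> forall a b : label k, ((a, b) \in W (u j)) =
  [&& ((edir (val (u j)) a.1 == t) && (edir (val (u j)) b.1 == t + 3))
      || ((edir (val (u j)) a.1 == t + 3) && (edir (val (u j)) b.1 == t)),
      is_track a.2, is_track b.2 & (a.2 == b.2) == fl (u j)].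
Proof.
move=> Hj a b; case: Hside => _ HS /(_ j Hj) [] H4 E1 E2 _ _.
have Hjm : (j <= m)%N by case/andP: Hj => _ /ltnW.
rewrite HW /track_wires card_lab {1}Hu // H4 /= inE /= !is_end_lab.
have Hc : convex_type (nbr S (val (u j))) by apply: Hconv; exact: valP.
rewrite -(Hu Hjm) in H4 E1 E2.
have Ed := fun d => convex_ends4 d Hc H4 E1 E2.
have Eab : (a.1 == b.1) = (edir (val (u j)) a.1 == edir (val (u j)) b.1).
  by rewrite (inj_eq (can_inj (edirK compass cw (val (u j))))).
rewrite !Ed Eab !andbA; congr (_ && _ && _ && _).
have Ht : t != t + 3 by rewrite eq_sym add3_neq.
apply/idP/orP => [|[/andP[/eqP -> /eqP ->]|/andP[/eqP -> /eqP ->]]]; last 2 first.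
- by rewrite !eqxx orbT.
- by rewrite !eqxx orbT add3_neq.
case/andP=> [/andP[/orP[/eqP ->|/eqP ->] /orP[/eqP ->|/eqP ->]]]; rewrite eqxx //= => _;
  by [left; rewrite !eqxx | right; rewrite !eqxx].
Qed.

Lemma side_circuit (tr : nat -> bool) x y :
  (forall j, (0 < j < m)%N -> tr j.-1 = tr j (+) fl (u j)) ->
  on_track compass cw u t m tr x -> connect (lk W) x y <-> on_track compass cw u t m tr y.
Proof. by move=> Htr Hx; apply: (chain_circuit side_step side_ends side_mid). Qed.

Lemma on_track_bond tr (y : name) : on_track compass cw u t m tr y -> on_bond compass cw y.
Proof.
case=> j Hj Hy; apply/on_bondP; case: Hy => ->; rewrite /ndir /= elabK.
  by exists (u j.+1); exact: side_step.
by exists (u j); rewrite dir_add3 side_step // addrK.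
Qed.

Lemma track_heard (B : S -> {set label k}) (tr : nat -> bool) (x : name) :
  (forall j, (0 < j < m)%N -> tr j.-1 = tr j (+) fl (u j)) ->
  on_track compass cw u t m tr x ->
  x.2 \in heard W B x.1 <-> exists2 y : name, on_track compass cw u t m tr y & y.2 \in B y.1.
Proof.
case: x => w a Htr Hx; have Hb := on_track_bond Hx; split=> [/part_ex[y [Hy Hc]]|[y Hy HB]].
  exists y => //; have [H _] := side_circuit y Htr Hx; apply: H.
  by rewrite connect_lk_sym.
apply/(heardP _ _ Hb); exists y; split => //.
  by rewrite [y]surjective_pairing; apply: part_bond; rewrite -surjective_pairing; apply: on_track_bond Hy.
by have [_ H] := side_circuit (w, a) Htr Hy; exact: H.
Qed.
End Sides.

(** * Comparing the two ends of a side *)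

Section Checks.
Variables (k0 : nat) (S : {fset node}) (compass : node -> 'Z_6) (cw : node -> bool).
Notation k := k0.+2.
Notation heard := (@heard k0 S compass cw).
Notation elab := (elab compass cw).
Notation lab := (lab S compass cw).
Variables (W : S -> {set label k * label k}).
Hypothesis Hconv : forall z, z \in S -> convex_type (nbr S z).
Hypothesis HW : forall v, W v = track_wires k0 (lab (val v)) false.

Variables (c : nat) (B : S -> {set label k}).
Hypothesis Hc : (c < 4)%N.
Hypothesis HB : forall v a, a \in B v -> #|lab (val v)| = c.
Hypothesis HB' : forall v m i, #|lab (val v)| = c -> is_end (lab (val v)) m -> (m, i) \in B v.

(** Inner amoebots of a side have four neighbours and never beep here, and the listener is not of
    kind [c]; what it hears along the side can only come from the opposite corner. *)
Lemma side_hears (v : S) t m : is_side S (val v) t m -> #|lab (val v)| <> c ->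
  hears (heard W B v) (elab (val v) t) <-> #|lab (walk (val v) t m)| = c.
Proof.
move=> Hs Hv; have [u Hu] := side_nodes Hs.
have Ev : u 0%N = v by apply/val_inj; rewrite Hu // walk0.
have m0 : (0 < m)%N by case: Hs.
(* The side [cw (val v)] is the one on which the pin read by [hears] lies. *)
have Hx : on_track (k0 := k0) compass cw u t m (fun=> cw (val v)) (v, (elab (val v) t, pin k0 false)).
  by exists 0%N => //; left; rewrite /side_pin Ev addbb.
have := track_heard Hconv HW Hs Hu B _ Hx => /= H; rewrite /hears H; last by move=> j _; rewrite addbF.
split=> [[y [j Hj Hy] Hyb]|Hm].
  have Hcard i : (i <= m)%N -> #|lab (val (u i))| = c -> i = m.
    rewrite leq_eqVlt => /orP[/eqP //|Him]; case: (posnP i) => [->|Hi]; first by rewrite Ev.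
    case: Hs => _ _ /(_ i) Hmid _ _; rewrite card_lab Hu; last exact: ltnW.
    by case: Hmid; rewrite ?Hi // => -> _ _ E; have := Hc; rewrite -E.
  move/HB: Hyb; case: Hy => -> /= => E.
    by have := Hcard j (ltnW Hj) E => Ejm; rewrite Ejm ltnn in Hj.
  by rewrite -Hu // -(Hcard _ Hj E) .
exists (side_pin k0 compass cw (u m) (t + 3) (~~ cw (val v))); last first.
  apply: HB'; first by rewrite Hu.
  by rewrite is_end_lab elabK -/(val (u m)) Hu //; case: Hs => _ _ _ _ /andP[].
by exists m.-1; [rewrite ltn_predL | right; rewrite prednK].
Qed.

End Checks.

(** * Net beeps heard along an arm *)

Section Nets.
Variables (k0 : nat) (S : {fset node}) (compass : node -> 'Z_6) (cw : node -> bool).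
Notation k := k0.+2.
Notation name := (pin_name S k).
Notation elab := (elab compass cw).
Notation lk := (@lk k0 S compass cw).
Notation heard := (@heard k0 S compass cw).
Notation ndir := (@ndir k0 S compass cw).
Variables (W : S -> {set label k * label k}).
Hypothesis HW : forall v, W v = net_wires k0.

Definition net_sign (d : 'Z_6) : 'Z_3 := if odd d then -1 else 1.

Lemma bond_color_walk v d i : bond_color (walk v d i) d = bond_color v d + net_sign d *+ i.
Proof.
elim: i => [|i IH]; first by rewrite walk0 mulr0n addr0.
rewrite walkS mulrSr addrA -IH /bond_color !color_dir /net_sign.
by case: odd; rewrite // addrAC.
Qed.

(** The first bond of the other arm is one colour behind; this places its net on the bonds of index
    2 modulo 3. *)
Lemma bond_color_other v d s : bond_color v (turn s d 1) = bond_color v d - net_sign d.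
Proof.
rewrite /bond_color !color_dir /net_sign.
have -> : odd (turn s d 1) = ~~ odd d by case: s; cases6 d; vm_compute.
by case: (odd d); rewrite /= ?opprK ?subrK.
Qed.

Section Reach.
Variables (L : S) (x : name).

Definition nreach (z : node) (d : 'Z_6) : Prop :=
  forall v : S, val v = z -> net_reach compass cw W x v d.

Lemma nreach_turn z (d d' : 'Z_6) : odd d = odd d' -> nreach z d -> nreach z d'.
Proof. by move=> Hd H v Hv; apply: net_turn Hd (H v Hv). Qed.

Lemma nreach_cross z d : z \in S -> nreach z d -> nreach (z + dir d) (d + 3).
Proof.
move=> Hz H v Hv; apply: (@net_cross _ _ _ _ _ _ [` Hz]%fset) => //.
exact: H.
Qed.

Variables (v : node) (c : 'Z_6) (s : bool) (A B : nat).
Hypothesis HR : is_region S v c s A B.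
Hypothesis A0 : (0 < A)%N.
Hypothesis B0 : (0 < B)%N.

Definition freach (a b : int) (j : 'Z_6) : Prop := nreach (pt v c s (a, b)) (turn s c j).

Lemma freach_turn a b (j j' : 'Z_6) : odd j = odd j' -> freach a b j -> freach a b j'.
Proof. by move=> Hj; apply: nreach_turn; rewrite !odd_turn Hj. Qed.

Lemma freach_cross a b j : (0 <= a <= A%:Z) -> (0 <= b <= B%:Z) -> freach a b j ->
  freach (a + (dir j).1) (b + (dir j).2) (j + 3).
Proof.
move=> Ha Hb /nreach_cross; rewrite HR Ha Hb => /(_ isT).
by rewrite -pt_dir -turn_add3.
Qed.

Lemma freach_to a b j a' b' j' : freach a b j -> a' = a + (dir j).1 -> b' = b + (dir j).2 ->
  j' = j + 3 -> (0 <= a <= A%:Z) -> (0 <= b <= B%:Z) -> freach a' b' j'.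
Proof. by move=> H -> -> -> Ha Hb; apply: freach_cross. Qed.

(** Equal colour only allows two bonds to share a circuit. That bonds at distance three do share one
    is shown by a detour through row 1, which a parallelogram of positive height contains. *)
Lemma freach_step (i : nat) : (i + 3 <= A)%N -> freach i 0 0 -> freach (i + 3)%N 0 0.
Proof.
move=> Hi H.
have {}H : freach (i%:Z + 1) 0 1.
  by apply: (freach_turn (j := 3)) => //; apply: (freach_to H); rewrite /= ?add0r //; lia.
have {}H : freach (i%:Z + 1) 1 0.
  by apply: (freach_turn (j := 4)) => //; apply: (freach_to H); rewrite /= ?addr0 ?add0r //; first [lia | exact/val_inj].
have {}H : freach (i%:Z + 2) 1 5.
  by apply: (freach_turn (j := 3)) => //; apply: (freach_to H); rewrite /= ?addr0 ?add0r -?addrA //; lia.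
have {}H : freach (i%:Z + 3) 0 0.
  by apply: (freach_turn (j := 2)) => //; apply: (freach_to H); rewrite /= ?subrr -?addrA //; first [lia | exact/val_inj].
by rewrite PoszD.
Qed.

Lemma freach_other : (2 <= A)%N -> freach 0 0 1 -> freach 2 0 0.
Proof.
move=> Hi H.
have {}H : freach 0 1 0.
  by apply: (freach_turn (j := 4)) => //; apply: (freach_to H); rewrite /= ?addr0 ?add0r //; first [lia | exact/val_inj].
have {}H : freach 1 1 5.
  by apply: (freach_turn (j := 3)) => //; apply: (freach_to H); rewrite /= ?addr0 ?add0r //; lia.
by apply: (freach_turn (j := 2)) => //; apply: (freach_to H); rewrite /= ?subrr //; first [lia | exact/val_inj].
Qed.
End Reach.

Lemma heard_connect (Bp : S -> {set label k}) (x y : name) : connect (lk W) x y ->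
  on_bond compass cw x -> on_bond compass cw y -> (x.2 \in heard W Bp x.1) = (y.2 \in heard W Bp y.1).
Proof.
case: x y => [v a] [w b] Hc Hx Hy; apply/(heardP _ _ Hx)/(heardP _ _ Hy) => -[z [H1 H2 H3]]; exists z; split => //.
  exact: connect_trans H3 Hc.
by apply: connect_trans H3 _; rewrite connect_lk_sym.
Qed.

Lemma hears_cross (Bp : S -> {set label k}) (v w : S) d : val w = val v + dir d ->
  hears (heard W Bp w) (elab (val w) (d + 3)) = hears (heard W Bp v) (elab (val v) d).
Proof.
move=> Hw; pose x : name := (v, (elab (val v) d, pin k0 false)).
pose y : name := (w, (elab (val w) (d + 3), pin k0 false)).
apply/esym/(@heard_connect _ x y).
- have := @net_same k0 S compass cw W HW x; rewrite /ndir /= elabK => /(net_cross Hw); apply => //.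
  by rewrite /ndir /= elabK.
- by apply/on_bondP; exists w; rewrite /ndir /= elabK.
- by apply/on_bondP; exists v; rewrite /ndir /= elabK dir_add3 Hw addrK.
Qed.

Variables (L : S) (e : 'Z_6) (Bp : S -> {set label k}).
Hypothesis HB : forall v, Bp v = if v == L then [set a : label k | a.1 == elab (val L) e] else set0.

Lemma net_hears_color (w : S) d : hears (heard W Bp w) (elab (val w) d) ->
  bond_color (val w) d = bond_color (val L) e.
Proof.
move/part_ex => [y [Hy Hc]]; have := net_connect_color HW Hc.
move: Hy; rewrite HB; case: eqP => [EL|]; rewrite inE // => /eqP Ey.
by rewrite /ndir Ey EL /= !elabK.
Qed.

Lemma net_reach_hears (w : S) d : val L + dir e \in S -> val w + dir d \in S ->
  net_reach compass cw W (L, (elab (val L) e, pin k0 false)) w d ->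
  hears (heard W Bp w) (elab (val w) d).
Proof.
move=> He Hd H; have Hb : on_bond compass cw ((w, (elab (val w) d, pin k0 false)) : name).
  by apply/on_bondP; exists [` Hd]%fset; rewrite /ndir /= elabK.
apply/(heardP _ _ Hb); exists (L, (elab (val L) e, pin k0 false)); split.
- by rewrite HB eqxx inE.
- by apply: part_bond; apply/on_bondP; exists [` He]%fset; rewrite /ndir /= elabK.
- by apply: H => //; rewrite /ndir /= elabK.
Qed.

Lemma natr3_eq0 (i : nat) : ((i%:R : 'Z_3) == 0) = (i %% 3 == 0)%N.
Proof. by rewrite -Zp_nat_mod // -val_eqE /= val_Zp_nat // modn_mod. Qed.

Lemma sign_eq0 d i : (net_sign d *+ i == 0) = (i %% 3 == 0)%N.
Proof.
rewrite /net_sign -natr3_eq0; case: odd => //.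
by rewrite mulNrn oppr_eq0.
Qed.

Section Arm.
Variables (c : 'Z_6) (s : bool) (A B : nat).
Hypothesis HR : is_region S (val L) c s A B.
Hypothesis A0 : (0 < A)%N.
Hypothesis B0 : (0 < B)%N.

Lemma regionS (a b : nat) : (a <= A)%N -> (b <= B)%N -> pt (val L) c s (a%:Z, b%:Z) \in S.
Proof. by move=> Ha Hb; rewrite HR; lia. Qed.

Lemma walk_region i : walk (val L) c i = pt (val L) c s (i%:Z, 0).
Proof. by rewrite -{1}(pt00 (val L) c s) walk_pt add0r. Qed.

Lemma own_bond (w : S) i : e = c -> (i < A)%N -> val w = walk (val L) c i ->
  hears (heard W Bp w) (elab (val w) c) = (i %% 3 == 0)%N.
Proof.
move=> Ee Hi Hw; apply/idP/idP => [/net_hears_color|Hm].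
  rewrite Ee Hw bond_color_walk => /eqP; rewrite -subr_eq0 addrAC subrr add0r sign_eq0.
  by [].
have HS i' : (i' < A)%N -> walk (val L) c i' + dir c \in S.
  by move=> H; rewrite -walkS walk_region; apply: regionS.
apply: net_reach_hears; rewrite ?Ee ?Hw.
- by have := HS 0%N A0; rewrite walk0.
- exact: HS.
have Ei : i = (i %/ 3 * 3)%N by rewrite [LHS](divn_eq i 3) (eqP Hm) addn0.
have H j : (j * 3 < A)%N ->
    freach (L, (elab (val L) c, pin k0 false)) (val L) c s (j * 3)%N 0 0.
  elim: j => [|j IH] Hj.
    rewrite /freach pt00 turn0 => v Hv; have -> : v = L by apply/val_inj.
    have := @net_same k0 S compass cw W HW (L, (elab (val L) c, pin k0 false)).
    by rewrite /ndir /= elabK.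
  rewrite mulSn addnC; apply: (freach_step HR) => //; first by rewrite mulSn addnC in Hj; exact: ltnW.
  apply: IH; lia.
have := H (i %/ 3)%N; rewrite -Ei => /(_ Hi) /(_ w); rewrite turn0; apply.
by rewrite Hw walk_region.
Qed.

Lemma oth_bond (w : S) i : e = turn s c 1 -> (i < A)%N -> val w = walk (val L) c i ->
  hears (heard W Bp w) (elab (val w) c) = (i %% 3 == 2)%N.
Proof.
move=> Ee Hi Hw; apply/idP/idP => [/net_hears_color|Hm].
  rewrite Ee Hw bond_color_walk bond_color_other => /eqP.
  have E (T x y : 'Z_3) : T + x - (T - y) = y + x by ring.
  rewrite -subr_eq0 E -mulrS sign_eq0; lia.
have HS i' : (i' < A)%N -> walk (val L) c i' + dir c \in S.
  by move=> H; rewrite -walkS walk_region; apply: regionS.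
apply: net_reach_hears; rewrite ?Ee ?Hw.
- rewrite -[val L](pt00 _ c s) -pt_dir -[(0, 0) + _]/(0%N%:Z, 1%N%:Z); exact: regionS.
- exact: HS.
have Ei : i = (i %/ 3 * 3 + 2)%N by rewrite [LHS](divn_eq i 3) (eqP Hm).
have H j : (j * 3 + 2 < A)%N ->
    freach (L, (elab (val L) (turn s c 1), pin k0 false)) (val L) c s (j * 3 + 2)%N 0 0.
  elim: j => [|j IH] Hj.
    apply: (freach_other HR) => //; first exact: ltnW.
    rewrite /freach pt00 => v Hv; have -> : v = L by apply/val_inj.
    have := @net_same k0 S compass cw W HW (L, (elab (val L) (turn s c 1), pin k0 false)).
    by rewrite /ndir /= elabK.
  have -> : (j.+1 * 3 + 2 = j * 3 + 2 + 3)%N by lia.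
  apply: (freach_step HR) => //; [lia | apply: IH; lia].
have := H (i %/ 3)%N; rewrite -Ei => /(_ Hi) /(_ w); rewrite turn0; apply.
by rewrite Hw walk_region.
Qed.
End Arm.

End Nets.

(** * The leader and its two arms *)

Lemma region_acute S v c s (A B : nat) z : is_region S v c s A B -> (0 < A)%N -> (0 < B)%N ->
  z \in S -> #|nbr S z| = 2 <-> z = v \/ z = pt v c s (A%:Z, B%:Z).
Proof.
move=> HR A0 B0 Hz; split => [|[->|->]]; last 2 first.
- by have [] := region_corner_cards HR A0 B0.
- by have [] := region_corner_cards (region_rot HR) A0 B0.
have [[x y] Ez] := pt_surj v c s z; rewrite Ez in Hz *.
rewrite card_rnbr => H2; have Hr := HR x y; rewrite Hz in Hr.
have R := region_rnbr HR x y.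
have H3 a b d : a != b -> a != d -> b != d -> a \in rnbr S v c s x y -> b \in rnbr S v c s x y ->
    d \in rnbr S v c s x y -> False.
  move=> Hab Had Hbd Ha Hb Hd.
  have : (#|[set a; b; d]| <= 2)%N.
    rewrite -[X in (_ <= X)%N]H2; apply: subset_leq_card; apply/subsetP => j.
    by rewrite !in_setU !in_set1 => /orP[/orP[]|] /eqP ->.
  by rewrite setUC cardsU1 !inE negb_or eq_sym Had eq_sym Hbd cards2 Hab.
have [[E1 E2]|[[E1 E2]|[E|E]]] : (x = 0 /\ y = 0) \/ (x = A /\ y = B) \/
   (0 < x /\ y < B%:Z) \/ (x < A%:Z /\ 0 < y) by lia.
- by left; rewrite E1 E2 pt00.
- by right; rewrite E1 E2.
- by case: (H3 1 2 3) => //; rewrite R; lia.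
- by case: (H3 0 4 5) => //; rewrite R; lia.
Qed.

Section Leader.
Variables (S : {fset node}) (compass : node -> 'Z_6) (cw : node -> bool).
Notation edir := (edge_dir compass cw).
Notation lab := (lab S compass cw).

Lemma arm_label_sector i : (arm_label (sector i 2) false = i) * (arm_label (sector i 2) true = i + 1).
Proof.
split; rewrite /arm_label; case: pickP => [m|].
- rewrite /= !in_sector => H; move: H; cases6 i; cases6 m => H; first [by exfalso; move: H; vm_compute | exact/val_inj].
- by move/(_ i); rewrite /= !in_sector; cases6 i; vm_compute.
- rewrite /= !in_sector => H; move: H; cases6 i; cases6 m => H; first [by exfalso; move: H; vm_compute | exact/val_inj].
- by move/(_ (i + 1)); rewrite /= !in_sector; cases6 i; vm_compute.
Qed.

(** The leader names its arms by its own sense of rotation, so the frame along arm [b] is mirrored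
    according to [cw (val L) (+) b]. Which arm is the longer one stays unknown, hence the two cases
    for [len]. *)
Lemma leader_frame (L : S) v c s (A B : nat) : is_region S v c s A B -> (0 < A)%N -> (0 < B)%N ->
  val L = v \/ val L = pt v c s (A%:Z, B%:Z) ->
  exists len : bool -> nat, [/\ (len false, len true) = (A, B) \/ (len false, len true) = (B, A),
    forall b, edir (val L) (arm_label (lab (val L)) (~~ b)) =
        turn (cw (val L) (+) b) (edir (val L) (arm_label (lab (val L)) b)) 1 &
    forall b, is_region S (val L) (edir (val L) (arm_label (lab (val L)) b)) (cw (val L) (+) b)
        (len b) (len (~~ b))].
Proof.
move=> HR A0 B0 HL.
have {HL} [c0 [s0 HR0]] : exists c0 s0, is_region S (val L) c0 s0 A B.
  by case: HL => ->; [exists c, s | exists (c + 3), s; apply: region_rot].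
have Hin j : (turn s0 c0 j \in nbr S (val L)) = (j == 0) || (j == 1).
  have := region_corner00 HR0 A0 B0 => /setP/(_ j); rewrite inE pt00 => ->.
  by rewrite in_sector; cases6 j; vm_compute.
have [i Ei] : exists i, lab (val L) = sector i 2.
  have E0 : nbr S (val L) = pre s0 (turnV s0 c0 0) (sector 0 2).
    rewrite -(region_corner00 HR0 A0 B0); apply/setP => m; rewrite !inE pt00 turnA addbb.
    by have -> : turn s0 c0 (turnV s0 c0 0) = 0 by [exact: turnVK]; rewrite /turn add0r.
  by rewrite /lab E0 !pre_sector //; eexists.
have Hi : i \in lab (val L) /\ i + 1 \in lab (val L).
  by rewrite Ei !in_sector subrr addrAC subrr add0r.
have E2 : edir (val L) (i + 1) = turn (cw (val L)) (edir (val L) i) 1.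
  by rewrite !edge_dirE turnD.
rewrite !in_lab E2 in Hi.
have Hturn b : edir (val L) (arm_label (lab (val L)) (~~ b)) =
        turn (cw (val L) (+) b) (edir (val L) (arm_label (lab (val L)) b)) 1.
  by case: b; rewrite Ei !arm_label_sector E2 ?addbF // addbT turn_back.
pose j := turnV s0 c0 (edir (val L) i); have Ej : edir (val L) i = turn s0 c0 j by rewrite turnVK.
have Hreg : is_region S (val L) (edir (val L) i) (cw (val L)) (if j == 0 then A else B) (if j == 0 then B else A).
  move: Hi; rewrite Ej Hin => -[].
  have -> : turn (cw (val L)) (turn s0 c0 j) 1 = turn s0 c0 (turn (s0 (+) cw (val L)) j 1).
    by rewrite turnA addKb.
  rewrite Hin => /orP[]/eqP ->; rewrite ?turn0 ?eqxx => H'.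
    have -> : cw (val L) = s0; last by [].
    by move: H'; case: (s0); case: (cw _).
  have -> : cw (val L) = ~~ s0 by move: H'; case: (s0); case: (cw _).
  exact: region_swap.
exists (fun b => if b (+) (j == 0) then A else B); split => //.
  by case: (j == 0); [left|right].
case; rewrite Ei !arm_label_sector ?addbF ?addbT.
  by rewrite E2; have := region_swap Hreg; case: (j == 0).
by move: Hreg; case: (j == 0).
Qed.
End Leader.

Section Arms.
Variables (k0 : nat) (S : {fset node}) (compass : node -> 'Z_6) (cw : node -> bool).
Notation k := k0.+2.
Notation name := (pin_name S k).
Notation edir := (edge_dir compass cw).
Notation elab := (elab compass cw).
Notation lab := (lab S compass cw).
Notation lk := (@lk k0 S compass cw).
Notation heard := (@heard k0 S compass cw).
Notation side_pin := (@side_pin k0 S compass cw).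
Notation on_track := (@on_track k0 S compass cw).

Variables (L : S) (len : bool -> nat) (ar : bool -> nat -> S).
Definition arm_dir (b : bool) : 'Z_6 := edir (val L) (arm_label (lab (val L)) b).
Definition arm_side (b : bool) : bool := cw (val L) (+) b.
Hypothesis Hlen : forall b, (0 < len b)%N.
Hypothesis Hturn : forall b, arm_dir (~~ b) = turn (arm_side b) (arm_dir b) 1.
Hypothesis Hreg : forall b, is_region S (val L) (arm_dir b) (arm_side b) (len b) (len (~~ b)).
Hypothesis Har : forall b j, (j <= len b)%N -> val (ar b j) = walk (val L) (arm_dir b) j.

Lemma arm_convex z : z \in S -> convex_type (nbr S z).
Proof. exact: (region_convex (Hreg false) (Hlen false) (Hlen (~~ false))). Qed.

Lemma arm_is_side b : is_side S (val L) (arm_dir b) (len b).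
Proof. exact: (region_bottom_side (Hreg b) (Hlen b) (Hlen (~~ b))). Qed.

Lemma ar0 b : ar b 0 = L.
Proof. by apply/val_inj; rewrite Har // walk0. Qed.

Lemma ar_pt b j : (j <= len b)%N -> val (ar b j) = pt (val L) (arm_dir b) (arm_side b) (j%:Z, 0).
Proof. by move=> Hj; rewrite Har // -{1}(pt00 (val L) (arm_dir b) (arm_side b)) walk_pt add0r. Qed.

Lemma ar_inj b b' j j' : (0 < j <= len b)%N -> (j' <= len b')%N -> ar b j = ar b' j' -> b = b' /\ j = j'.
Proof.
move=> /andP[Hj0 Hj] Hj' E; have := ar_pt Hj; rewrite E ar_pt //.
case: (b' =P b) E => [->|Hb] E.
  by move=> /pt_inj [] ->.
have -> : b' = ~~ b by case: b b' Hb {Hj E Hj'} => -[].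
rewrite Hturn; have -> : arm_side (~~ b) = ~~ arm_side b by rewrite /arm_side addbN.
by rewrite pt_swap => /pt_inj [] H; lia.
Qed.

Lemma arm_nbr_end b j d : (j <= len b)%N ->
  (turn (arm_side b) (arm_dir b) d \in nbr S (val (ar b j))) =
  (d \in rnbr S (val L) (arm_dir b) (arm_side b) j 0).
Proof. by move=> Hj; rewrite ar_pt // [RHS]inE. Qed.

Lemma card_ar b j : (j <= len b)%N -> #|lab (val (ar b j))| =
  if j == 0%N then 2 else if j == len b then 3 else 4.
Proof.
move=> Hj; rewrite card_lab ar_pt // card_rnbr.
case: eqP => [->|/eqP Hj0]; first by rewrite (region_corner00 (Hreg b)) // card_sector.
case: eqP => [->|/eqP Hjl]; first by rewrite (region_cornerA0 (Hreg b)) // card_sector.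
by rewrite (region_bottom (Hreg b)) ?card_sector // lt0n Hj0 ltn_neqAle Hjl.
Qed.

Lemma arm_row b j : (j <= len b)%N ->
  [\/ j = 0%N /\ rnbr S (val L) (arm_dir b) (arm_side b) j 0 = sector 0 2,
      (0 < j < len b)%N /\ rnbr S (val L) (arm_dir b) (arm_side b) j 0 = sector 0 4 |
      j = len b /\ rnbr S (val L) (arm_dir b) (arm_side b) j 0 = sector 1 3].
Proof.
move=> Hj; have [E|[E|E]] : j = 0%N \/ (0 < j < len b)%N \/ j = len b by lia.
- by apply: Or31; rewrite E; split => //; rewrite (region_corner00 (Hreg b)).
- by apply: Or32; split => //; rewrite (region_bottom (Hreg b)).
- by apply: Or33; rewrite E; split => //; rewrite (region_cornerA0 (Hreg b)).
Qed.

(* On the bonds of an arm, interior and exterior pins do not depend on the end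
   of the bond from which one looks. *)
Lemma bit_pin_away b j x : (j < len b)%N ->
  (ar b j, bit_pin k0 (lab (val (ar b j))) (elab (val (ar b j)) (arm_dir b)) x) =
  side_pin (ar b j) (arm_dir b) (arm_side b (+) x).
Proof.
move=> Hj; have Hj' := ltnW Hj; rewrite /bit_pin /side_pin; congr (_, (_, pin _ _)).
have -> : (elab (val (ar b j)) (arm_dir b) + 1 \in lab (val (ar b j))) =
    (cw (val (ar b j)) == arm_side b).
  rewrite in_lab edge_dirE turnD -edge_dirE elabK.
  case: eqP => [->|/eqP Hs].
    have [[E1 E2]|[E1 E2]|[E1 _]] := arm_row Hj'; last by rewrite E1 ltnn in Hj.
      by rewrite arm_nbr_end // E2 in_sector.
    by rewrite arm_nbr_end // E2 in_sector.
  have -> : turn (cw (val (ar b j))) (arm_dir b) 1 = turn (arm_side b) (arm_dir b) 5.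
    by move: Hs; case: (cw _); case: (arm_side b) => // _; rewrite /turn; congr (_ + _); exact/val_inj.
  have [[E1 E2]|[E1 E2]|[E1 _]] := arm_row Hj'; last by rewrite E1 ltnn in Hj.
    by rewrite arm_nbr_end // E2 in_sector.
  by rewrite arm_nbr_end // E2 in_sector.
by case: (cw _); case: (arm_side b); case: x.
Qed.

Lemma bit_pin_toward b j x : (0 < j <= len b)%N ->
  (ar b j, bit_pin k0 (lab (val (ar b j))) (elab (val (ar b j)) (arm_dir b + 3)) x) =
  side_pin (ar b j) (arm_dir b + 3) (~~ (arm_side b (+) x)).
Proof.
move=> /andP[Hj0 Hj]; rewrite /bit_pin /side_pin; congr (_, (_, pin _ _)).
have -> : (elab (val (ar b j)) (arm_dir b + 3) + 1 \in lab (val (ar b j))) =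
    (cw (val (ar b j)) != arm_side b).
  rewrite in_lab edge_dirE turnD -edge_dirE elabK.
  case: eqP => [->|/eqP Hs] /=.
    have -> : turn (arm_side b) (arm_dir b + 3) 1 = turn (arm_side b) (arm_dir b) 4.
      by rewrite /turn; case: (arm_side b); rewrite -addrA; congr (_ + _); exact/val_inj.
    have [[E1 _]|[E1 E2]|[E1 E2]] := arm_row Hj; first by rewrite E1 in Hj0.
      by rewrite arm_nbr_end // E2 in_sector.
    by rewrite arm_nbr_end // E2 in_sector.
  have -> : turn (cw (val (ar b j))) (arm_dir b + 3) 1 = turn (arm_side b) (arm_dir b) 2.
    by move: Hs; case: (cw _); case: (arm_side b) => // _; rewrite /turn -addrA; congr (_ + _); exact/val_inj.
  have [[E1 _]|[E1 E2]|[E1 E2]] := arm_row Hj; first by rewrite E1 in Hj0.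
    by rewrite arm_nbr_end // E2 in_sector.
  by rewrite arm_nbr_end // E2 in_sector.
by case: (cw _); case: (arm_side b); case: x.
Qed.

Lemma arm_ends b j d : (0 < j <= len b)%N -> is_end (lab (val (ar b j))) (elab (val (ar b j)) d) =
  ((j < len b)%N && (d == arm_dir b)) || (d == arm_dir b + 3) ||
  ((j == len b)%N && (d == turn (arm_side b) (arm_dir b) 1)).
Proof.
move=> /andP[Hj0 Hj]; rewrite is_end_lab elabK.
rewrite -(turnVK (arm_side b) (arm_dir b) d); set d' := turnV _ _ _.
rewrite ar_pt // end_rnbr.
have -> : (turn (arm_side b) (arm_dir b) d' == arm_dir b) = (d' == 0).
  by rewrite -{2}(turn0 (arm_side b) (arm_dir b)) (inj_eq (@turn_inj _ _)).
have -> : (turn (arm_side b) (arm_dir b) d' == arm_dir b + 3) = (d' == 3).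
  by rewrite -{2}(turn0 (arm_side b) (arm_dir b)) -turn_add3 (inj_eq (@turn_inj _ _)) add0r.
rewrite (inj_eq (@turn_inj _ _)).
have [[E1 _]|[E1 E2]|[E1 E2]] := arm_row Hj; first by rewrite E1 in Hj0.
  case/andP: E1 => _ E1; rewrite E2 /is_end !in_sector E1 (ltn_eqF E1) /= orbF.
  by move: d' => d'; cases6 d'; vm_compute.
rewrite E1 in E2 *; rewrite E2 /is_end !in_sector ltnn eqxx /=.
by move: d' => d'; cases6 d'; vm_compute.
Qed.

Definition on_arm (b : bool) (w : S) (m : 'Z_6) : Prop := exists2 j, (j < len b)%N &
  (w = ar b j /\ m = elab (val w) (arm_dir b)) \/ (w = ar b j.+1 /\ m = elab (val w) (arm_dir b + 3)).

Section Hearing.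
Variables (W : S -> {set label k * label k}) (fl : S -> bool) (Bp : S -> {set label k}).
Hypothesis HW : forall v, W v = track_wires k0 (lab (val v)) (fl v).

Lemma arm_track_heard b tr (x : name) :
  (forall j, (0 < j < len b)%N -> tr j.-1 = tr j (+) fl (ar b j)) ->
  on_track (ar b) (arm_dir b) (len b) tr x ->
  x.2 \in heard W Bp x.1 <-> exists2 y : name, on_track (ar b) (arm_dir b) (len b) tr y & y.2 \in Bp y.1.
Proof. exact: (track_heard arm_convex HW (arm_is_side b) (Har (b := b))). Qed.

Lemma track_inv (x y : name) : lk W x y -> is_track x.2.2 = is_track y.2.2.
Proof.
rewrite lkE => /or3P[/eqP -> //|/and3P[_ _ /eqP ->]|/andP[/eqP H]].
  case: ifP => // _; apply/is_trackP/is_trackP => -[b Hb]; exists (~~ b).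
    by rewrite Hb rev_pin.
  by rewrite -(rev_ordK x.2.2) Hb rev_pin.
rewrite !HW /track_wires; case: ifP => _; rewrite !inE //=.
by case/orP => /and5P[_ _ _ H1 /andP[H2 _]]; rewrite H1 H2.
Qed.

Variable g : bool -> bool.
Hypothesis Hfl : forall v, fl v = false.
Hypothesis HB : forall v, Bp v = if v == L
  then [set a : label k | [exists b, (a.1 == arm_label (lab (val L)) b) && g b]] else set0.

(** The leader beeps on all pins of an edge, so both tracks of the arm carry the beep and any
    chirality may listen on its [pin false]; the remaining pins are not wired. *)
Lemma arms_hear (w : S) (m : 'Z_6) :
  hears (heard W Bp w) m <-> exists2 b, g b & on_arm b w m.
Proof.
have Htr b c j : (0 < j < len b)%N -> (fun=> c) j.-1 = (fun=> c) j (+) fl (ar b j) by rewrite Hfl addbF.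
have HL b : arm_label (lab (val L)) b = elab (val L) (arm_dir b) by rewrite edirK.
split=> [/part_ex [y [Hy Hc]]|[b Hb [j Hj Hw]]].
- have Htrack : is_track y.2.2.
    by rewrite (circuit_inv (f := fun x : name => is_track x.2.2) track_inv Hc); apply/is_trackP; exists false.
  move: Hy; rewrite HB; case: eqP => [EL|]; rewrite inE // => /existsP[b /andP[/eqP El Hb]].
  exists b => //; have [c Ec] := side_pin_eta compass cw Htrack.
  have Hon : on_track (ar b) (arm_dir b) (len b) (fun=> c) y.
    by exists 0%N => //; left; rewrite Ec El EL ar0.
  have [H _] := side_circuit arm_convex HW (arm_is_side b) (Har (b := b)) (w, (m, pin k0 false)) (Htr b c) Hon.
  have [j Hj [E|E]] := H Hc; exists j => //; [left|right].
    by have /= -> := congr1 fst E; have /= -> := congr1 (fun z : name => z.2.1) E.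
  by have /= -> := congr1 fst E; have /= -> := congr1 (fun z : name => z.2.1) E.
- have [c Hx] : exists c, on_track (ar b) (arm_dir b) (len b) (fun=> c) (w, (m, pin k0 false)).
    case: Hw => -[-> ->]; [exists (cw (val (ar b j))) | exists (~~ cw (val (ar b j.+1)))]; exists j => //; [left|right].
      by rewrite /side_pin addbb.
    by rewrite /side_pin negbK addbb.
  apply/(arm_track_heard (Htr b c) Hx); exists (side_pin L (arm_dir b) c).
    by exists 0%N => //; left; rewrite ar0.
  by rewrite HB eqxx inE; apply/existsP; exists b; rewrite /= HL eqxx.
Qed.
End Hearing.
Lemma elab_add3 v d : elab v (d + 3) = elab v d + 3.
Proof.
rewrite /elab /turnV; case: (cw v); last by rewrite addrAC.
by rewrite opprD addrA; congr (_ + _); exact/val_inj.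
Qed.

Section Out.
Variables (b : bool) (own oth : S -> {set 'Z_6}) (r : S -> {set label k}).
Hypothesis Hown : forall j, (j < len b)%N ->
  (elab (val (ar b j)) (arm_dir b) \in own (ar b j)) = (j %% 3 == 0)%N /\
  (elab (val (ar b j.+1)) (arm_dir b + 3) \in own (ar b j.+1)) = (j %% 3 == 0)%N.
Hypothesis Hoth : forall j, (j < len b)%N ->
  (elab (val (ar b j)) (arm_dir b) \in oth (ar b j)) = (j %% 3 == 2)%N /\
  (elab (val (ar b j.+1)) (arm_dir b + 3) \in oth (ar b j.+1)) = (j %% 3 == 2)%N.
Hypothesis Hr : forall w m, hears (r w) m <-> on_arm b w m.

(** Away from the leader the bonds run cyclically through own, silent, other. Each pair of
    consecutive bonds thus occurs in one order only, and [toward] recognizes that order. *)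
Lemma arm_out_on j : (0 < j <= len b)%N ->
  arm_out (lab (val (ar b j))) (own (ar b j)) (oth (ar b j)) (r (ar b j)) =
  Some (elab (val (ar b j)) (arm_dir b + 3)).
Proof.
move=> Hj; have [Hj0 Hjl] := andP Hj; have Hend := fun d => arm_ends d Hj.
have Hout : hears (r (ar b j)) (elab (val (ar b j)) (arm_dir b + 3)).
  by apply/Hr; exists j.-1; [rewrite prednK | right; rewrite prednK].
rewrite /arm_out (card_ar Hjl) (gtn_eqF Hj0).
case: (j =P len b) => [Ej|/eqP Ej] /=.
  case: pickP => [m /andP[Hm /Hr[i Hi Him]]|/(_ (elab (val (ar b j)) (arm_dir b + 3)))]; last first.
    by rewrite Hend eqxx orbT Hout.
  congr Some; case: Him => -[E ->] //.
  by have [_ E'] := ar_inj Hj (ltnW Hi) E; move: Hi; rewrite -E' Ej ltnn.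
have Hlt : (j < len b)%N by rewrite ltn_neqAle Ej.
have [O1 _] := Hown Hlt; have [T1 _] := Hoth Hlt.
have [|_ O2] := Hown (j := j.-1); first by lia.
have [|_ T2] := Hoth (j := j.-1); first by lia.
rewrite prednK // in O2 T2.
case: pickP => [m /and3P[Hm _ Ht]|/(_ (elab (val (ar b j)) (arm_dir b + 3)))]; last first.
  rewrite Hend eqxx orbT Hout /toward -elab_add3 add33 O1 O2 T1 T2 /=; lia.
congr Some; move: Hm; rewrite -(edirK compass cw (val (ar b j)) m) Hend Hlt (negPf Ej) orbF /=.
case/orP => /eqP Em; last by rewrite Em.
move: Ht; rewrite -(edirK compass cw (val (ar b j)) m) Em /toward -elab_add3 O1 O2 T1 T2; lia.
Qed.

Lemma arm_out_off w : (forall j, (0 < j <= len b)%N -> w <> ar b j) ->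
  arm_out (lab (val w)) (own w) (oth w) (r w) = None.
Proof.
move=> Hw; case: (w =P L) => [->|HL].
  by rewrite /arm_out -(ar0 b) (card_ar (leq0n _)).
have Hno m : hears (r w) m = false.
  apply/negP => /Hr[j Hj [[E _]|[E _]]]; last by apply: (Hw j.+1) E; rewrite Hj.
  case: j Hj E => [|j] Hj E; first by apply: HL; rewrite E (ar0).
  by apply: (Hw j.+1) E => /=; exact: ltnW.
rewrite /arm_out; case: eqP => _; first by case: pickP => // m; rewrite Hno andbF.
by case: eqP => // _; case: pickP => // m; rewrite Hno andbF.
Qed.
End Out.
End Arms.

(** * Serial arithmetic *)

Section Bits.
Local Open Scope nat_scope.

Definition bit (n i : nat) : bool := odd (n %/ 2 ^ i).
(** The carry into position [i] in the addition of [u] and [v]. *)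
Definition cry (u v i : nat) : bool := 2 ^ i <= u %% 2 ^ i + v %% 2 ^ i.

Lemma modn_expS n i : n %% 2 ^ i.+1 = n %% 2 ^ i + bit n i * 2 ^ i.
Proof.
have H2 : 0 < 2 ^ i by rewrite expn_gt0.
have E : n = (n %/ 2 ^ i)./2 * 2 ^ i.+1 + (bit n i * 2 ^ i + n %% 2 ^ i).
  rewrite {1}(divn_eq n (2 ^ i)) /bit -{1}(odd_double_half (n %/ 2 ^ i)) -muln2 expnS; lia.
have Hlt : bit n i * 2 ^ i + n %% 2 ^ i < 2 ^ i.+1.
  have := ltn_pmod n H2; rewrite expnS; case: (bit n i); lia.
by rewrite {1}E modnMDl modn_small // addnC.
Qed.

Lemma bit0 i : bit 0 i = false.
Proof. by rewrite /bit div0n. Qed.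

Lemma cry0 u v : cry u v 0 = false.
Proof. by rewrite /cry expn0 !modn1. Qed.

Lemma addn_div u v i : (u + v) %/ 2 ^ i = u %/ 2 ^ i + v %/ 2 ^ i + cry u v i.
Proof.
have H2 : 0 < 2 ^ i by rewrite expn_gt0.
rewrite divnD // /cry; by [].
Qed.

Lemma bit_add u v i : bit (u + v) i = bit u i (+) bit v i (+) cry u v i.
Proof. by rewrite /bit addn_div !oddD oddb. Qed.

Lemma cryS u v i : cry u v i.+1 = maj (bit u i) (bit v i) (cry u v i).
Proof.
have H2 : 0 < 2 ^ i by rewrite expn_gt0.
have := ltn_pmod u H2; have := ltn_pmod v H2.
rewrite /cry !modn_expS /maj expnS.
case: (bit u i); case: (bit v i); case: leqP; lia.
Qed.

Lemma modnS_eq u v w i : ((u + v) %% 2 ^ i.+1 == w %% 2 ^ i.+1) =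
  ((u + v) %% 2 ^ i == w %% 2 ^ i) && (bit u i (+) bit v i (+) cry u v i == bit w i).
Proof.
have H2 : 0 < 2 ^ i by rewrite expn_gt0.
have := ltn_pmod (u + v) H2; have := ltn_pmod w H2.
rewrite !modn_expS -bit_add; move: (bit (u + v) i) (bit w i) => b1 b2.
move: ((u + v) %% 2 ^ i) (w %% 2 ^ i) (2 ^ i) H2 => a b p.
by case: b1; case: b2; lia.
Qed.

(** With [modnS_eq], this is what makes the running tests of [next_cmp] correct modulo the next
    power of two. *)
Lemma modnS_leq x y i : (x %% 2 ^ i.+1 <= y %% 2 ^ i.+1) =
  if bit x i == bit y i then x %% 2 ^ i <= y %% 2 ^ i else bit y i.
Proof.
have H2 : 0 < 2 ^ i by rewrite expn_gt0.
have := ltn_pmod x H2; have := ltn_pmod y H2.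
rewrite !modn_expS; move: (bit x i) (bit y i) => b1 b2.
move: (x %% 2 ^ i) (y %% 2 ^ i) (2 ^ i) H2 => a b p.
by case: b1; case: b2; rewrite /=; lia.
Qed.

Variables (keep : nat -> bool) (cst : nat -> nat).

(* [zval m r] is the output of stage [r] on an arm of length [m], [zin m r] its
   input, and [psum m r t] the sum after [t] of the [m] adders of the arm. *)
Fixpoint zval (m r : nat) : nat :=
  if r is r'.+1 then cst r + m * (if keep r then zval m r' else 0) else cst 0.
Definition zin (m r : nat) : nat := if keep r && (0 < r) then zval m r.-1 else 0.
Definition psum (m r t : nat) : nat := cst r + t * zin m r.

Lemma psum0 m r : psum m r 0 = cst r. Proof. by rewrite /psum mul0n addn0. Qed.

Lemma psumS m r t : psum m r t.+1 = psum m r t + zin m r.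
Proof. by rewrite /psum mulSn [zin m r + _]addnC addnA. Qed.

Lemma psum_max m r : psum m r m = zval m r.
Proof. by case: r => [|r]; rewrite /psum /zin /= ?andbF ?muln0 ?addn0 // andbT. Qed.

Lemma cry_small u v i : u < 2 ^ i -> v < 2 ^ i -> cry u v i = false -> u + v < 2 ^ i.
Proof. by rewrite /cry => Hu Hv; rewrite !modn_small // leqNgt => /negbFE. Qed.

Lemma cry_big u v i : u + v < 2 ^ i -> cry u v i = false.
Proof.
move=> H; have Hu := leq_ltn_trans (leq_addr v u) H; have Hv := leq_ltn_trans (leq_addl u v) H.
by rewrite /cry !modn_small // leqNgt H.
Qed.

(** If both summands fit into [i] bits and no carry leaves, the sum fits as well. Applied along all
    adders and all stages, this shows that the bits processed so far are the whole numbers. *)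
Lemma quiet_small m i K : 0 < m -> (forall r, r < K -> cst r < 2 ^ i) ->
  (forall r t, r < K -> t < m -> cry (psum m r t) (zin m r) i = false) ->
  forall r, r < K -> zval m r < 2 ^ i.
Proof.
move=> Hm Hc Hq; elim=> [|r IH] Hr; first exact: Hc.
have Hz : zin m r.+1 < 2 ^ i.
  by rewrite /zin andbT; case: ifP => _; [apply: IH; exact: ltnW | rewrite expn_gt0].
have Hs t : t <= m -> psum m r.+1 t < 2 ^ i.
  elim: t => [|t IHt] Ht; first by rewrite psum0; apply: Hc.
  by rewrite psumS; apply: cry_small => //; [apply: IHt; exact: ltnW | apply: Hq].
by rewrite -psum_max; apply: Hs.
Qed.

(** A polynomial bound in the length of the arm; it is the source of the logarithmic number of
    passes. *)
Lemma zval_bound m c r : (forall r, cst r <= c) -> zval m r <= c * m.+1 ^ r.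
Proof.
move=> Hc; elim: r => [|r IH]; first by rewrite expn0 muln1 Hc.
have H1 : 0 < m.+1 ^ r by rewrite expn_gt0.
have H2 : (if keep r.+1 then zval m r else 0) <= c * m.+1 ^ r by case: ifP.
have H3 : cst r.+1 <= c * m.+1 ^ r by apply: leq_trans (Hc _) _; rewrite leq_pmulr.
rewrite /= expnS; apply: (@leq_trans (c * m.+1 ^ r + m * (c * m.+1 ^ r))); last by lia.
by rewrite leq_add // leq_mul2l H2 orbT.
Qed.

End Bits.

(** * The run of the protocol *)

Section Evolution.
Variables (k0 K0 : nat).
Notation k := k0.+2.
Notation K := K0.+1.
Variables (keep : nat -> bool) (cst : nat -> nat) (cmax : nat).
Variables (iP iM iD iI : 'I_K).
Notation state := (state K0 cmax).
Notation advance := (@advance k0 K0 cst cmax iP iM iD iI).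
Notation wiring := (@wiring k0 K0 cmax).
Notation beeping := (@beeping k0 K0 keep cmax).
Notation start_state := (start_state K0 cmax).
Variables (S : {fset node}) (compass : node -> 'Z_6) (cw : node -> bool).
Notation lab := (lab S compass cw).
Notation elab := (elab compass cw).
Notation heard := (@heard k0 S compass cw).
Hypothesis HS : connected_structure S.
Hypothesis S2 : (1 < #|` S|)%N.
Notation zval := (zval keep cst).
Notation zin := (zin keep cst).
Notation psum := (psum keep cst).
Variables (N : nat) (cf : nat -> S -> state) (coin : nat -> S -> bool).

(** The run is kept abstract, as configurations [cf] and coins [coin] obeying the recursion for [N]
    rounds; no probability enters before the end. *)
Definition rcv (t : nat) (v : S) : {set label k} :=
  heard (fun u => wiring (cf t u)) (fun u => beeping (cf t u)) v.

Hypothesis cf0 : forall v, cf 0 v = start_state.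
Hypothesis cfS : forall t v, (t < N)%N -> cf t.+1 v = advance (cf t v) (rcv t v) (coin t v).

Definition at_phase (t : nat) (c : phase K0) : Prop := forall v, ph (cf t v) = c.

Lemma ph_next t v : (t < N)%N -> ph (cf t.+1 v) = next_phase (cf t v) (rcv t v).
Proof. by move=> Ht; rewrite cfS. Qed.

Lemma sound_global t v : (forall u, wiring (cf t u) = setT) ->
  (rcv t v != set0) = [exists u, beeping (cf t u) != set0].
Proof. by move=> HT; apply: (heard_global compass cw HT HS). Qed.

Lemma all_if_neq0 b : (@all_if k0 b != set0) = b.
Proof.
case: b => /=; last by rewrite eqxx.
by apply/set0Pn; exists (0, ord0); rewrite inE.
Qed.

Lemma at_detect : (0 < N)%N -> at_phase 1 (PDetect K0).
Proof. by move=> H v; rewrite ph_next // /next_phase cf0. Qed.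

Lemma at_acute : (1 < N)%N -> at_phase 2 (PAcute K0).
Proof. by move=> H v; rewrite ph_next // /next_phase at_detect // ltnW. Qed.

Lemma nb_detect v : (1 < N)%N -> nb (cf 2 v) = lab (val v).
Proof.
move=> H; have H1 := at_detect (ltnW H); rewrite cfS //= H1.
apply/setP => m; rewrite in_lab !inE /hears /rcv heard_unwired.
- by [].
- by move=> u; rewrite /wiring H1.
- by move=> u; rewrite /beeping H1.
Qed.

Lemma nb_inv t v : (1 < t <= N)%N -> nb (cf t v) = lab (val v) /\ ph (cf t v) <> PStart K0 /\ ph (cf t v) <> PDetect K0.
Proof.
elim: t v => [//|[//|t] IH] v Ht.
have [E|Ht2] : t = 0%N \/ (1 < t.+1 <= N)%N by lia.
  by subst t; rewrite nb_detect ?at_acute //; case/andP: Ht.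
have [E [H1 H2]] := IH v Ht2.
have HtN : (t.+1 < N)%N by case/andP: Ht.
rewrite cfS //; case: (cf t.+1 v) E H1 H2 => p ? ? ? ? ? ? ? ? ? ? ? ? ? ? /=.
rewrite /next_phase /=.
by case: p => //= *; repeat case: ifP => //.
Qed.

Lemma nbE t v : (1 < t <= N)%N -> nb (cf t v) = lab (val v).
Proof. by move/(nb_inv v) => []. Qed.

Lemma at_obtuse : (2 < N)%N -> at_phase 3 (PObtuse K0).
Proof. by move=> H v; rewrite ph_next // /next_phase at_acute // ltnW. Qed.

Lemma at_veto : (3 < N)%N -> at_phase 4 (PVeto K0).
Proof. by move=> H v; rewrite ph_next // /next_phase at_obtuse // ltnW. Qed.

Lemma fit_veto v : (3 < N)%N -> fit (cf 4 v) =
  ((#|lab (val v)| == 3) ==> ends_hear (lab (val v)) (rcv 2 v)) &&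
  ((#|lab (val v)| == 2) ==> ends_hear (lab (val v)) (rcv 3 v)).
Proof.
move=> H; rewrite cfS //= at_obtuse; last exact: ltnW.
rewrite (cfS (t := 2)) //=; last exact: ltnW.
by rewrite at_acute ?nbE //; lia.
Qed.

Lemma at_check : (4 < N)%N ->
  if [forall v, fit (cf 4 v) && convex_type (lab (val v))] then at_phase 5 (PHeads K0)
  else at_phase 5 (PWait K0 false).
Proof.
move=> H; have Hv := at_veto (ltnW H).
have E v : (rcv 4 v != set0) = ~~ [forall v, fit (cf 4 v) && convex_type (lab (val v))].
  rewrite sound_global; last by move=> u; rewrite /wiring Hv.
  rewrite negb_forall; apply: eq_existsb => u.
  by rewrite /beeping Hv all_if_neq0 nbE //; lia.
case: ifP => Hf v; rewrite ph_next // /next_phase Hv E Hf //.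
Qed.

Section Check.
Hypothesis Hconv : forall z, z \in S -> convex_type (nbr S z).

Lemma hears_acute (v : S) t m : (1 < N)%N -> is_side S (val v) t m -> #|lab (val v)| <> 2 ->
  hears (rcv 2 v) (elab (val v) t) <-> #|lab (walk (val v) t m)| = 2.
Proof.
move=> H; have Ha := at_acute H; have Hn u : nb (cf 2 u) = lab (val u) by rewrite nbE.
apply: side_hears => //.
- by move=> u; rewrite /wiring Ha Hn.
- by move=> u a; rewrite /beeping Ha Hn; case: eqP => //; rewrite inE.
- move=> u l i Hu Hm; rewrite /beeping Ha Hn Hu eqxx inE /=.
  by case/andP: Hm.
Qed.

Lemma hears_obtuse (v : S) t m : (2 < N)%N -> is_side S (val v) t m -> #|lab (val v)| <> 3 ->
  hears (rcv 3 v) (elab (val v) t) <-> #|lab (walk (val v) t m)| = 3.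
Proof.
move=> H; have Ha := at_obtuse H; have Hn u : nb (cf 3 u) = lab (val u) by rewrite nbE //.
apply: side_hears => //.
- by move=> u; rewrite /wiring Ha Hn.
- by move=> u a; rewrite /beeping Ha Hn; case: eqP => //; rewrite inE.
- by move=> u l i Hu Hm; rewrite /beeping Ha Hn Hu eqxx inE /=.
Qed.

Lemma side_cards v t m : is_side S v t m ->
  (#|lab v| = 2 \/ #|lab v| = 3) /\ (#|lab (walk v t m)| = 2 \/ #|lab (walk v t m)| = 3).
Proof.
case=> m0 HS' _ /andP[_ H1] /andP[_ H2]; rewrite !card_lab; split; apply: convex_card => //; apply: Hconv.
  by have := HS' 0%N isT; rewrite walk0.
exact: HS'.
Qed.
End Check.

Lemma convex_lab v : convex_type (lab v) = convex_type (nbr S v).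
Proof.
apply/idP/idP; last exact: convex_type_pre.
have -> : nbr S v = pre (cw v) (turnV (cw v) (compass v) 0) (lab v).
  apply/setP => m; rewrite !in_set turnA addbb.
  by have -> : turn (cw v) (compass v) (turnV (cw v) (compass v) 0) = 0 by [exact: turnVK]; rewrite /turn add0r.
exact: convex_type_pre.
Qed.

(** Each kind of corner listens while the other kind beeps, so success means that all sides have
    ends of different kinds. What is heard is only interpreted under convexity, which the same veto
    enforces. *)
Lemma check_region : (3 < N)%N ->
  [forall v, fit (cf 4 v) && convex_type (lab (val v))] <->
  exists v c s (A B : nat), [/\ (0 < A)%N, (0 < B)%N & is_region S v c s A B].
Proof.
move=> H; split => [/forallP Hf|[v0 [c [s [A [B [A0 B0 HR]]]]]]].
  have Hconv z : z \in S -> convex_type (nbr S z).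
    by move=> Hz; have /andP[_] := Hf [` Hz]%fset; rewrite convex_lab.
  apply: convex_region => // v t m Hs; apply/eqP => E.
  have Hv : v \in S by case: Hs => _ /(_ 0%N isT); rewrite walk0.
  have [] := side_cards Hconv Hs; rewrite !card_lab -E => Hv23 _.
  have /andP[] := Hf [` Hv]%fset; rewrite fit_veto // !card_lab /= => /andP[H3 H2] _.
  have Et : is_end (lab v) (elab v t) by rewrite is_end_lab elabK; case: Hs => _ _ _ /andP[].
  pose w : S := [` Hv]%fset.
  have H2N : (2 < N)%N := ltnW H; have H1N : (1 < N)%N := ltnW H2N.
  case: Hv23 => Ev.
    have Hne : #|lab (val w)| <> 3 by rewrite card_lab /= Ev.
    move: H2; rewrite Ev eqxx => /forallP/(_ (elab v t)); rewrite Et /=.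
    move/(proj1 (@hears_obtuse Hconv w t m H2N Hs Hne)).
    by rewrite card_lab -E Ev.
  have Hne : #|lab (val w)| <> 2 by rewrite card_lab /= Ev.
  move: H3; rewrite Ev eqxx => /forallP/(_ (elab v t)); rewrite Et /=.
  move/(proj1 (@hears_acute Hconv w t m H1N Hs Hne)).
  by rewrite card_lab -E Ev.
have Hconv z : z \in S -> convex_type (nbr S z) by apply: region_convex HR A0 B0.
apply/forallP => v; rewrite convex_lab Hconv ?andbT; last exact: valP.
rewrite fit_veto //; apply/andP; split; apply/implyP => /eqP Hc; apply/forallP => m; apply/implyP;
  rewrite is_end_lab => He; have Hc4 : (#|nbr S (val v)| < 4)%N by [rewrite -(card_lab S compass cw) Hc];
  have [l Hl Hne] := region_sides HR A0 B0 (valP v) Hc4 He.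
- rewrite -(edirK compass cw (val v) m); apply/(hears_acute Hconv _ Hl); rewrite ?Hc //; first exact: ltnW (ltnW H).
  have [_ [//|E]] := side_cards Hconv Hl; move: Hne; rewrite -!(card_lab S compass cw) Hc E.
  by rewrite eqxx.
- rewrite -(edirK compass cw (val v) m); apply/(hears_obtuse Hconv _ Hl); rewrite ?Hc //; first exact: ltnW.
  have [_ [E|//]] := side_cards Hconv Hl; move: Hne; rewrite -!(card_lab S compass cw) Hc E.
  by rewrite eqxx.
Qed.

Lemma after_check : (4 < N)%N ->
  if `[< exists v c s (A B : nat), [/\ (0 < A)%N, (0 < B)%N & is_region S v c s A B] >]
  then at_phase 5 (PHeads K0) else at_phase 5 (PWait K0 false).
Proof.
move=> H; have := at_check H; have := check_region (ltnW H).
case: ifP => Hf; case: asboolP => //.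
  by move=> Hn [H1 _]; case: Hn; apply: H1.
by move=> Hy [_ H2]; have := H2 Hy.
Qed.

(** * Election of the leader *)

Section Election.
Variables (v0 : node) (c0 : 'Z_6) (s0 : bool) (A B : nat).
Hypothesis HR : is_region S v0 c0 s0 A B.
Hypothesis A0 : (0 < A)%N.
Hypothesis B0 : (0 < B)%N.
Variables (w1 w2 : S).
Hypothesis Hw1 : val w1 = v0.
Hypothesis Hw2 : val w2 = pt v0 c0 s0 (A%:Z, B%:Z).

Lemma acute_corner v : (#|lab (val v)| == 2) = (v == w1) || (v == w2).
Proof.
apply/eqP/orP; rewrite card_lab (region_acute HR A0 B0 (valP v)).
  by case=> E; [left|right]; apply/eqP/val_inj; rewrite E ?Hw1 ?Hw2.
by case=> /eqP ->; rewrite ?Hw1 ?Hw2; [left|right].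
Qed.

Lemma corners_ex (g : S -> bool) : [exists u, (#|lab (val u)| == 2) && g u] = g w1 || g w2.
Proof.
apply/existsP/orP => [[u]|[Hg|Hg]].
- by rewrite acute_corner => /andP[/orP[]/eqP ->]; [left|right].
- by exists w1; rewrite acute_corner eqxx Hg.
- by exists w2; rewrite acute_corner eqxx Hg orbT.
Qed.

Lemma flip_start v : (4 < N)%N -> flip (cf 5 v) = coin 4 v.
Proof. by move=> H; rewrite cfS //= at_veto // ltnW. Qed.

(** Heads and tails are announced in separate rounds on the global circuit; both are heard exactly
    if the two acute corners differ. The coin of the second round is the flip of the next
    attempt. *)
Lemma election_round t : at_phase t (PHeads K0) -> (1 < t)%N -> (t.+1 < N)%N ->
  if flip (cf t w1) != flip (cf t w2)
  then at_phase t.+2 (PNetA K0) /\ forall v, lead (cf t.+2 v) = ((v == w1) || (v == w2)) && flip (cf t v)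
  else at_phase t.+2 (PHeads K0) /\ forall v, flip (cf t.+2 v) = coin t.+1 v.
Proof.
move=> Hph Ht HtN; have HtN' := ltnW HtN.
have Hnb u : nb (cf t u) = lab (val u) by rewrite nbE // Ht ltnW.
have Hnb1 u : nb (cf t.+1 u) = lab (val u) by rewrite nbE // ltnW.
have Hph1 : at_phase t.+1 (PTails K0) by move=> v; rewrite cfS //= /next_phase Hph.
have E1 v : (rcv t v != set0) = flip (cf t w1) || flip (cf t w2).
  rewrite sound_global; last by move=> u; rewrite /wiring Hph.
  rewrite -(corners_ex (fun u => flip (cf t u))); apply: eq_existsb => u.
  by rewrite /beeping Hph all_if_neq0 Hnb.
have F1 v : flip (cf t.+1 v) = flip (cf t v) by rewrite cfS //= Hph.
have G1 v : heads (cf t.+1 v) = flip (cf t w1) || flip (cf t w2) by rewrite cfS //= Hph E1.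
have E2 v : (rcv t.+1 v != set0) = ~~ flip (cf t w1) || ~~ flip (cf t w2).
  rewrite sound_global; last by move=> u; rewrite /wiring Hph1.
  rewrite -(corners_ex (fun u => ~~ flip (cf t u))); apply: eq_existsb => u.
  by rewrite /beeping Hph1 all_if_neq0 Hnb1 F1.
have Hsp : (flip (cf t w1) || flip (cf t w2)) && (~~ flip (cf t w1) || ~~ flip (cf t w2)) =
    (flip (cf t w1) != flip (cf t w2)) by case: (flip _); case: (flip _).
case: ifP => Hs; split=> v; rewrite cfS //= ?/next_phase Hph1 //.
- by rewrite G1 E2 Hsp Hs.
- by rewrite Hnb1 F1 acute_corner.
- by rewrite G1 E2 Hsp Hs.
Qed.

Hypothesis Hstart : at_phase 5 (PHeads K0).

(** The first flip is the coin of the veto round 4, each later one comes two rounds after its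
    predecessor: hence the indices [4 + 2 * j]. *)
Lemma election J : (5 + 2 * J <= N)%N ->
  (exists2 j, (j < J)%N & coin (4 + 2 * j) w1 != coin (4 + 2 * j) w2) ->
  exists2 j, (j < J)%N & at_phase (7 + 2 * j) (PNetA K0) /\
    exists2 L : S, L = w1 \/ L = w2 & forall v, lead (cf (7 + 2 * j) v) = (v == L).
Proof.
move=> HN Hex.
have Hex' : exists j, (j < J)%N && (coin (4 + 2 * j) w1 != coin (4 + 2 * j) w2).
  by case: Hex => j H1 H2; exists j; rewrite H1.
have [j /andP[Hj Hjc] Hmin] := ex_minnP Hex'.
have Heads i : (i <= j)%N -> at_phase (5 + 2 * i) (PHeads K0) /\
    forall v, flip (cf (5 + 2 * i) v) = coin (4 + 2 * i) v.
  elim: i => [|i IH] Hi; first by split => // v; rewrite flip_start //; lia.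
  have [IH1 IH2] := IH (ltnW Hi).
  have := election_round IH1; rewrite !IH2.
  have -> : coin (4 + 2 * i) w1 != coin (4 + 2 * i) w2 = false.
    apply/negbTE/negP => Hc; have := Hmin i; rewrite Hc andbT; lia.
  have -> : (5 + 2 * i.+1 = (5 + 2 * i).+2)%N by lia.
  have -> : (4 + 2 * i.+1 = (5 + 2 * i).+1)%N by lia.
  by apply; lia.
have [H1 H2] := Heads j (leqnn j).
have := election_round H1; rewrite !H2 Hjc.
have -> : (5 + 2 * j).+2 = (7 + 2 * j)%N by lia.
case; [lia | lia |].
move=> Hnet Hl; exists j => //; split => //.
have w12 : w1 != w2.
  apply/eqP => E; have := Hw2; rewrite -E Hw1 -{1}(pt00 v0 c0 s0) => /pt_inj [] ; lia.
exists (if coin (4 + 2 * j) w1 then w1 else w2); first by case: ifP; [left|right].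
move=> v; rewrite Hl H2; case: (v =P w1) => [->|Hv1] /=.
  by case: ifP => _; rewrite ?eqxx ?(negPf w12).
case: (v =P w2) => [->|Hv2] /=.
  by move: Hjc; case: (coin _ w1); case: (coin _ w2); rewrite ?eqxx // [w2 == w1]eq_sym (negPf w12).
by case: ifP => _; apply/esym/eqP.
Qed.
End Election.

(** * Marking the arms *)

Section Arms.
Variables (L : S) (len : bool -> nat) (ar : bool -> nat -> S).
Notation arm_dir := (arm_dir compass cw L).
Notation arm_side := (arm_side cw L).
Hypothesis Hlen : forall b, (0 < len b)%N.
Hypothesis Hturn : forall b, arm_dir (~~ b) = turn (arm_side b) (arm_dir b) 1.
Hypothesis Hreg : forall b, is_region S (val L) (arm_dir b) (arm_side b) (len b) (len (~~ b)).
Hypothesis Har : forall b j, (j <= len b)%N -> val (ar b j) = walk (val L) (arm_dir b) j.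

Definition out_spec (o : S -> option 'Z_6) : Prop :=
  (forall b j, (0 < j <= len b)%N -> o (ar b j) = Some (elab (val (ar b j)) (arm_dir b + 3))) /\
  (forall w, (forall b j, (0 < j <= len b)%N -> w <> ar b j) -> o w = None).

Lemma net_facts (W : S -> {set label k * label k}) (Bp : S -> {set label k}) b :
  (forall v, W v = net_wires k0) ->
  (forall v, Bp v = if v == L then [set a : label k | a.1 == arm_label (lab (val L)) b] else set0) ->
  forall b' j, (j < len b')%N ->
  let h := fun w => [set m | hears (heard W Bp w) m] in
  let n := if b' == b then 0%N else 2%N in
  (elab (val (ar b' j)) (arm_dir b') \in h (ar b' j)) = (j %% 3 == n)%N /\
  (elab (val (ar b' j.+1)) (arm_dir b' + 3) \in h (ar b' j.+1)) = (j %% 3 == n)%N.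
Proof.
move=> HW HB b' j Hj h n; rewrite !inE.
have HB' v : Bp v = if v == L then [set a : label k | a.1 == elab (val L) (arm_dir b)] else set0.
  by rewrite HB edirK.
have Hst : val (ar b' j.+1) = val (ar b' j) + dir (arm_dir b') by rewrite !Har ?walkS // ltnW.
rewrite (hears_cross compass cw HW Bp Hst); suff -> : hears (heard W Bp (ar b' j)) (elab (val (ar b' j)) (arm_dir b')) = (j %% 3 == n)%N by [].
rewrite /n; case: (b' =P b) => [Eb|/eqP Hb] /=.
  have Ee : arm_dir b = arm_dir b' by rewrite Eb.
  by rewrite (own_bond HW HB' (Hreg b') (Hlen _) (Hlen _) Ee Hj) // Har // ltnW.
apply: (oth_bond HW HB' (Hreg b') (Hlen _) (Hlen _)) => //; last by rewrite Har // ltnW.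
by rewrite -Hturn; congr arm_dir; case: b b' Hb {HB HB' Hj n Hst} => -[].
Qed.

Section Setup.
Variable t0 : nat.
Hypothesis Ht0 : (1 < t0)%N.
Hypothesis HtN : (t0.+4 <= N)%N.
Hypothesis Hnet : at_phase t0 (PNetA K0).
Hypothesis Hlead : forall v, lead (cf t0 v) = (v == L).

Let t1N : (t0 < N)%N. Proof. lia. Qed.
Let t2N : (t0.+1 < N)%N. Proof. lia. Qed.
Let t3N : (t0.+2 < N)%N. Proof. lia. Qed.
Let t4N : (t0.+3 < N)%N. Proof. exact: HtN. Qed.

Let ph1 : at_phase t0.+1 (PNetB K0). Proof. by move=> v; rewrite cfS //= /next_phase Hnet. Qed.
Let ph2 : at_phase t0.+2 (PArmA K0). Proof. by move=> v; rewrite cfS //= /next_phase ph1. Qed.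
Let ph3 : at_phase t0.+3 (PArmB K0). Proof. by move=> v; rewrite cfS //= /next_phase ph2. Qed.

Let nbt t v : (t0 <= t <= N)%N -> nb (cf t v) = lab (val v).
Proof. by move=> Ht; rewrite nbE //; move: Ht Ht0; lia. Qed.

Let lead1 v : lead (cf t0.+1 v) = (v == L). Proof. by rewrite cfS //= Hnet. Qed.
Let lead2 v : lead (cf t0.+2 v) = (v == L). Proof. by rewrite cfS //= ph1. Qed.
Let lead3 v : lead (cf t0.+3 v) = (v == L). Proof. by rewrite cfS //= ph2. Qed.

Let neta2 w : neta (cf t0.+2 w) = [set m | hears (rcv t0 w) m].
Proof. by rewrite cfS //= ph1 cfS //= Hnet. Qed.
Let netb2 w : netb (cf t0.+2 w) = [set m | hears (rcv t0.+1 w) m].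
Proof. by rewrite cfS //= ph1. Qed.
Let neta3 w : neta (cf t0.+3 w) = neta (cf t0.+2 w).
Proof. by rewrite cfS //= ph2. Qed.
Let netb3 w : netb (cf t0.+3 w) = netb (cf t0.+2 w).
Proof. by rewrite cfS //= ph2. Qed.

Let facts_a : forall b' j, (j < len b')%N ->
  let n := if b' == false then 0%N else 2%N in
  (elab (val (ar b' j)) (arm_dir b') \in neta (cf t0.+2 (ar b' j))) = (j %% 3 == n)%N /\
  (elab (val (ar b' j.+1)) (arm_dir b' + 3) \in neta (cf t0.+2 (ar b' j.+1))) = (j %% 3 == n)%N.
Proof.
move=> b' j Hj; rewrite !neta2.
apply: (@net_facts _ _ false) => // v; first by rewrite /wiring Hnet.
by rewrite /beeping Hnet Hlead nbt ?leqnn 1?ltnW //; case: eqP => // ->.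
Qed.

Let facts_b : forall b' j, (j < len b')%N ->
  let n := if b' == true then 0%N else 2%N in
  (elab (val (ar b' j)) (arm_dir b') \in netb (cf t0.+2 (ar b' j))) = (j %% 3 == n)%N /\
  (elab (val (ar b' j.+1)) (arm_dir b' + 3) \in netb (cf t0.+2 (ar b' j.+1))) = (j %% 3 == n)%N.
Proof.
move=> b' j Hj; rewrite !netb2.
apply: (@net_facts _ _ true) => // v; first by rewrite /wiring ph1.
by rewrite /beeping ph1 lead1 nbt ?leqnSn 1?ltnW //; case: eqP => // ->.
Qed.

Let hear_a w m : hears (rcv t0.+2 w) m <-> on_arm compass cw L len ar false w m.
Proof.
have HW v : wiring (cf t0.+2 v) = track_wires k0 (lab (val v)) ((fun=> false) v).
  by rewrite /wiring ph2 nbt //; lia.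
have HB v : beeping (cf t0.+2 v) = if v == L
    then [set a : label k | [exists b, (a.1 == arm_label (lab (val L)) b) && negb b]] else set0.
  rewrite /beeping ph2 lead2; case: eqP => // ->.
  rewrite nbt; last lia.
  apply/setP => a; rewrite !inE; apply/idP/existsP => [Ha|[[] /andP[H1]]] //.
  by exists false; rewrite Ha.
rewrite /rcv (arms_hear Hlen Hreg Har HW (fun=> erefl) HB).
by split=> [[[]]|H] //; exists false.
Qed.

Let hear_b w m : hears (rcv t0.+3 w) m <-> on_arm compass cw L len ar true w m.
Proof.
have HW v : wiring (cf t0.+3 v) = track_wires k0 (lab (val v)) ((fun=> false) v).
  by rewrite /wiring ph3 nbt //; lia.
have HB v : beeping (cf t0.+3 v) = if v == L
    then [set a : label k | [exists b, (a.1 == arm_label (lab (val L)) b) && id b]] else set0.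
  rewrite /beeping ph3 lead3; case: eqP => // ->.
  rewrite nbt; last lia.
  apply/setP => a; rewrite !inE; apply/idP/existsP => [Ha|[[] /andP[H1]]] //.
  by exists true; rewrite Ha.
rewrite /rcv (arms_hear Hlen Hreg Har HW (fun=> erefl) HB).
by split=> [[[]]|H] //; exists true.
Qed.

Lemma setup_phase : at_phase t0.+4 (PInput ord0).
Proof. by move=> v; rewrite cfS //= /next_phase ph3. Qed.

Lemma setup_lead v : lead (cf t0.+4 v) = (v == L).
Proof. by rewrite cfS //= ph3. Qed.

Lemma setup_out : out_spec (fun v => out (cf t0.+4 v)).
Proof.
have nb2 v : nb (cf t0.+2 v) = lab (val v) by rewrite nbt //; lia.
have nb3 v : nb (cf t0.+3 v) = lab (val v) by rewrite nbt //; lia.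
have E v : out (cf t0.+4 v) =
    if arm_out (lab (val v)) (netb (cf t0.+2 v)) (neta (cf t0.+2 v)) (rcv t0.+3 v) is Some m then Some m
    else arm_out (lab (val v)) (neta (cf t0.+2 v)) (netb (cf t0.+2 v)) (rcv t0.+2 v).
  have O3 : out (cf t0.+3 v) =
      arm_out (lab (val v)) (neta (cf t0.+2 v)) (netb (cf t0.+2 v)) (rcv t0.+2 v).
    by rewrite cfS //= ph2 nb2.
  by rewrite cfS //= ph3 nb3 neta3 netb3 O3.
pose na (v : S) := neta (cf t0.+2 v); pose nB (v : S) := netb (cf t0.+2 v).
have OnA := @arm_out_on k0 S compass cw L len ar Hlen Hturn Hreg Har false na nB _ (@facts_a false) (@facts_b false) hear_a.
have OnB := @arm_out_on k0 S compass cw L len ar Hlen Hturn Hreg Har true nB na _ (@facts_b true) (@facts_a true) hear_b.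
have OffA := @arm_out_off k0 S compass cw L len ar Hlen Hreg Har false na nB _ hear_a.
have OffB := @arm_out_off k0 S compass cw L len ar Hlen Hreg Har true nB na _ hear_b.
split=> [b j Hj|w Hw]; rewrite E -?/(na _) -?/(nB _).
  case: b Hj => Hj; first by rewrite OnB.
  by rewrite OffB ?OnA // => j' /andP[_ Hj'] /(ar_inj Hturn Har Hj Hj') [].
by rewrite OffB ?OffA // => j; exact: Hw.
Qed.

Lemma setup_arith v : [/\ carry (cf t0.+4 v) = [ffun=> false],
  rest (cf t0.+4 v) = [ffun s : 'I_K => inord (cst s)],
  zbit (cf t0.+4 v) = [ffun=> false] & cmp (cf t0.+4 v) = [ffun=> (false, true, true)]].
Proof. by rewrite cfS //= ph3. Qed.
End Setup.

(** * The loop over the bits *)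

Definition cmp_spec (i : nat) (b : bool) : bool * bool * bool :=
  let x := len b in let y := len (~~ b) in
  (cry (zval x iM) (zval y iD) i,
   ((zval x iM + zval y iD) %% 2 ^ i == zval x iP %% 2 ^ i)%N,
   (zval x iI %% 2 ^ i <= zval y iI %% 2 ^ i)%N).

(* [i] bits have been processed in all stages, and one more in the first [s]. *)
Record loop_inv (t : nat) (p : phase K0) (i s : nat) : Prop := LoopInv {
  loop_ph : at_phase t p;
  loop_lead : forall v, lead (cf t v) = (v == L);
  loop_out : out_spec (fun v => out (cf t v));
  loop_carry : forall b j (r : 'I_K), (0 < j <= len b)%N -> carry (cf t (ar b j)) r =
    cry (psum (len b) r (len b - j)) (zin (len b) r) (if (r < s)%N then i.+1 else i);
  loop_carry0 : forall w r, out (cf t w) = None -> carry (cf t w) r = false;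
  loop_rest : forall v (r : 'I_K), rest (cf t v) r = (cst r %/ 2 ^ i)%N :> nat;
  loop_zbit : forall b (r : 'I_K), (r < s)%N -> zbit (cf t L) (b, r) = bit (zval (len b) r) i;
  loop_cmp : forall b, cmp (cf t L) b = cmp_spec i b;
  loop_cmp0 : forall v b, v != L -> (cmp (cf t v) b).1.1 = false }.

Lemma bit_lt_half n i : (n %/ 2 ^ i)./2 = (n %/ 2 ^ i.+1)%N.
Proof. by rewrite -divn2 -divnMA -expnSr. Qed.

Section Stage.
Variables (t i : nat) (s : 'I_K).
Hypothesis Ht : (1 < t)%N.
Hypothesis HtN : (t.+2 <= N)%N.
Hypothesis HI : loop_inv t (PInput s) i s.

Let t1N : (t < N)%N. Proof. exact: ltnW. Qed.
Let ph1 : at_phase t.+1 (PAdd s).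
Proof. by move=> v; rewrite cfS //= /next_phase (loop_ph HI). Qed.
Let nb0 v : nb (cf t v) = lab (val v).
Proof. by rewrite nbE // Ht ltnW. Qed.
Let nb1 v : nb (cf t.+1 v) = lab (val v).
Proof. by rewrite nbE // ltnW. Qed.
Let out1 v : out (cf t.+1 v) = out (cf t v).
Proof. by rewrite cfS //= (loop_ph HI). Qed.
Let carry1 v : carry (cf t.+1 v) = carry (cf t v).
Proof. by rewrite cfS //= (loop_ph HI). Qed.
Let rest1 v : rest (cf t.+1 v) = rest (cf t v).
Proof. by rewrite cfS //= (loop_ph HI). Qed.

Lemma stage_input b : in_bit keep (cf t L) b s = bit (zin (len b) s) i.
Proof.
rewrite /in_bit /zin; case: (keep s) => /=; last by rewrite bit0.
case: (posnP s) => [_|Hs] /=; first by rewrite bit0.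
have Hs' : (s.-1 < K)%N := leq_ltn_trans (leq_pred s) (ltn_ord s).
by rewrite (loop_zbit HI) inordK // ltn_predL.
Qed.

Lemma stage_xbit b j : (0 < j <= len b)%N -> xbit (cf t.+1 (ar b j)) = bit (zin (len b) s) i.
Proof.
move=> Hj; rewrite cfS //= (loop_ph HI); have [-> // _] := loop_out HI.
have HW v : wiring (cf t v) = track_wires k0 (lab (val v)) ((fun=> false) v).
  by rewrite /wiring (loop_ph HI) nb0.
have HB v : beeping (cf t v) = if v == L
    then [set a : label k | [exists b, (a.1 == arm_label (lab (val L)) b) && bit (zin (len b) s) i]] else set0.
  rewrite /beeping (loop_ph HI) (loop_lead HI); case: eqP => // ->; rewrite nb0.
  by apply/setP => a; rewrite !inE; apply: eq_existsb => b'; rewrite stage_input.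
apply/idP/idP; rewrite /rcv (arms_hear Hlen Hreg Har HW (fun=> erefl) HB).
  case=> b' Hb' [j' Hj' [[E _]|[E _]]].
    by have [-> _] := ar_inj Hturn Har Hj (ltnW Hj') E.
  by have [-> _] := ar_inj Hturn Har Hj Hj' E.
move=> Hb; exists b => //; exists j.-1; first by lia.
by right; rewrite prednK //; case/andP: Hj.
Qed.

Let fl v := flipped (cf t.+1 v) s.
Let HW1 v : wiring (cf t.+1 v) = track_wires k0 (lab (val v)) (fl v).
Proof. by rewrite /wiring ph1 nb1. Qed.

Let tr b j := arm_side b (+) bit (psum (len b) s (len b - j)) i.

(** Adders are counted from the far end: amoebot [j] turns the partial sum after [len b - j]
    additions into the next one. The bond beyond it carries the old sum bit and the bond towards the
    leader the new one, so the track crosses exactly when the bit changes. *)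
Lemma stage_flip b j : (0 < j < len b)%N -> tr b j.-1 = tr b j (+) fl (ar b j).
Proof.
move=> Hj; have Hj' : (0 < j <= len b)%N by lia.
rewrite /fl /flipped out1; have [-> // _] := loop_out HI.
rewrite /= stage_xbit // carry1 (loop_carry HI) // ltnn /tr.
have -> : (len b - j.-1 = (len b - j).+1)%N by lia.
by rewrite psumS bit_add !addbA.
Qed.

Lemma stage_beep b : beeping (cf t.+1 (ar b (len b))) =
  [set bit_pin k0 (lab (val (ar b (len b)))) (elab (val (ar b (len b))) (arm_dir b + 3))
    (bit (psum (len b) s 1) i)].
Proof.
have Hj : (0 < len b <= len b)%N by rewrite Hlen leqnn.
rewrite /beeping ph1 nb1 (card_ar Hlen Hreg Har) // (gtn_eqF (Hlen b)) eqxx /= out1.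
have [-> // _] := loop_out HI; rewrite stage_xbit // carry1 (loop_carry HI) // ltnn subnn.
by rewrite rest1 (loop_rest HI) psumS !psum0 bit_add.
Qed.

Lemma stage_silent b j : (j < len b)%N -> beeping (cf t.+1 (ar b j)) = set0.
Proof.
move=> Hj; rewrite /beeping ph1 nb1 (card_ar Hlen Hreg Har) ?(ltnW Hj) // (ltn_eqF Hj).
by case: (j == 0%N).
Qed.

(** The interior pin lies on the track [tr b] of the far beep if the bit is 1. If it is 0, the pin
    lies on the complementary track, whose only candidate for a beep is the far corner, and that
    beeps on the other pin. *)
Lemma stage_hear b j : (j < len b)%N ->
  (bit_pin k0 (lab (val (ar b j))) (elab (val (ar b j)) (arm_dir b)) true \in rcv t.+1 (ar b j)) =
  bit (psum (len b) s (len b - j)) i.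
Proof.
move=> Hj; have H0 := Hlen b.
pose x : pin_name S k := (ar b j, bit_pin k0 (lab (val (ar b j))) (elab (val (ar b j)) (arm_dir b)) true).
pose y : pin_name S k := (ar b (len b), bit_pin k0 (lab (val (ar b (len b))))
   (elab (val (ar b (len b))) (arm_dir b + 3)) (bit (psum (len b) s 1) i)).
have Ex : x = side_pin k0 compass cw (ar b j) (arm_dir b) (arm_side b (+) true).
  exact: (bit_pin_away k0 Hlen Hreg Har).
have Ey : y = side_pin k0 compass cw (ar b (len b)) (arm_dir b + 3) (~~ tr b (len b).-1).
  rewrite /y (bit_pin_toward k0 Hlen Hreg Har) ?H0 ?leqnn //.
  by rewrite /tr; have -> : (len b - (len b).-1 = 1)%N by lia.
have Hy : on_track compass cw (ar b) (arm_dir b) (len b) (tr b) y.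
  by exists (len b).-1; [rewrite ltn_predL | right; rewrite prednK].
have Hheard tr' : (forall j, (0 < j < len b)%N -> tr' j.-1 = tr' j (+) fl (ar b j)) ->
    on_track compass cw (ar b) (arm_dir b) (len b) tr' x ->
    x.2 \in rcv t.+1 x.1 <-> exists2 y, on_track compass cw (ar b) (arm_dir b) (len b) tr' y & y.2 \in beeping (cf t.+1 y.1).
  exact: (arm_track_heard Hlen Hreg Har _ HW1).
rewrite -[bit_pin _ _ _ _]/(x.2) -[X in rcv _ X]/(x.1).
case Eb : (bit (psum (len b) s (len b - j)) i).
  apply/(Hheard (tr b)); first exact: stage_flip.
    by exists j => //; left; rewrite Ex /tr Eb.
  by exists y => //; rewrite /y /= stage_beep inE.
apply/negbTE/negP.
have Hx : on_track compass cw (ar b) (arm_dir b) (len b) (fun j => ~~ tr b j) x.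
  by exists j => //; left; rewrite Ex /tr Eb addbF addbT.
rewrite (Hheard (fun j => ~~ tr b j)) //; last by move=> j' Hj'; rewrite stage_flip // addNb.
case=> z [j' Hj' Hz] Hzb.
have Ez : z = side_pin k0 compass cw (ar b j'.+1) (arm_dir b + 3) (~~ ~~ tr b j') /\ j'.+1 = len b.
  case: Hz => Ez; first by move: Hzb; rewrite Ez /= stage_silent // inE.
  split => //; apply/eqP; apply: contraT => Hne; move: Hzb; rewrite Ez /= stage_silent ?inE //.
  by rewrite ltn_neqAle Hne.
case: Ez => Ez Ejl; move: Hzb; rewrite Ez [(side_pin _ _ _ _ _ _).1]/= Ejl stage_beep inE => /eqP E2.
have : side_pin k0 compass cw (ar b (len b)) (arm_dir b + 3) (~~ ~~ tr b j') = y.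
  by rewrite [LHS]surjective_pairing E2.
rewrite Ey -Ejl /= => /side_pin_inj [_ [_]]; by case: (tr b j').
Qed.

Lemma stage : loop_inv t.+2 (if s == ord_max then PUpdate K0 else PInput (inord s.+1)) i s.+1.
Proof.
have Hz : forall b (r : 'I_K), zbit (cf t.+2 L) (b, r) = if r == s
    then bit (zval (len b) s) i else zbit (cf t L) (b, r).
  move=> b r; rewrite cfS //= ph1.
  have -> : lead (cf t.+1 L) by rewrite cfS //= (loop_ph HI) (loop_lead HI) eqxx.
  rewrite ffunE /=; case: (r =P s) => [_|_]; last by rewrite cfS //= (loop_ph HI).
  have := stage_hear (Hlen b); rewrite subn0 psum_max => <-.
  by rewrite nb1 (ar0 Har) edirK.
have Eo v : out (cf t.+2 v) = out (cf t v) by rewrite cfS //= ph1 out1.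
have Hcs v r : carry (cf t.+2 v) r = if r == s then next_carry (cf t.+1 v) (rcv t.+1 v) s else carry (cf t v) r.
  by rewrite cfS //= ph1 ffunE carry1.
split.
- by move=> v; rewrite cfS //= /next_phase ph1.
- by move=> v; rewrite cfS //= ph1 cfS //= (loop_ph HI) (loop_lead HI).
- have [O1 O2] := loop_out HI; split=> [b j Hj|w Hw]; rewrite Eo; [exact: O1|exact: O2].
- move=> b j r Hj; rewrite Hcs; case: eqP => [->|Hr]; last first.
    rewrite (loop_carry HI) // ltnS [in RHS]leq_eqVlt.
    by case: eqP => // E; case: Hr; apply/val_inj.
  rewrite ltnSn /next_carry out1; have [-> // _] := loop_out HI.
  rewrite stage_xbit // carry1 (loop_carry HI) // ltnn cryS; congr (maj _ _ _).
  rewrite nb1 (card_ar Hlen Hreg Har); last by case/andP: Hj.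
  rewrite (gtn_eqF (proj1 (andP Hj))); case: (j =P len b) => [->|/eqP Hjl] /=.
    by rewrite rest1 (loop_rest HI) subnn psum0.
  have Hlt : (j < len b)%N by rewrite ltn_neqAle Hjl; case/andP: Hj.
  by rewrite -(stage_hear Hlt) -elab_add3 add33.
- move=> w r Hw; rewrite Eo in Hw; rewrite Hcs.
  by case: eqP => _; rewrite ?/next_carry ?out1 ?Hw ?carry1 (loop_carry0 HI).
- by move=> v r; rewrite cfS //= ph1 rest1 (loop_rest HI).
- move=> b r; rewrite ltnS leq_eqVlt Hz => /orP[/eqP E|Hr].
    by have -> : r = s by [apply/val_inj]; rewrite eqxx.
  by case: eqP => [->|_] //; rewrite (loop_zbit HI).
- by move=> b; rewrite cfS //= ph1 cfS //= (loop_ph HI) (loop_cmp HI).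
- by move=> v b Hv; rewrite cfS //= ph1 cfS //= (loop_ph HI) (loop_cmp0 HI).
Qed.
End Stage.

Lemma stages t i : (1 < t)%N -> (t + 2 * K <= N)%N -> loop_inv t (PInput ord0) i 0 ->
  loop_inv (t + 2 * K) (PUpdate K0) i K.
Proof.
move=> Ht HtN H0.
have H s : (s <= K0)%N -> loop_inv (t + 2 * s) (PInput (inord s)) i s.
  elim: s => [|s IH] Hs; first by rewrite muln0 addn0; have -> : inord 0 = ord0 :> 'I_K by apply/val_inj; rewrite /= inordK.
  have := IH (ltnW Hs); rewrite -[X in loop_inv _ _ _ X](inordK (m := s) (n' := K0)); last by rewrite ltnS ltnW.
  move/stage; rewrite inordK; last by rewrite ltnS ltnW.
  have -> : (inord s : 'I_K) == ord_max = false.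
    by apply/negbTE; rewrite -val_eqE /= inordK ?ltn_eqF // ltnS ltnW.
  have -> : ((t + 2 * s).+2 = t + 2 * s.+1)%N by lia.
  by apply; lia.
have := H K0 (leqnn K0); rewrite -[X in loop_inv _ _ _ X](inordK (m := K0) (n' := K0)) //.
move/stage; rewrite inordK //.
have -> : (inord K0 : 'I_K) == ord_max by rewrite -val_eqE /= inordK.
have -> : ((t + 2 * K0).+2 = t + 2 * K)%N by lia.
by apply; lia.
Qed.

Lemma update t i : (t < N)%N -> loop_inv t (PUpdate K0) i K -> loop_inv t.+1 (PActive K0) i.+1 0.
Proof.
move=> HtN HI; have Hph := loop_ph HI.
split.
- by move=> v; rewrite cfS //= /next_phase Hph.
- by move=> v; rewrite cfS //= Hph (loop_lead HI).
- by have [O1 O2] := loop_out HI; split=> [b j Hj|w Hw]; rewrite cfS //= Hph; [exact: O1|exact: O2].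
- by move=> b j r Hj; rewrite cfS //= Hph (loop_carry HI) // ltn_ord.
- by move=> w r; rewrite cfS //= Hph; apply: (loop_carry0 HI).
- move=> v r; rewrite cfS //= Hph ffunE inordK ?(loop_rest HI) ?bit_lt_half //.
  apply: (@leq_ltn_trans (cst r %/ 2 ^ i)); first by rewrite -bit_lt_half -divn2 leq_div.
  by rewrite -(loop_rest HI v) ltn_ord.
- by [].
- move=> b; rewrite cfS //= Hph (loop_lead HI) eqxx ffunE /next_cmp (loop_cmp HI) /cmp_spec.
  by rewrite !(loop_zbit HI) ?ltn_ord // -cryS modnS_eq modnS_leq.
- by move=> v b Hv; rewrite cfS //= Hph (loop_lead HI) (negPf Hv) (loop_cmp0 HI).
Qed.

Definition quiet (t : nat) : bool := [forall v, ~~ busy (cf t v)].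

Lemma active t i : (t < N)%N -> loop_inv t (PActive K0) i 0 ->
  loop_inv t.+1 (if quiet t then PResult K0 else PInput ord0) i 0.
Proof.
move=> HtN HI; have Hph := loop_ph HI.
have E v : (rcv t v != set0) = ~~ quiet t.
  rewrite sound_global; last by move=> u; rewrite /wiring Hph.
  rewrite negb_forall; apply: eq_existsb => u.
  by rewrite /beeping Hph all_if_neq0 negbK.
split.
- by move=> v; rewrite cfS //= /next_phase Hph E; case: quiet.
- by move=> v; rewrite cfS //= Hph (loop_lead HI).
- by have [O1 O2] := loop_out HI; split=> [b j Hj|w Hw]; rewrite cfS //= Hph; [exact: O1|exact: O2].
- by move=> b j r Hj; rewrite cfS //= Hph (loop_carry HI).
- by move=> w r; rewrite cfS //= Hph; apply: (loop_carry0 HI).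
- by move=> v r; rewrite cfS //= Hph (loop_rest HI).
- by [].
- by move=> b; rewrite cfS //= Hph (loop_cmp HI).
- by move=> v b Hv; rewrite cfS //= Hph (loop_cmp0 HI).
Qed.

Definition fits (i : nat) : Prop := (forall r, (r < K)%N -> (cst r < 2 ^ i)%N) /\
  (forall b r, (r < K)%N -> (psum (len b) r (len b) < 2 ^ i)%N) /\
  (forall b, (zval (len b) iM + zval (len (~~ b)) iD < 2 ^ i)%N).

(** Bounds the number of passes: once all sums fit into [i] bits, no carry is left. *)
Lemma fits_quiet t i : loop_inv t (PActive K0) i 0 -> fits i -> quiet t.
Proof.
move=> HI [H1 [H2 H3]]; apply/forallP => v; rewrite /busy !negb_or; apply/and3P; split.
- apply/existsPn => r; apply/negP => Hc.
  case Eo : (out (cf t v)) => [m|]; last by rewrite (loop_carry0 HI) in Hc.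
  have [O1 O2] := loop_out HI.
  have [b [j [Hj Ev]]] : exists b j, (0 < j <= len b)%N /\ v = ar b j.
    apply: contrapT => Hn; have : out (cf t v) = None.
      by apply: O2 => b j Hj Ev; apply: Hn; exists b, j.
    by rewrite Eo.
  move: Hc; rewrite Ev (loop_carry HI) // ltn0 cry_big //.
  rewrite -psumS; apply: leq_ltn_trans (H2 b r (ltn_ord r)).
  by rewrite /psum leq_add2l leq_mul2r; apply/orP; right; lia.
- by apply/existsPn => r; rewrite negbK (loop_rest HI) divn_small // H1.
- apply/existsPn => b; case: (v =P L) => [->|/eqP Hv]; last by rewrite (loop_cmp0 HI).
  by rewrite (loop_cmp HI) /= cry_big.
Qed.

Definition answer (b : bool) : bool :=
  (zval (len b) iM + zval (len (~~ b)) iD == zval (len b) iP)%N &&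
  (zval (len b) iI <= zval (len (~~ b)) iI)%N.

(** Silence on the activity test certifies that all values and the sum lie below [2 ^ i], so the
    tests made modulo [2 ^ i] are exact. *)
Lemma quiet_answer t i : loop_inv t (PActive K0) i 0 -> quiet t ->
  forall b, (cmp_spec i b).1.2 && (cmp_spec i b).2 = answer b.
Proof.
move=> HI /forallP Hq b.
have Hz b' (r : 'I_K) : (zval (len b') r < 2 ^ i)%N.
  apply: (@quiet_small keep cst (len b') i K) => // [r' Hr'|r' j Hr' Hj].
    have := Hq L; rewrite /busy !negb_or => /and3P[_ /existsPn/(_ (Ordinal Hr'))].
    rewrite negbK (loop_rest HI) /= => /eqP H _.
    by rewrite (divn_eq (cst r') (2 ^ i)) H mul0n add0n ltn_pmod // expn_gt0.
  have := Hq (ar b' (len b' - j)); rewrite /busy !negb_or => /and3P[/existsPn/(_ (Ordinal Hr')) + _ _].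
  rewrite (loop_carry HI) /=; last lia.
  by have -> : (len b' - (len b' - j) = j)%N; [lia | move/negbTE].
have Hc : cry (zval (len b) iM) (zval (len (~~ b)) iD) i = false.
  have := Hq L; rewrite /busy !negb_or => /and3P[_ _ /existsPn/(_ b)].
  by rewrite (loop_cmp HI) => /negbTE.
have Hs := cry_small (Hz _ iM) (Hz _ iD) Hc.
by rewrite /cmp_spec /answer /= !modn_small.
Qed.

Lemma result t i : (t.+1 < N)%N -> loop_inv t (PActive K0) i 0 -> quiet t ->
  at_phase t.+2 (PWait K0 [exists b, answer b]).
Proof.
move=> HtN HI Hq; have HI1 := active (ltnW HtN) HI; rewrite Hq in HI1.
have Hph := loop_ph HI1.
have Ea : accepts (cf t.+1 L) = [exists b, answer b].
  by apply: eq_existsb => b; rewrite (loop_cmp HI1) (quiet_answer HI Hq).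
have E v : (rcv t.+1 v != set0) = ~~ [exists b, answer b].
  rewrite sound_global; last by move=> u; rewrite /wiring Hph.
  rewrite -Ea; apply/existsP/idP => [[u]|Hn].
    by rewrite /beeping Hph all_if_neq0 (loop_lead HI1) => /andP[/eqP ->].
  by exists L; rewrite /beeping Hph all_if_neq0 (loop_lead HI1) eqxx.
by move=> v; rewrite cfS //= /next_phase Hph E negbK.
Qed.

(** A pass costs two rounds per stage, one update and one activity test. *)
Lemma loop_run M t i : (1 < t)%N -> (t + (M - i) * (2 * K + 2) < N)%N -> (i < M)%N -> fits M ->
  loop_inv t (PInput ord0) i 0 ->
  exists2 t', (t <= t' <= t + (M - i) * (2 * K + 2) + 1)%N & at_phase t' (PWait K0 [exists b, answer b]).
Proof.
move Ed : (M - i)%N => d; elim: d i t Ed => [|d IH] i t Ed Ht HtN HiM Hfit HI; first lia.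
have H1 : (t + 2 * K <= N)%N by lia.
have HU := stages Ht H1 HI.
have HA := update (_ : (t + 2 * K < N)%N) HU; have {}HA := HA ltac:(lia).
case Hq : (quiet (t + 2 * K).+1).
  exists (t + 2 * K).+3; first by lia.
  by apply: result HA Hq; lia.
have HI' := active (_ : ((t + 2 * K).+1 < N)%N) HA; have {}HI' := HI' ltac:(lia); rewrite Hq in HI'.
have [E|Hi] : M = i.+1 \/ (i.+1 < M)%N by lia.
  by have := fits_quiet HA; rewrite -E Hq => /(_ Hfit).
have Hd : (M - i.+1)%N = d by lia.
have Ht2 : (1 < (t + 2 * K).+2)%N by [].
have HN2 : ((t + 2 * K).+2 + d * (2 * K + 2) < N)%N by lia.
have [t' Ht' Hp] := IH i.+1 (t + 2 * K).+2 Hd Ht2 HN2 Hi Hfit HI'.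
by exists t' => //; lia.
Qed.
End Arms.

Lemma done_stays t t' v b : (t <= t' <= N)%N -> ph (cf t v) = PDone K0 b -> ph (cf t' v) = PDone K0 b.
Proof.
elim: t' => [|t' IH]; first by rewrite leqn0 => /andP[/eqP <-].
case/andP; rewrite leq_eqVlt => /orP[/eqP <- //|Ht] Ht' Hd.
by rewrite cfS //= /next_phase IH //; apply/andP; split => //; exact: ltnW.
Qed.

Lemma alive_run t v : (t <= N)%N -> decision (cf t v) = None ->
  alive (cf t v) = all (fun i => coin i v) (iota 0 t).
Proof.
elim: t => [|t IH] Ht Hd; first by rewrite cf0.
have Hd' : decision (cf t v) = None.
  move: Hd; rewrite /decision; case E : (ph (cf t v)) => [||||||||||||||s|s|b|b] //.
  by rewrite (done_stays (t := t) _ E) // leqnSn.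
rewrite -addn1 iotaD all_cat /= andbT add0n -IH //; last exact: ltnW.
by rewrite addn1 cfS //=; move: Hd'; rewrite /decision; case: (ph _).
Qed.

Definition all_dead (t : nat) : bool := [forall v, has (fun i => ~~ coin i v) (iota 0 t)].

Lemma wait_run t' b m : at_phase t' (PWait K0 b) -> all_dead m -> (maxn t' m < N)%N ->
  exists T, [/\ (t' < T <= (maxn t' m).+1)%N, at_phase T (PDone K0 b),
    forall t v, (t < T)%N -> decision (cf t v) = None & all_dead T].
Proof.
move=> Hw Hm HN.
have mono i j : (i <= j)%N -> all_dead i -> all_dead j.
  move=> Hij /forallP H; apply/forallP => v; have /hasP[x Hx Hc] := H v.
  apply/hasP; exists x => //; move: Hx; rewrite !mem_iota !add0n /= => Hx.
  exact: leq_trans Hij.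
have Hex : exists t, (t' <= t)%N && all_dead t.
  by exists (maxn t' m); rewrite leq_maxl (mono m) // leq_maxr.
have [t /andP[Ht1 Ht2] Hmin] := ex_minnP Hex.
have HtN : (t <= maxn t' m)%N by apply: Hmin; rewrite leq_maxl (mono m) // leq_maxr.
have HtN' : (t < N)%N := leq_ltn_trans HtN HN.
have E u v : (u < N)%N -> at_phase u (PWait K0 b) -> (rcv u v != set0) = ~~ all_dead u.
  move=> Hu Hph; rewrite sound_global; last by move=> w; rewrite /wiring Hph.
  rewrite negb_forall; apply: eq_existsb => w.
  rewrite /beeping Hph all_if_neq0 alive_run; [|exact: ltnW|by rewrite /decision Hph].
  by rewrite -all_predC; apply: eq_all => i; rewrite /= negbK.
have Hwait u : (t' <= u <= t)%N -> at_phase u (PWait K0 b).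
  elim: u => [|u IH]; first by rewrite leqn0 => /andP[/eqP <-].
  case/andP; rewrite leq_eqVlt => /orP[/eqP <- //|Hu1] Hu2.
  have Hu : at_phase u (PWait K0 b) by apply: IH; rewrite -ltnS Hu1 ltnW.
  have HuN : (u < N)%N := ltn_trans Hu2 HtN'.
  move=> v; rewrite cfS //= /next_phase Hu E //.
  case: ifP => // /negbFE Hd.
  by have := Hmin u; rewrite Hd andbT -ltnS Hu1 => /(_ isT); rewrite leqNgt Hu2.
have Hend : at_phase t.+1 (PDone K0 b).
  have Hph := Hwait t; rewrite Ht1 leqnn in Hph; have {}Hph := Hph isT.
  by move=> v; rewrite cfS //= /next_phase Hph E // Ht2.
exists t.+1; split => //; [by rewrite !ltnS Ht1|idtac|exact: mono Ht2].
move=> u v Hu; rewrite /decision; case Ep : (ph (cf u v)) => [||||||||||||||s|s|b'|b'] //.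
have : ph (cf t v) = PDone K0 b' by apply: done_stays Ep; rewrite -ltnS Hu ltnW.
by rewrite Hwait // Ht1 leqnn.
Qed.

Hypothesis Hcst : forall s, (s < K)%N -> (cst s <= cmax)%N.

Definition ans (x y : nat) : bool :=
  (zval x iM + zval y iD == zval x iP)%N && (zval x iI <= zval y iI)%N.

(** The leader exists by round [5 + 2 * J]; four rounds of set-up, [M] passes and the result give
    the bound. The values are required below [2 ^ M.-1] because the sum of two of them has to fit
    into [M] bits. *)
Lemma region_run v0 c0 s0 (A B : nat) (w1 w2 : S) J M :
  is_region S v0 c0 s0 A B -> (0 < A)%N -> (0 < B)%N ->
  val w1 = v0 -> val w2 = pt v0 c0 s0 (A%:Z, B%:Z) ->
  (exists2 j, (j < J)%N & coin (4 + 2 * j) w1 != coin (4 + 2 * j) w2) -> (0 < M)%N ->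
  (forall r, (r < K)%N -> (cst r < 2 ^ M)%N) ->
  (forall x r, (x <= A)%N || (x <= B)%N -> (r < K)%N -> (zval x r < 2 ^ M.-1)%N) ->
  (10 + 2 * J + M * (2 * K + 2) < N)%N ->
  exists2 t, (4 < t <= 10 + 2 * J + M * (2 * K + 2))%N & at_phase t (PWait K0 (ans A B || ans B A)).
Proof.
move=> HR A0 B0 E1 E2 Hc M0 Hcst2 Hz HN.
have H5 : at_phase 5 (PHeads K0).
  have := after_check; case: asboolP; first by move=> _; apply; lia.
  by case; exists v0, c0, s0, A, B.
have HJ : (5 + 2 * J <= N)%N by lia.
have [j Hj [Hnet [L HL Hlead]]] := election HR A0 B0 E1 E2 H5 HJ Hc.
have HL' : val L = v0 \/ val L = pt v0 c0 s0 (A%:Z, B%:Z).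
  by case: HL => ->; [left|right].
have [len [Hab Hturn Hreg]] := leader_frame compass cw HR A0 B0 HL'.
have Hlen b : (0 < len b)%N by case: Hab => -[El1 El2]; case: b; rewrite ?El1 ?El2.
have [ar Har] : exists ar : bool -> nat -> S, forall b i, (i <= len b)%N ->
    val (ar b i) = walk (val L) (arm_dir compass cw L b) i.
  have H b := side_nodes (arm_is_side Hlen Hreg b).
  have [u1 H1] := H false; have [u2 H2] := H true.
  by exists (fun b => if b then u2 else u1); case.
have Ht0 : (1 < 7 + 2 * j)%N by lia.
have HtN : ((7 + 2 * j).+4 <= N)%N by lia.
have HI : loop_inv L len ar (7 + 2 * j).+4 (PInput ord0) 0 0.
  have Har0 := setup_arith Ht0 HtN Hnet.
  split.
  - exact: (setup_phase Ht0 HtN Hnet).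
  - exact: (setup_lead Ht0 HtN Hnet Hlead).
  - exact: (setup_out Hlen Hturn Hreg Har Ht0 HtN Hnet Hlead).
  - by move=> b i r _; have [-> _ _ _] := Har0 (ar b i); rewrite ffunE ltn0 cry0.
  - by move=> w r _; have [-> _ _ _] := Har0 w; rewrite ffunE.
  - by move=> v r; have [_ -> _ _] := Har0 v; rewrite ffunE inordK ?expn0 ?divn1 // ltnS Hcst.
  - by [].
  - by move=> b; have [_ _ _ ->] := Har0 L; rewrite ffunE /cmp_spec cry0 !modn1.
  - by move=> v b _; have [_ _ _ ->] := Har0 v; rewrite ffunE.
have Hlab b : (len b <= A)%N || (len b <= B)%N.
  by case: Hab => -[El1 El2]; case: b; rewrite ?El1 ?El2 leqnn ?orbT.
have E2M : (2 ^ M = 2 ^ M.-1 + 2 ^ M.-1)%N by rewrite -{1}(prednK M0) expnS mul2n addnn.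
have Hfit : fits len M.
  split => //; split => [b r Hr|b].
    by rewrite psum_max E2M; apply: leq_trans (Hz _ _ (Hlab b) Hr) _; exact: leq_addr.
  by rewrite E2M -addSn; apply: leq_add; [|apply: ltnW]; apply: Hz.
have Ht4 : (1 < (7 + 2 * j).+4)%N by [].
have HN4 : ((7 + 2 * j).+4 + (M - 0) * (2 * K + 2) < N)%N by lia.
have [t Ht Hp] := loop_run Hlen Hturn Hreg Har Ht4 HN4 M0 Hfit HI.
exists t; first by lia.
have -> : ans A B || ans B A = [exists b, answer len b].
  rewrite /answer; apply/orP/existsP => [|[b]].
    by case: Hab => -[El1 El2] [] H; [exists false|exists true|exists true|exists false]; rewrite /= El1 El2.
  by case: Hab => -[El1 El2]; case: b; rewrite /= El1 El2; [right|left|left|right].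
exact: Hp.
Qed.
End Evolution.

(** * The ratio as an equation in natural numbers *)

Section Equation.
Implicit Types (s : seq nat) (h l : nat).

Definition evaln s h : nat := foldr (fun a z => a + h * z)%N 0%N s.

Lemma split_int_seq (s : seq int) h :
  (evaln [seq if 0 <= c then `|c|%N else 0%N | c <- s] h)%:Z -
  (evaln [seq if 0 <= c then 0%N else `|c|%N | c <- s] h)%:Z = horner_rec s h%:Z.
Proof.
elim: s => [|c s IH] //=; rewrite -IH !PoszD !PoszM.
by case: (lerP 0 c) => Hc; rewrite ?(ger0_norm Hc) ?(ltr0_norm Hc) ?abszE /=; lia.
Qed.

Lemma horner_rec_bound (s : seq int) h : (0 < h)%N ->
  `|horner_rec s h%:Z| <= (\sum_(c <- s) `|c|) * h%:Z ^+ size s.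
Proof.
move=> Hh; elim: s => [|c s IH] /=; first by rewrite normr0 big_nil mul0r.
have H1 : 1 <= h%:Z ^+ (size s).+1 by rewrite exprn_ege1 //; lia.
rewrite big_cons mulrDl; apply: le_trans (ler_normD _ _) _.
rewrite addrC lerD //; first by rewrite ler_peMr.
by rewrite normrM (@ger0_norm _ h%:Z) // exprSr mulrA ler_wpM2r.
Qed.

Lemma interpolate s (f : nat -> rat) : uniq s ->
  exists2 q : {poly rat}, (size q <= size s)%N & forall h, h \in s -> q.[h%:R] = f h.
Proof.
elim: s => [|a s IH] /=; first by exists 0; rewrite ?size_poly0.
case/andP => Ha /IH[q Hq Hs].
pose n : {poly rat} := \prod_(h <- s) ('X - h%:R%:P).
have Hn h : n.[h%:R] = \prod_(j <- s) (h%:R - j%:R).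
  by rewrite horner_prod; apply: eq_bigr => j _; rewrite hornerXsubC.
have Hn0 : n.[a%:R] != 0.
  rewrite Hn prodf_seq_neq0; apply/allP => j Hj; rewrite subr_eq0 eqr_nat.
  by apply: contraNneq Ha => ->.
exists (q + ((f a - q.[a%:R]) / n.[a%:R]) *: n).
  apply: leq_trans (size_polyD _ _) _; rewrite geq_max (leq_trans Hq) //=.
  by apply: leq_trans (size_scale_leq _ _) _; rewrite size_prod_XsubC.
move=> h; rewrite inE hornerD hornerZ => /orP[/eqP ->|Hh].
  by rewrite divfK // addrC subrK.
rewrite Hs // [X in _ + _ * X](_ : _ = 0) ?mulr0 ?addr0 // Hn.
by apply/eqP; rewrite prodf_seq_eq0; apply/hasP; exists h; rewrite ?subrr.
Qed.

(** Supplies the dichotomy for [rational_equation]: enough points to determine a polynomial, or a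
    complete list of them. *)
Lemma bounded_enum (P : nat -> Prop) n : exists s, [/\ uniq s, forall h, h \in s -> P h,
  (size s <= n)%N & size s = n \/ forall h, P h -> h \in s].
Proof.
elim: n => [|n [s [H1 H2 H3 H4]]]; first by exists [::]; split => //; left.
case: (pselect (forall h, P h -> h \in s)) => [Hs|Hs].
  by exists s; split => //; [exact: leqW | right].
have [Hn|//] := H4.
have [h Hh] : exists h, P h /\ h \notin s.
  apply: contrapT => Hno; apply: Hs => g Hg; apply/negPn/negP => Hgs.
  by apply: Hno; exists g.
exists (h :: s); split => /=.
- by rewrite H1 andbT; case: Hh.
- by move=> g; rewrite inE => /orP[/eqP ->|/H2 //]; case: Hh.
- by rewrite Hn.
- by left; rewrite Hn.
Qed.

Variable R : realType.

(* Either [p] takes natural values at more than its degree many points, hence is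
   rational, or [w] singles out the finitely many points where it does and [q]
   interpolates its values there. *)
Lemma rational_equation (p : {poly R}) : exists (q : {poly rat}) (w : {poly int}),
  (forall h, 0 <= w.[h%:Z]) /\
  forall h l, (0 < h)%N -> l%:R = p.[h%:R] <-> w.[h%:Z] = 0 /\ l%:R = q.[h%:R].
Proof.
pose P h := (0 < h)%N /\ exists l, l%:R = p.[h%:R].
have [s [Hu HP Hs Hall]] := bounded_enum P (size p).
have [f Hf] : exists f : nat -> nat, forall h, P h -> (f h)%:R = p.[h%:R].
  exists (fun h => Num.truncn p.[h%:R]) => g [_ [l <-]].
  by rewrite natrK.
have [q Hq Hqs] := interpolate (fun h => (f h)%:R) Hu.
have Hqr h : (ratr q.[h%:R] : R) = (map_poly ratr q).[h%:R].
  by rewrite -(horner_map (@ratr R)) /= ratr_nat.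
have Hqp h : h \in s -> (ratr q.[h%:R] : R) = p.[h%:R].
  by move=> Hh; rewrite Hqs // ratr_nat; apply: Hf; apply: HP.
case: Hall => [Hn|Hall].
  exists q, 0; split => [h|h l Hh]; first by rewrite horner0.
  have Ep : p = map_poly ratr q.
    (* The difference has size at most [size p] and vanishes at [size p] distinct points, which is
       one root too many. *)
    apply/eqP; rewrite -subr_eq0; apply: contraT => Hp0.
    have /(max_poly_roots Hp0) : all (root (p - map_poly ratr q)) [seq h%:R | h <- s].
      by apply/allP => _ /mapP[g Hg ->]; rewrite /root hornerD hornerN -Hqr Hqp // subrr.
    rewrite map_inj_uniq // => [/(_ Hu)|x y /eqP]; last by rewrite eqr_nat => /eqP.
    rewrite size_map Hn ltnNge => /negP[].
    apply: leq_trans (size_polyD _ _) _; rewrite size_polyN geq_max leqnn /=.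
    by apply: leq_trans (size_poly _ _) _; rewrite -Hn.
  rewrite horner0 Ep -Hqr; split=> [H|[_ <-]]; last by rewrite ratr_nat.
  by split => //; apply: (fmorph_inj (@ratr R)); rewrite /= ratr_nat.
(* The squares keep [w] nonnegative, so it is at least 1 wherever it does not vanish;
   [natural_equation] relies on this. *)
exists q, (\prod_(h <- s) ('X - (h%:Z)%:P) ^+ 2).
have Hw h : (\prod_(j <- s) ('X - (j%:Z)%:P) ^+ 2).[h%:Z] = \prod_(j <- s) (h%:Z - j%:Z) ^+ 2.
  by rewrite horner_prod; apply: eq_bigr => j _; rewrite horner_exp hornerXsubC.
split=> [h|h l Hh]; first by rewrite Hw; apply: prodr_ge0 => j _; exact: sqr_ge0.
rewrite Hw; have -> : (\prod_(j <- s) (h%:Z - j%:Z) ^+ 2 = 0) <-> h \in s.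
  split=> [/eqP|Hin].
    by rewrite prodf_seq_eq0 => /hasP[j Hj]; rewrite /= sqrf_eq0 subr_eq0 eqz_nat => /eqP ->.
  by apply/eqP; rewrite prodf_seq_eq0; apply/hasP; exists h; rewrite // subrr expr0n.
split=> [H|[Hin H]].
  have Hin : h \in s by apply: Hall; split => //; exists l.
  by split => //; apply: (fmorph_inj (@ratr R)); rewrite /= ratr_nat Hqp.
by rewrite -Hqp // -H ratr_nat.
Qed.

(** Denominators are cleared, the condition that [w] vanishes is merged into the equation, and
    negative coefficients move to the other side. *)
Lemma natural_equation (p : {poly R}) : exists (D : nat) (P M : seq nat),
  forall h l, (0 < h)%N -> l%:R = p.[h%:R] <-> (D * l + evaln M h = evaln P h)%N.
Proof.
have [q [w [Hw0 Hw]]] := rational_equation p.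
have [z [a Ha Eq]] := rat_poly_scale q.
(* Multiplication by the sign of [a] makes the factor of [l] positive. *)
pose D := `|a|%N; pose z' := Num.sg a *: z.
have D0 : (0 < D)%N by rewrite absz_gt0.
have Hz h l : l%:R = q.[h%:R] <-> D%:Z * l%:Z = z'.[h%:Z].
  rewrite Eq hornerZ.
  have -> : (map_poly intr z).[h%:R] = (z.[h%:Z])%:~R :> rat.
    by rewrite -[h%:R]/((h%:Z)%:~R) horner_map.
  have Ha' : a%:~R != 0 :> rat by rewrite intr_eq0.
  have ED : D%:Z = Num.sg a * a by rewrite /D abszE normrEsg .
  have Hs : Num.sg a != 0 by rewrite sgr_eq0.
  have E1 : (l%:R = a%:~R^-1 * (z.[h%:Z])%:~R :> rat) <-> a * l%:Z = z.[h%:Z].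
    split=> [E|<-]; last by rewrite intrM mulKf.
    by apply: (@intr_inj rat); rewrite intrM -[(l%:Z)%:~R]/(l%:R) E mulVKf.
  rewrite E1 /z' hornerZ ED -mulrA; split=> [-> //|]; exact: mulfI.
(* Where [w] does not vanish, the correction term exceeds the value of [z'],
   so that the combined equation has no solution. *)
pose C := \sum_(c <- polyseq z') `|c|.
pose Q := z' - (C + 1) *: ('X^(size z') * w).
pose sP := [seq if 0 <= c then `|c|%N else 0%N | c <- polyseq Q].
pose sM := [seq if 0 <= c then 0%N else `|c|%N | c <- polyseq Q].
exists D, sP, sM => h l Hh.
have EQ : D%:Z * l%:Z = Q.[h%:Z] <-> (D * l + evaln sM h = evaln sP h)%N.
  have := split_int_seq (polyseq Q) h; rewrite -/sP -/sM -/(horner Q h%:Z) => <-; lia.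
rewrite -EQ Hw // Hz /Q hornerD hornerN [X in _ - X]hornerZ hornerM hornerXn.
split=> [[-> ->]|E]; first by rewrite !mulr0 subr0.
have Hb := horner_rec_bound (polyseq z') Hh; rewrite -/(horner z' h%:Z) -/C in Hb.
have C0 : 0 <= C by apply: sumr_ge0 => c _; exact: normr_ge0.
suff Ew : w.[h%:Z] = 0 by split => //; rewrite E Ew !mulr0 subr0.
apply/eqP; apply: contraT => Hne.
have Hw1 : 1 <= w.[h%:Z] by have := Hw0 h; move: Hne; lia.
have Hh1 : 1 <= h%:Z ^+ size z' by rewrite exprn_ege1 //; lia.
have : 0 <= D%:Z * l%:Z by rewrite mulr_ge0.
rewrite E subr_ge0 leNgt => /negP[].
apply: le_lt_trans (ler_norm _) _; apply: le_lt_trans Hb _.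
rewrite mulrDl mul1r; apply: ltr_pwDr.
  by rewrite mulr_gt0 // (lt_le_trans _ Hh1) // (lt_le_trans _ Hw1).
by rewrite ler_wpM2l // ler_peMr // ltW // (lt_le_trans _ Hh1).
Qed.
End Equation.

(** * The stages as a program *)

Section Program.
(** The leading [false] cuts the link to the preceding stage, so several polynomials can be
    evaluated by one sequence of stages. *)
Definition horner_block (a : nat) (s : seq nat) : seq (bool * nat) := (false, a) :: map (pair true) s.

Lemma zval_horner_block s0 a s s1 m :
  let q := s0 ++ horner_block a s ++ s1 in
  zval (fun r => (nth (false, 0%N) q r).1) (fun r => (nth (false, 0%N) q r).2) m (size s0 + size s) =
  foldl (fun z c => c + m * z)%N a s.
Proof.
elim/last_ind: s s1 => [|s x IH] s1 /=.
  rewrite addn0; case: s0 => [|y s0] //=.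
  by rewrite nth_cat ltnn subnn /= muln0 addn0.
rewrite foldl_rcons -(IH ((true, x) :: s1)) size_rcons addnS /=.
have -> : s0 ++ (false, a) :: map (pair true) (rcons s x) ++ s1 =
  s0 ++ (false, a) :: map (pair true) s ++ (true, x) :: s1.
  by rewrite map_rcons cat_rcons.
have En : nth (false, 0%N) (s0 ++ (false, a) :: map (pair true) s ++ (true, x) :: s1)
    (size s0 + size s).+1 = (true, x).
  rewrite nth_cat ltnNge -addnS leq_addr /= addKn /= nth_cat size_map ltnn subnn /=.
  by [].
by rewrite En.
Qed.

Lemma program_exists D P M : exists (K0 : nat) (keep : nat -> bool) (cst : nat -> nat)
    (c : nat) (iP iM iD iI : 'I_K0.+1),
  (forall r, cst r <= c)%N /\ forall m,
  [/\ zval keep cst m iP = evaln P m, zval keep cst m iM = evaln M m,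
      zval keep cst m iD = (D * m)%N & zval keep cst m iI = m].
Proof.
(* Horner's rule starts with the leading coefficient, hence the reversals. The last two blocks yield
   [D * m] and [m] itself, the latter for the comparison of height and length. *)
pose bP := horner_block 0 (rev P); pose bM := horner_block 0 (rev M).
pose bD := horner_block D [:: 0%N]; pose bI := horner_block 1 [:: 0%N].
pose q := bP ++ bM ++ bD ++ bI.
have Eq : size q = ((size P).+1 + ((size M).+1 + 3)).+1.
  by rewrite /q !size_cat /= !size_map !size_rev; lia.
have HP : (size P < size q)%N by rewrite Eq; lia.
have HM : ((size P).+1 + size M < size q)%N by rewrite Eq; lia.
have HD : ((size P).+1 + (size M).+1 + 1 < size q)%N by rewrite Eq; lia.
have HI : ((size P).+1 + (size M).+1 + 2 + 1 < size q)%N by rewrite Eq; lia.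
rewrite Eq in HP HM HD HI.
exists ((size P).+1 + ((size M).+1 + 3))%N, (fun r => (nth (false, 0%N) q r).1),
  (fun r => (nth (false, 0%N) q r).2), (\max_(x <- q) x.2)%N,
  (Ordinal HP), (Ordinal HM), (Ordinal HD), (Ordinal HI); split=> [r|m].
  case: (ltnP r (size q)) => Hr; last by rewrite nth_default.
  by apply: (@leq_bigmax_seq _ q xpredT (fun x : bool * nat => x.2)) => //; exact: mem_nth.
have Er s : (foldl (fun z c => c + m * z) 0 (rev s) = evaln s m)%N by rewrite foldl_rev.
have Esz s : (size (horner_block 0 (rev s)) = (size s).+1)%N by rewrite /= size_map size_rev.
split.
- by rewrite -Er -(@zval_horner_block [::] 0 (rev P) (bM ++ bD ++ bI)) size_rev.
- by rewrite -Er -(@zval_horner_block bP 0 (rev M) (bD ++ bI)) size_rev Esz.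
- have := @zval_horner_block (bP ++ bM) D [:: 0%N] bI m.
  by rewrite [foldl _ _ _]/= add0n mulnC size_cat !Esz -catA => <-.
have := @zval_horner_block (bP ++ bM ++ bD) 1 [:: 0%N] [::] m.
by rewrite [foldl _ _ _]/= add0n muln1 !size_cat !Esz -!catA cats0 addnA => E; rewrite -[RHS]E.
Qed.
End Program.

(** * Probability *)

Section Coins.
Variables (R : realType) (T : finType).
Notation X := {ffun T -> bool}.
Implicit Types (N : nat) (v : T).

Definition mu : R := \prod_(v : T) 2^-1.

Definition prob N (E : N.-tuple X -> Prop) : R :=
  \sum_(w : N.-tuple X | `[< E w >]) \prod_(x <- w) mu.

Lemma mu_ge0 : 0 <= mu.
Proof. by apply: prodr_ge0 => v _; rewrite invr_ge0 ler0n. Qed.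

Lemma half_sum : \sum_(b : bool) (2^-1 : R) = 1.
Proof. by rewrite big_bool /=; lra. Qed.

Lemma mu_sum : \sum_(x : X) mu = 1.
Proof.
by rewrite -(bigA_distr_bigA (fun (v : T) (b : bool) => 2^-1 : R)) /= big1 // => v _; exact: half_sum.
Qed.

Lemma prob_le N (E F : N.-tuple X -> Prop) : (forall w, E w -> F w) -> prob E <= prob F.
Proof.
move=> H; rewrite /prob [leRHS]big_mkcond [leLHS]big_mkcond; apply: ler_sum => w _.
have Hw : 0 <= \prod_(x <- w) mu by apply: prodr_ge0 => x _; exact: mu_ge0.
by case: asboolP => [/H /asboolP -> //|_]; case: ifP.
Qed.

Lemma prob_or N (E F : N.-tuple X -> Prop) : prob (fun w => E w \/ F w) <= prob E + prob F.
Proof.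
rewrite /prob big_mkcond [X in _ <= X + _]big_mkcond [X in _ <= _ + X]big_mkcond -big_split /=.
apply: ler_sum => w _.
have Hw : 0 <= \prod_(x <- w) mu by apply: prodr_ge0 => x _; exact: mu_ge0.
rewrite asbool_or; case: `[< E w >]; case: `[< F w >]; rewrite //= ?addr0 ?add0r //.
by rewrite ler_wpDr.
Qed.

Lemma prob_exists N (E : T -> N.-tuple X -> Prop) (d : R) :
  (forall v, prob (E v) <= d) -> prob (fun w => exists v, E v w) <= #|T|%:R * d.
Proof.
move=> H; apply: (@le_trans _ _ (\sum_v prob (E v))); last first.
  by rewrite mulr_natl -sumr_const; apply: ler_sum => v _.
rewrite /prob (exchange_big_dep xpredT) //= big_mkcond; apply: ler_sum => w _.
have Hw : 0 <= \prod_(x <- w) mu by apply: prodr_ge0 => x _; exact: mu_ge0.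
case: asboolP => [[v Hv]|_]; last by apply: sumr_ge0 => u _; exact: Hw.
rewrite (bigD1 v) /=; last exact/asboolP.
by rewrite ler_wpDr //; apply: sumr_ge0 => u _; exact: Hw.
Qed.

Lemma sum_rows N (F : 'I_N -> X -> R) :
  \sum_(w : N.-tuple X) \prod_i F i (tnth w i) = \prod_i \sum_x F i x.
Proof.
rewrite bigA_distr_bigA (reindex (@finfun_of_tuple X N)) /=; last first.
  by exists (@tuple_of_finfun X N) => ? _; rewrite ?finfun_of_tupleK ?tuple_of_finfunK.
by apply: eq_bigr => w _; apply: eq_bigr => i _; rewrite ffunE.
Qed.

(** Independence over the amoebots, obtained by transposing the table of coins; [sum_rows] is
    independence over the rounds. *)
Lemma sum_columns N (F : T -> {ffun 'I_N -> bool} -> R) :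
  \sum_(w : N.-tuple X) \prod_v F v [ffun i => tnth w i v] = \prod_v \sum_c F v c.
Proof.
pose f (w : N.-tuple X) : {ffun T -> {ffun 'I_N -> bool}} := [ffun v => [ffun i => tnth w i v]].
pose g (c : {ffun T -> {ffun 'I_N -> bool}}) : N.-tuple X := [tuple [ffun v => c v i] | i < N].
rewrite bigA_distr_bigA (reindex f) /=.
  by apply: eq_bigr => w _; apply: eq_bigr => v _; rewrite ffunE.
exists g => [w|c] _.
  by apply: eq_from_tnth => i; rewrite tnth_mktuple; apply/ffunP => v; rewrite !ffunE.
by apply/ffunP => v; apply/ffunP => i; rewrite !ffunE tnth_mktuple ffunE.
Qed.

Lemma probE N (E : N.-tuple X -> Prop) :
  prob E = \sum_(w : N.-tuple X) (`[< E w >])%:R * mu ^+ N.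
Proof.
rewrite /prob big_mkcond; apply: eq_bigr => w _; rewrite big_tuple prodr_const card_ord -/mu.
by case: ifP => _; rewrite ?mul1r ?mul0r.
Qed.

Lemma prob_compl N (E : N.-tuple X -> Prop) : prob E = 1 - prob (fun w => ~ E w).
Proof.
have E1 : \sum_(w : N.-tuple X) mu ^+ N = 1.
  rewrite (eq_bigr (fun w : N.-tuple X => \prod_(i < N) mu)) => [|w _]; last by rewrite prodr_const card_ord.
  by rewrite (sum_rows (fun _ _ => mu)) mu_sum big1.
apply/eqP; rewrite eq_sym subr_eq -E1 !probE -big_split /=; apply/eqP.
by apply: eq_bigr => w _; rewrite asbool_neg; case: `[< E w >]; rewrite ?mul1r ?mul0r ?addr0 ?add0r.
Qed.

(** A test that changes whenever the coin of [v] is turned over has probability one half. It covers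
    both a single coin showing heads and the equality of two coins. *)
Lemma prob_rows N (I : pred nat) (g : X -> bool) v :
  (forall x : X, g [ffun u => x u (+) (u == v)] = ~~ g x) ->
  prob (fun w : N.-tuple X => forall i : 'I_N, I i -> g (tnth w i)) = (2^-1 : R) ^+ count I (iota 0 N).
Proof.
move=> Hg; rewrite probE.
have Hhalf : \sum_(x : X) (g x)%:R * mu = 2^-1.
  have : \sum_(x : X) (g x)%:R * mu + \sum_(x : X) (g x)%:R * mu = 1.
    rewrite {2}(reindex_inj (h := fun x : X => [ffun u => x u (+) (u == v)])) /=; last first.
      move=> x y /ffunP H; apply/ffunP => u; move: (H u); rewrite !ffunE.
      by case: (u == v); rewrite ?addbT ?addbF // => /negb_inj.
    rewrite -big_split /= -[RHS]mu_sum; apply: eq_bigr => x _; rewrite Hg.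
    by case: (g x) => /=; rewrite ?mul1r ?mul0r ?addr0 ?add0r.
  lra.
have -> : \sum_(w : N.-tuple X) (`[< forall i : 'I_N, I i -> g (tnth w i) >])%:R * mu ^+ N =
    \sum_(w : N.-tuple X) \prod_(i < N) ((I i ==> g (tnth w i))%:R * mu).
  apply: eq_bigr => w _; rewrite big_split /= prodr_const card_ord; congr (_ * _).
  case: asboolP => [H|H]; first by rewrite big1 // => i _; rewrite (introT implyP) //; exact: H.
  have [i Hi] : exists i : 'I_N, ~~ (I i ==> g (tnth w i)).
    by apply: contrapT => Hno; apply: H => i; apply/implyP; apply/negPn/negP => ?; apply: Hno; exists i.
  by rewrite (bigD1 i) //= (negPf Hi) mul0r.
rewrite (sum_rows (fun i x => (I i ==> g x)%:R * mu)).
rewrite -(big_mkord xpredT (fun i => \sum_x (I i ==> g x)%:R * mu)) /index_iota subn0.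
elim: (iota 0 N) => [|i s IH] /=; first by rewrite big_nil.
rewrite big_cons IH exprD; case: (I i); rewrite ?mul1r ?Hhalf //=.
by rewrite -[RHS]mul1r expr0 mul1r (eq_bigr (fun=> mu)) ?mu_sum // => x _; rewrite mul1r.
Qed.

(** Columns are independent, and each has a tail among its first [m] entries unless these are all
    heads. *)
Lemma prob_all_tails N m : (m <= N)%N ->
  prob (fun w : N.-tuple X => forall v, exists2 i : 'I_N, (i < m)%N & ~~ tnth w i v) =
  (1 - (2^-1 : R) ^+ m) ^+ #|T|.
Proof.
move=> HN; rewrite probE.
pose D (c : {ffun 'I_N -> bool}) := [exists i : 'I_N, (i < m)%N && ~~ c i].
have -> : \sum_(w : N.-tuple X)
      (`[< forall v, exists2 i : 'I_N, (i < m)%N & ~~ tnth w i v >])%:R * mu ^+ N =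
    \sum_(w : N.-tuple X) \prod_(v : T) ((D [ffun i => tnth w i v])%:R * \prod_(i < N) 2^-1).
  apply: eq_bigr => w _; rewrite big_split /= exchange_big /= prodr_const card_ord; congr (_ * _).
  case: asboolP => [H|H].
    rewrite big1 // => v _; have [i Hi Hc] := H v; suff -> : D [ffun i => tnth w i v] by [].
    by apply/existsP; exists i; rewrite Hi ffunE.
  have [v Hv] : exists v, ~~ D [ffun i => tnth w i v].
    apply: contrapT => Hno; apply: H => v.
    have : D [ffun i => tnth w i v] by case: (boolP (D _)) => // HD; case: Hno; exists v.
    by case/existsP => i /andP[Hi]; rewrite ffunE; exists i.
  by rewrite (bigD1 v) //= (negPf Hv) mul0r.
rewrite (sum_columns (fun _ c => (D c)%:R * \prod_(i < N) 2^-1)) prodr_const; congr (_ ^+ _).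
have Hall : \sum_(c : {ffun 'I_N -> bool}) \prod_(i < N) (2^-1 : R) = 1.
  by rewrite -(bigA_distr_bigA (fun _ _ => 2^-1 : R)) big1 // => i _; exact: half_sum.
apply/eqP; rewrite eq_sym subr_eq -[X in X == _]Hall; apply/eqP.
have <- : \sum_(c : {ffun 'I_N -> bool}) (~~ D c)%:R * \prod_(i < N) (2^-1 : R) = 2^-1 ^+ m.
  have -> : \sum_(c : {ffun 'I_N -> bool}) (~~ D c)%:R * \prod_(i < N) (2^-1 : R) =
      \sum_(c : {ffun 'I_N -> bool}) \prod_(i < N) (((i < m)%N ==> c i)%:R * (2^-1 : R)).
    apply: eq_bigr => c _; rewrite big_split /=; congr (_ * _).
    case: (boolP (D c)) => [/existsP[i /andP[Hi Hc]]|]; first by rewrite (bigD1 i) //= Hi (negPf Hc) mul0r.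
    rewrite negb_exists => /forallP H; rewrite big1 // => i _.
    by have := H i; rewrite negb_and negbK -implybE => ->.
  rewrite -(bigA_distr_bigA (fun (i : 'I_N) b => ((i < m)%N ==> b)%:R * (2^-1 : R))) /=.
  rewrite -(big_mkord xpredT (fun i => \sum_(b : bool) ((i < m)%N ==> b)%:R * (2^-1 : R))).
  rewrite (big_cat_nat (n := m)) //= [X in _ * X]big1_seq ?mulr1.
    rewrite big_nat (eq_bigr (fun=> 2^-1)) => [|i /= ->]; last by rewrite big_bool /= mul1r mul0r addr0.
    by rewrite -big_nat prodr_const_nat subn0.
  by move=> i /andP[_]; rewrite mem_index_iota => /andP[Hi _]; rewrite ltnNge Hi big_bool /=; lra.
rewrite -big_split /=; apply: eq_bigr => c _.
by case: (D c); rewrite ?mul1r ?mul0r ?addr0 ?add0r.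
Qed.
End Coins.

(** * Real parallelograms and detection *)

Section Parallelograms.
Variables (R : realType) (S : {fset node}).

Lemma dir_free (c : 'Z_6) (s : bool) (a b : R) :
  a * (dir c).1%:~R + b * (dir (turn s c 1)).1%:~R = 0 ->
  a * (dir c).2%:~R + b * (dir (turn s c 1)).2%:~R = 0 -> a = 0 /\ b = 0.
Proof. by cases6 c; case: s; rewrite /dir /= ?mulrN1z; lra. Qed.

Lemma parallelogram_pt v c s l h (x y : int) :
  @parallelogram R v c (turn s c 1) l h ((pt v c s (x, y)).1%:~R, (pt v c s (x, y)).2%:~R) <->
  (0 <= x <= l%:Z) && (0 <= y <= h%:Z).
Proof.
have E1 : ((pt v c s (x, y)).1)%:~R =
    v.1%:~R + x%:~R * (dir c).1%:~R + y%:~R * (dir (turn s c 1)).1%:~R :> R.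
  by rewrite /pt /tilt !mulrz_pair /= !intrD !mulrzz !intrM addrA ![_ * x%:~R]mulrC ![_ * y%:~R]mulrC.
have E2 : ((pt v c s (x, y)).2)%:~R =
    v.2%:~R + x%:~R * (dir c).2%:~R + y%:~R * (dir (turn s c 1)).2%:~R :> R.
  by rewrite /pt /tilt !mulrz_pair /= !intrD !mulrzz !intrM addrA ![_ * x%:~R]mulrC ![_ * y%:~R]mulrC.
have Hint (z : int) (m : nat) : (0 <= (z%:~R : R) <= m%:R) = (0 <= z <= m%:Z).
  by rewrite -[m%:R]/((m%:Z)%:~R) ler0z ler_int.
rewrite -!Hint /parallelogram /=; split=> [[a [b [Ha Hb H1 H2]]]|/andP[Hx Hy]].
  have [Hax Hby] : a - x%:~R = 0 /\ b - y%:~R = 0.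
    by apply: (@dir_free c s); [move: H1; rewrite E1|move: H2; rewrite E2]; lra.
  by rewrite -(subr0_eq Hax) -(subr0_eq Hby) Ha Hb.
by exists x%:~R, y%:~R; split.
Qed.

Lemma forms_region v c s l h :
  forms S (@parallelogram R v c (turn s c 1) l h) <-> is_region S v c s l h.
Proof.
split=> [H x y|H u].
  by apply/idP/idP => [/H/parallelogram_pt|/parallelogram_pt/H].
by have [[x y] ->] := pt_surj v c s u; rewrite H parallelogram_pt.
Qed.

(* Seen from the other end of a side, axes at 120 degrees become axes at 60. *)
Lemma parallelogram_reverse v c e l h (z : R * R) :
  @parallelogram R v c e l h z -> @parallelogram R (v + dir c *+ l) (c + 3) e l h z.
Proof.
have E1 : (v + dir c *+ l).1%:~R = v.1%:~R + l%:R * (dir c).1%:~R :> R.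
  by rewrite pmulrn mulrz_pair /= intrD mulrzz intrM mulrC.
have E2 : (v + dir c *+ l).2%:~R = v.2%:~R + l%:R * (dir c).2%:~R :> R.
  by rewrite pmulrn mulrz_pair /= intrD mulrzz intrM mulrC.
case=> a [b [Ha Hb H1 H2]]; exists (l%:R - a), b; split => //; first lra.
  by rewrite E1 dir_add3 H1 /= intrN; lra.
by rewrite E2 dir_add3 H2 /= intrN; lra.
Qed.

Lemma forms_parallelogram_region h l :
  @forms_parallelogram R S h l -> exists v c s, is_region S v c s l h.
Proof.
case=> _ [v [d [e [Hd Hd3 HS]]]].
have HS' : forms S (@parallelogram R (v + dir d *+ l) (d + 3) e l h).
  move=> u; rewrite HS; split; first exact: parallelogram_reverse.
  move/parallelogram_reverse; rewrite dir_add3 mulNrn addrK -addrA.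
  by rewrite (_ : 3 + 3 = 0) ?addr0 //; apply/val_inj.
have [[s He]|[s He]] : (exists s, e = turn s d 1) \/ (exists s, e = turn s (d + 3) 1).
  rewrite (_ : e = d + (e - d)); last by rewrite addrC subrK.
  move: Hd Hd3; rewrite -!(subr_eq0 e) opprD addrA; move: (e - d) => m.
  rewrite /turn; cases6 m => // _ _; [left; exists false|right; exists true|right; exists false|left; exists true] => //;
    rewrite -?addrA; congr (_ + _); exact/val_inj.
- by exists v, d, s; rewrite He in HS; apply/forms_region.
by exists (v + dir d *+ l), (d + 3), s; rewrite He in HS'; apply/forms_region.
Qed.

Lemma region_forms_parallelogram v c s A B :
  (0 < B <= A)%N -> is_region S v c s A B -> @forms_parallelogram R S B A.
Proof.
move=> HAB HR; split => //; exists v, c, (turn s c 1); split; last exact/forms_region.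
  by clear HR; cases6 c; case: s.
by clear HR; cases6 c; case: s.
Qed.
End Parallelograms.

Lemma region_size S v c s A B : is_region S v c s A B -> (A < #|` S|)%N /\ (B < #|` S|)%N.
Proof.
wlog suff H : c s A B / is_region S v c s A B -> (A < #|` S|)%N.
  by move=> HR; split; [exact: H HR|exact: H (region_swap HR)].
move=> HR.
have Hin (i : 'I_A.+1) : pt v c s (i%:Z, 0) \in S.
  by rewrite HR; have := ltn_ord i; lia.
have Hinj : injective (fun i : 'I_A.+1 => FSetSub (Hin i)).
  by move=> i j /(congr1 val)/pt_inj[/ord_inj].
by have := leq_card _ Hinj; rewrite card_ord -cardfE.
Qed.

(** * Correctness of the verdict *)

Section Verdict.
Variables (R : realType) (p : {poly R}) (D : nat) (P M : seq nat).
Hypothesis p_eq : forall h l, (0 < h)%N ->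
  l%:R = p.[h%:R] <-> (D * l + evaln M h = evaln P h)%N.
Variables (k0 K0 : nat) (keep : nat -> bool) (cst : nat -> nat) (cmax : nat).
Variables (iP iM iD iI : 'I_K0.+1).
Notation state := (state K0 cmax).
Notation advance := (@advance k0 K0 cst cmax iP iM iD iI).
Hypothesis Hcst : forall r, (cst r <= cmax)%N.
Hypothesis Hzval : forall m,
  [/\ zval keep cst m iP = evaln P m, zval keep cst m iM = evaln M m,
      zval keep cst m iD = (D * m)%N & zval keep cst m iI = m].
Variables (S : {fset node}) (compass : node -> 'Z_6) (cw : node -> bool).
Hypothesis HS : connected_structure S.
Hypothesis S2 : (1 < #|` S|)%N.
Variables J m : nat.
Hypothesis m_gt0 : (0 < m)%N.
Hypothesis cmax_lt : (cmax < 2 ^ m)%N.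
Hypothesis zval_lt : (cmax * #|` S| ^ K0 < 2 ^ m.-1)%N.

Lemma ansE h l : (0 < h)%N ->
  ans keep cst iP iM iD iI h l <-> (h <= l)%N /\ l%:R = p.[h%:R].
Proof.
move=> Hh; rewrite p_eq // /ans; have [-> -> _ ->] := Hzval h.
have [_ _ -> ->] := Hzval l; rewrite addnC; split=> [/andP[/eqP ? ?] //|[-> /eqP ->] //].
Qed.

(** For a parallelogram [u1] and [u2] are its acute corners; otherwise any two amoebots will do, so
    that one event about the coins serves all structures. *)
Lemma verdict_run : exists u1 u2 : S, u1 != u2 /\
  forall N (cf : nat -> S -> state) (coin : nat -> S -> bool),
  (forall v, cf 0 v = start_state K0 cmax) ->
  (forall t v, (t < N)%N -> cf t.+1 v = advance (cf t v) (rcv k0 keep compass cw cf t v) (coin t v)) ->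
  (exists2 j, (j < J)%N & coin (4 + 2 * j) u1 != coin (4 + 2 * j) u2) ->
  (10 + 2 * J + m * (2 * K0.+1 + 2) < N)%N ->
  exists2 t, (4 < t <= 10 + 2 * J + m * (2 * K0.+1 + 2))%N &
    at_phase cf t (PWait K0 `[< has_side_ratio p S >]).
Proof.
case: (pselect (exists v c s A B, [/\ (0 < A)%N, (0 < B)%N & is_region S v c s A B])) => Hreg.
  have [v [c [s [A [B [A0 B0 HR Hans]]]]]] : exists v c s A B,
      [/\ (0 < A)%N, (0 < B)%N, is_region S v c s A B &
       ans keep cst iP iM iD iI A B || ans keep cst iP iM iD iI B A = `[< has_side_ratio p S >]].
    case: (asboolP (has_side_ratio p S)) => [[h [l [Hpar Hl]]]|Hno].
      have [/andP[Hh Hhl] _] := Hpar.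
      have [v [c [s HR]]] := forms_parallelogram_region Hpar.
      exists v, c, s, l, h; split => //; first exact: leq_trans Hhl.
      by apply/orP; right; apply/ansE.
    case: Hreg => v [c [s [A [B [A0 B0 HR]]]]]; exists v, c, s, A, B; split => //.
    apply/negP => /orP[] /ansE -/(_ _)[] // Hle Hp; apply: Hno.
      exists A, B; split => //; apply: region_forms_parallelogram (region_swap HR).
      by rewrite A0.
    by exists B, A; split => //; apply: region_forms_parallelogram HR; rewrite B0.
  have Hv1 : v \in S by rewrite -(pt00 v c s) HR.
  have Hv2 : pt v c s (A%:Z, B%:Z) \in S by rewrite HR; lia.
  exists [` Hv1]%fset, [` Hv2]%fset; split.
    apply/negP => /eqP/(congr1 val) /=; rewrite -{1}(pt00 v c s) => /pt_inj[] HA; lia.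
  move=> N cf coin cf0 cfS Hc HN; rewrite -Hans.
  have [HA HB] := region_size HR.
  apply: (region_run HS S2 cf0 cfS (fun r _ => Hcst r) HR A0 B0 _ _ Hc m_gt0) => // [r _|x r Hx Hr].
    exact: leq_ltn_trans (Hcst r) cmax_lt.
  apply: leq_ltn_trans (zval_bound keep x r Hcst) _; apply: leq_ltn_trans zval_lt.
  rewrite leq_mul2l; apply/orP; right; apply: (@leq_trans (#|` S| ^ r)).
    by case: r {Hr} => // r; rewrite leq_exp2r //; lia.
  by rewrite leq_exp2l.
have [u1 [u2 Hu]] : exists u1 u2 : S, u1 != u2.
  move: S2; rewrite cardfE => /card_gt1P[u1 [u2 [_ _ ?]]]; by exists u1, u2.
exists u1, u2; split => // N cf coin cf0 cfS _ HN; exists 5 => //.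
have := after_check HS S2 cf0 cfS; case: asboolP => // _.
case: asboolP => [[h [l [Hpar _]]]|_]; last by apply; lia.
case: Hreg; have [v [c [s HR]]] := forms_parallelogram_region Hpar.
have [/andP[Hh Hhl] _] := Hpar.
by exists v, c, s, l, h; split => //; exact: leq_trans Hhl.
Qed.
End Verdict.

Section Detection.
Variables (R : realType) (p : {poly R}) (D : nat) (P M : seq nat).
Hypothesis p_eq : forall h l, (0 < h)%N ->
  l%:R = p.[h%:R] <-> (D * l + evaln M h = evaln P h)%N.
Variables (k0 K0 : nat) (keep : nat -> bool) (cst : nat -> nat) (cmax : nat).
Variables (iP iM iD iI : 'I_K0.+1).
Hypothesis Hcst : forall r, (cst r <= cmax)%N.
Hypothesis Hzval : forall m,
  [/\ zval keep cst m iP = evaln P m, zval keep cst m iM = evaln M m,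
      zval keep cst m iD = (D * m)%N & zval keep cst m iI = m].
Notation A := (@detector k0 K0 keep cst cmax iP iM iD iI R).
Variables (S : {fset node}) (compass : node -> 'Z_6) (cw : node -> bool).
Hypothesis HS : connected_structure S.
Hypothesis S2 : (1 < #|` S|)%N.
Notation X := {ffun S -> bool}.

Definition toss (w : seq X) (t : nat) (v : S) : bool := nth [ffun => false] w t v.

Lemma runS (w : seq (coins A S)) t v : (t < size w)%N ->
  run compass cw w t.+1 v =
  @advance k0 K0 cst cmax iP iM iD iI (run compass cw w t v)
    (rcv k0 keep compass cw (fun t v => run compass cw w t v) t v) (toss w t v).
Proof.
move=> Ht; rewrite {1}/run (take_nth ([ffun => false] : coins A S)) // foldl_rcons ffunE.
by [].
Qed.

Variables J m : nat.
Hypothesis m_gt0 : (0 < m)%N.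
Hypothesis cmax_lt : (cmax < 2 ^ m)%N.
Hypothesis zval_lt : (cmax * #|` S| ^ K0 < 2 ^ m.-1)%N.

(** Randomness enters through two conditions on the coins only: the two amoebots differ in time, and
    every amoebot shows tails in time. *)
Lemma detector_run : exists u1 u2 : S, u1 != u2 /\ forall (w : seq (coins A S)) m0,
  (exists2 j, (j < J)%N & toss w (4 + 2 * j) u1 != toss w (4 + 2 * j) u2) ->
  all_dead (toss w) m0 -> (maxn (10 + 2 * J + m * (2 * K0.+1 + 2)) m0 < size w)%N ->
  exists T, [/\ running_time compass cw w T,
    (0 < T <= (maxn (10 + 2 * J + m * (2 * K0.+1 + 2)) m0).+1)%N,
    decides compass cw w T (has_side_ratio p S) & all_dead (toss w) T].
Proof.
have [u1 [u2 [Hu Hv]]] := verdict_run p_eq k0 Hcst Hzval compass cw HS S2 J m_gt0 cmax_lt zval_lt.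
exists u1, u2; split => // w m0 Hj Hm0 HN.
pose cf t v := run compass cw w t v.
have cf0 v : cf 0 v = start_state K0 cmax by rewrite /cf /run take0 ffunE.
have cfS t v : (t < size w)%N -> cf t.+1 v =
  @advance k0 K0 cst cmax iP iM iD iI (cf t v) (rcv k0 keep compass cw cf t v) (toss w t v).
  exact: runS.
move: HN; rewrite gtn_max => /andP[HN Hm0N].
have [t /andP[Ht4 Ht] Hph] := Hv _ _ _ cf0 cfS Hj HN.
have HN' : (maxn t m0 < size w)%N by rewrite gtn_max (leq_ltn_trans Ht).
have [T [/andP[HT1 HT2] HTp HTd HTa]] := wait_run HS S2 cf0 cfS Hph Hm0 HN'.
exists T; split => //.
- split; first exact: leq_trans HT2 _.
    by apply/forallP => v; rewrite /= /decision -/(cf T v) HTp.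
  move=> t0 Ht0; apply/negP => /forallP/(_ u1); rewrite /= -/(cf t0 u1).
  by rewrite HTd.
- rewrite (leq_trans _ HT1) //=; apply: leq_trans HT2 _.
  by rewrite ltnS geq_max leq_maxr andbT (leq_trans Ht) // leq_maxl.
by move=> v; rewrite /= /decision -/(cf T v) HTp.
Qed.
End Detection.

(** * Numerical estimates *)

Section Estimates.
Variable R : realType.
Implicit Types (n m l C : nat).

Lemma ln2_le1 : ln (2 : R) <= 1.
Proof. by have := @le_ln1Dx R 1; rewrite (_ : 1 + 1 = 2); [apply; lra|lra]. Qed.

Lemma ln2_ge_half : 2^-1 <= ln (2 : R).
Proof.
have : ln (1 + - 2^-1 : R) <= - 2^-1 by apply: le_ln1Dx; lra.
have -> : 1 + - 2^-1 = 2^-1 :> R by lra.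
by rewrite lnV ?posrE //; lra.
Qed.

Lemma ln_ge_log n l : (2 ^ l <= n)%N -> l%:R / 2 <= ln (n%:R : R).
Proof.
move=> Hn; have n0 : (0 < n)%N by apply: leq_trans Hn; rewrite expn_gt0.
have : ln ((2 ^ l)%:R : R) <= ln n%:R by rewrite ler_ln ?posrE ?ltr0n ?expn_gt0 // ler_nat.
rewrite natrX lnXn // -[ln 2 *+ l]mulr_natl; apply: le_trans.
by rewrite ler_wpM2l // ln2_ge_half.
Qed.

Lemma ln_le_log n l : (0 < n <= 2 ^ l)%N -> ln (n%:R : R) <= l%:R.
Proof.
case/andP=> n0 Hn.
have : ln (n%:R : R) <= ln ((2 ^ l)%:R) by rewrite ler_ln ?posrE ?ltr0n ?expn_gt0 // ler_nat.
rewrite natrX lnXn // -[ln 2 *+ l]mulr_natl => H; apply: le_trans H _.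
by rewrite ler_piMr // ln2_le1.
Qed.

Lemma half_exp_le n l C : (0 < n <= 2 ^ l)%N -> (2^-1 : R) ^+ (C * l) <= n%:R^-1 ^+ C.
Proof.
case/andP=> n0 Hn; rewrite mulnC exprM; apply: lerXn2r; rewrite ?nnegrE ?exprn_ge0 ?invr_ge0 //.
by rewrite exprVn lef_pV2 ?posrE ?exprn_gt0 ?ltr0n // -natrX ler_nat.
Qed.

Lemma all_tails_le n m C : (4 ^ m <= n <= 4 ^ m.+1)%N -> (2 * C * m.+1 < 2 ^ m)%N ->
  (1 - (2^-1 : R) ^+ m) ^+ n <= n%:R^-1 ^+ C / 2.
Proof.
case/andP=> Hn1 Hn2 HC; have n0 : (0 < n)%N by apply: leq_trans Hn1; rewrite expn_gt0.
(* [(1 - 2^-m)^(2^m) <= 1/e <= 1/2], and [n >= 2^m * 2^m]. *)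
pose x : R := 2^-1 ^+ m.
have x0 : 0 < x by rewrite exprn_gt0 // invr_gt0.
have x1 : x <= 1 by rewrite exprn_ile1 // ?invr_ge0 //; lra.
have y0 : 0 <= 1 - x by lra.
have Hx : (1 - x) ^+ (2 ^ m) <= 2^-1.
  apply: (@le_trans _ _ (sequences.expR (- x) ^+ (2 ^ m))).
    by apply: lerXn2r; rewrite ?nnegrE ?expR_ge0 //; exact: expR_ge1Dx.
  rewrite -expRM_natl natrX mulrN /x -exprMn mulfV ?pnatr_eq0 ?expr1n // expRN.
  rewrite lef_pV2 ?posrE ?expR_gt0 //.
  by apply: le_trans (expR_ge1Dx _); lra.
apply: (@le_trans _ _ ((1 - x) ^+ (2 ^ m * 2 ^ m))).
  by apply: ler_wiXn2l => //; rewrite ?gerBl ?(ltW x0) -?expnMn.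
rewrite exprM; apply: (@le_trans _ _ (2^-1 ^+ (2 ^ m))).
  by apply: lerXn2r; rewrite ?nnegrE ?exprn_ge0 // invr_ge0.
apply: (@le_trans _ _ (2^-1 ^+ (2 * C * m.+1).+1)).
  by apply: ler_wiXn2l => //; rewrite ?invr_ge0 //; lra.
rewrite exprSr ler_wpM2r ?invr_ge0 // (_ : (2 * C * m.+1 = C * (2 * m.+1))%N); last by lia.
by apply: half_exp_le; rewrite n0 expnM.
Qed.

Lemma exp2_ge C m : (4 * C + 6 <= m)%N -> (2 * C * m.+1 < 2 ^ m)%N.
Proof.
move=> Hm; have [j Hj] : exists j, m = (j + 6)%N by exists (m - 6)%N; lia.
suff : (m.+1 * m.+1 <= 2 ^ m)%N by nia.
rewrite Hj; elim: (j) => [//|i IH]; rewrite addSn expnS; nia.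
Qed.

Lemma count_ge (I : pred nat) (s : seq nat) N :
  uniq s -> (forall i, i \in s -> I i && (i < N)%N) -> (size s <= count I (iota 0 N))%N.
Proof.
move=> Hu Hs; rewrite -size_filter uniq_leq_size // => i /Hs/andP[H1 H2].
by rewrite mem_filter H1 mem_iota.
Qed.

(** The failures are a long run of heads at some amoebot, corners that never differ, and tails
    everywhere too early. The exponent [C + 3] absorbs the union over the amoebots: since there are
    at least two, the three terms are at most 1/4, 1/8 and 1/2 of the bound. The third event is
    restricted to large [m1], where its estimate applies. *)
Lemma rare (T : finType) (u1 u2 : T) C l N (m1 := trunc_log 4 #|T|) :
  u1 != u2 -> (#|T| <= 2 ^ l)%N -> (4 + 2 * ((C + 3) * l) <= N)%N -> (m1 <= N)%N ->
  @prob R T N (fun w => (exists v, forall i : 'I_N, (i < (C + 3) * l)%N -> tnth w i v) \/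
    ((forall i : 'I_N, nat_of_ord i \in [seq (4 + 2 * j)%N | j <- iota 0 ((C + 3) * l)] ->
       tnth w i u1 == tnth w i u2) \/
     (4 * C + 6 <= m1)%N /\ forall v, exists2 i : 'I_N, (i < m1)%N & ~~ tnth w i v))
  <= #|T|%:R^-1 ^+ C.
Proof.
move=> Hu Hl HN Hm1; pose n := #|T|; set J := ((C + 3) * l)%N in HN *.
have n2 : (1 < n)%N by apply/card_gt1P; exists u1, u2.
have n0 : (0 < n)%N := ltnW n2.
pose y : R := n%:R^-1.
have y0 : 0 < y by rewrite invr_gt0 ltr0n.
have y2 : y <= 2^-1 by rewrite lef_pV2 ?posrE ?ltr0n // ler_nat.
have HJ : (2^-1 : R) ^+ J <= y ^+ (C + 3) by apply: half_exp_le; rewrite n0.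
have Hcount (I : pred nat) (s : seq nat) : size s = J -> uniq s ->
    (forall i, i \in s -> I i && (i < N)%N) -> (2^-1 : R) ^+ count I (iota 0 N) <= y ^+ (C + 3).
  move=> Hs Hu' HI; apply: le_trans HJ; apply: ler_wiXn2l; rewrite ?invr_ge0 //; first lra.
  by rewrite -Hs count_ge.
have H1 : prob R (fun w : N.-tuple {ffun T -> bool} =>
    exists v, forall i : 'I_N, (i < J)%N -> tnth w i v) <= n%:R * y ^+ (C + 3).
  apply: prob_exists => v.
  rewrite (@prob_rows R T N (fun i => (i < J)%N) (fun x => x v) v); last first.
    by move=> x; rewrite ffunE eqxx addbT.
  apply: (Hcount _ (iota 0 J)); rewrite ?size_iota ?iota_uniq // => i; rewrite mem_iota add0n => /= Hi.
  by rewrite Hi; lia.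
have H2 : prob R (fun w : N.-tuple {ffun T -> bool} => forall i : 'I_N,
    nat_of_ord i \in [seq (4 + 2 * j)%N | j <- iota 0 J] -> tnth w i u1 == tnth w i u2) <= y ^+ (C + 3).
  rewrite (@prob_rows R T N (mem [seq (4 + 2 * j)%N | j <- iota 0 J]) (fun x => x u1 == x u2) u1); last first.
    by move=> x; rewrite !ffunE eqxx eq_sym [u2 == u1]eq_sym (negPf Hu); case: (x u1); case: (x u2).
  apply: (Hcount _ [seq (4 + 2 * j)%N | j <- iota 0 J]); first by rewrite size_map size_iota.
    by rewrite map_inj_uniq ?iota_uniq // => i j; lia.
  move=> i Hi; rewrite /= Hi; case/mapP: Hi => j; rewrite mem_iota; lia.
have H3 : prob R (fun w : N.-tuple {ffun T -> bool} =>
    (4 * C + 6 <= m1)%N /\ forall v, exists2 i : 'I_N, (i < m1)%N & ~~ tnth w i v) <= y ^+ C / 2.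
  have [HC|HC] := leqP (4 * C + 6) m1; last first.
    rewrite /prob big_pred0; first by rewrite mulr_ge0 ?exprn_ge0 ?invr_ge0 // ltW.
    by move=> w; apply/asboolP => -[].
  apply: (@le_trans _ _ ((1 - (2^-1 : R) ^+ m1) ^+ n)).
    by rewrite -(prob_all_tails R T Hm1); apply: prob_le => w [].
  apply: all_tails_le; last exact: exp2_ge.
  by have /andP[-> /ltnW] := @trunc_log_bounds 4 n isT n0.
apply: le_trans (prob_or R _ _) _; apply: le_trans (lerD H1 (le_trans (prob_or R _ _) (lerD H2 H3))) _.
have E1 : n%:R * y ^+ (C + 3) = y ^+ C * (y * y).
  by rewrite addnS exprS mulrA mulfV ?mul1r ?exprD ?expr2 // pnatr_eq0 -lt0n.
have E2 : y ^+ (C + 3) = y ^+ C * (y * y * y) by rewrite exprD !exprS expr0 mulr1 -[y * y * y]mulrA.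
rewrite -/y E1 E2 -!mulrDr.
have yC : 0 <= y ^+ C by rewrite exprn_ge0 // ltW.
rewrite ler_piMr //.
have Hy : y * y <= 2^-1 * 2^-1 by apply: ler_pM => //; exact: ltW.
have Hy3 : y * y * y <= 2^-1 * 2^-1 * 2^-1 by apply: ler_pM => //; rewrite ?mulr_ge0 //; exact: ltW.
lra.
Qed.
End Estimates.

Lemma round_bound g e q L : (0 < L)%N ->
  (maxn (10 + 2 * (g * L) + (e * L).+1 * q) (g * L) < (11 + 2 * g + (e + 1) * q) * L)%N.
Proof.
move=> L0; have Hq : (q <= q * L)%N by rewrite leq_pmulr.
have E1 : ((e * L).+1 * q = q + e * q * L)%N by rewrite mulSn mulnAC.
have E2 : ((11 + 2 * g + (e + 1) * q) * L = 11 * L + 2 * (g * L) + (e * q * L + q * L))%N by lia.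
rewrite gtn_max E1 E2; lia.
Qed.

Theorem theoremD5 (R : realType) (p : {poly R}) (k : nat) (hk : (2 <= k)%N) :
  exists A : protocol R k,
  forall c : R, 0 < c ->
  exists a b : R, 0 < a /\ 0 < b /\
  forall (S : {fset node}) (compass : node -> 'Z_6) (cw : node -> bool),
  connected_structure S ->
  forall N : nat, b * ln (#|` S|%:R : R) <= N%:R ->
  1 - (#|` S|%:R `^ c)^-1 <=
  Pr (fun w : N.-tuple (coins A S) =>
    exists T : nat,
      [/\ running_time compass cw w T,
          a * ln (#|` S|%:R : R) <= T%:R <= b * ln (#|` S|%:R : R) &
          decides compass cw w T (has_side_ratio p S)]).
Proof.
case: k hk => [|[|k0]] // _.
have [D [P [M p_eq]]] := natural_equation p.
have [K0 [keep [cst [cmax [iP [iM [iD [iI [Hcst Hzval]]]]]]]]] := program_exists D P M.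
exists (@detector k0 K0 keep cst cmax iP iM iD iI R) => c c0.
pose C := (Num.truncn c).+1; have cC : c <= C%:R by apply/ltW; exact: truncnS_gt.
pose Bc := (11 + 2 * (C + 3) + (cmax + K0 + 1) * (2 * K0.+1 + 2))%N.
have Bc0 : (0 < Bc)%N by [].
(* The factor 4 in [b] comes from [L <= 4 ln n]. In [a], the 2 comes from [ln n <= 2 (m1 + 1)], and
   [4 * C + 7] covers those [m1] below the threshold of [rare], for which only [0 < T] is used. *)
exists (2 * (4 * C + 7))%N%:R^-1, (4 * Bc)%N%:R; split; first by rewrite invr_gt0 ltr0n.
split=> [|S compass cw HS N HN]; first by rewrite ltr0n muln_gt0.
set n := #|` S| in HN *; set E := fun w => _.
have n0 : (0 < n)%N by rewrite cardfs_gt0; case: HS.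
have [n1|n2] := leqP n 1.
  (* For a single amoebot the required probability is 0. *)
  rewrite (_ : n = 1%N) ?powR1 ?invr1 ?subrr; last by lia.
  apply: sumr_ge0 => w _; apply: prodr_ge0 => x _; apply: prodr_ge0 => v _; exact: coin_law_ge0.
(* Since [n <= 2 ^ L], all values [cmax * n ^ K0] fit into [(cmax + K0) * L] bits; [m] has one more
   for the sum. *)
pose l := trunc_log 2 n; pose L := l.+1; pose J := ((C + 3) * L)%N.
pose m := ((cmax + K0) * L).+1; pose m1 := trunc_log 4 n.
have Hl : (2 ^ l <= n <= 2 ^ L)%N by have /andP[-> /ltnW] := @trunc_log_bounds 2 n isT n0.
have Hm1 : (4 ^ m1 <= n <= 4 ^ m1.+1)%N by have /andP[-> /ltnW] := @trunc_log_bounds 4 n isT n0.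
have cmaxL : (cmax < 2 ^ (cmax * L))%N.
  by apply: leq_trans (ltn_expl cmax (isT : 1 < 2)%N) _; rewrite leq_exp2l // leq_pmulr.
have cmax_lt : (cmax < 2 ^ m)%N.
  by apply: leq_trans cmaxL _; rewrite leq_exp2l // /m mulnDl; lia.
have zval_lt : (cmax * n ^ K0 < 2 ^ m.-1)%N.
  rewrite /m /= mulnDl expnD; apply: (@leq_ltn_trans (cmax * 2 ^ (K0 * L))).
    rewrite leq_mul2l; apply/orP; right; rewrite mulnC expnM.
    by case: (K0) => // i; rewrite leq_exp2r //; case/andP: Hl.
  by rewrite ltn_pmul2r // expn_gt0.
have ln_ge : L%:R <= 4 * ln (n%:R : R).
  have H1 : l%:R / 2 <= ln (n%:R : R) by apply: ln_ge_log; case/andP: Hl.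
  have H2 : 1%:R / 2 <= ln (n%:R : R) by apply: ln_ge_log.
  have -> : L%:R = l%:R + 1 :> R by rewrite natr1.
  by clear -H1 H2; lra.
have ln_le : ln (n%:R : R) <= (2 * m1.+1)%:R.
  by apply: ln_le_log; rewrite n0 expnM; case/andP: Hm1.
pose t0 := maxn (10 + 2 * J + m * (2 * K0.+1 + 2)) J.
have Ht0 : (t0 < Bc * L)%N.
  exact: round_bound.
have HBL : (Bc * L)%:R <= (4 * Bc)%:R * ln (n%:R : R).
  by rewrite natrM (natrM _ 4) [4 * _]mulrC -mulrA ler_wpM2l.
have BLN : (Bc * L <= N)%N by rewrite -(ler_nat R); exact: le_trans HN.
have m1l : (m1 <= l)%N.
  apply: trunc_log_max => //; apply: leq_trans (andP Hm1).1.
  by case: (m1) => // i; rewrite leq_exp2r.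
have [u1 [u2 [Hu Hrun]]] := detector_run p_eq k0 Hcst Hzval compass cw HS n2 J (ltn0Sn _) cmax_lt zval_lt.
have HNt : (t0 < N)%N by exact: leq_trans BLN.
have HJ : (4 + 2 * J <= N)%N by move: HNt; rewrite gtn_max; clear; lia.
have Hm1N : (m1 <= N)%N by apply: leq_trans BLN; rewrite (leq_trans m1l) // (leq_trans (leqnSn l)) // leq_pmull.
have := @rare R S u1 u2 C L N Hu; rewrite -cardfE => /(_ (andP Hl).2 HJ Hm1N) Hrare.
have nC : (n%:R^-1 : R) ^+ C <= (n%:R `^ c)^-1.
  rewrite exprVn lef_pV2 ?posrE ?exprn_gt0 ?powR_gt0 ?ltr0n //.
  by rewrite -powR_mulrn // ler_powR // ler1n.
apply: (@le_trans _ _ (1 - (n%:R^-1 : R) ^+ C)); first by rewrite lerB.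
change (1 - (n%:R^-1 : R) ^+ C <= @prob R S N E).
rewrite prob_compl lerB //; apply: le_trans Hrare; apply: prob_le => w HE.
apply: contrapT => Hno; apply: HE.
have Htoss i (Hi : (i < N)%N) v : toss w i v = tnth w (Ordinal Hi) v.
  by rewrite /toss (tnth_nth [ffun => false]).
have Hdead : all_dead (toss w) J.
  apply/forallP => v; apply: contrapT => Hv; apply: Hno; left; exists v => i Hi.
  move/negP: Hv; rewrite -all_predC => /allP/(_ i); rewrite mem_iota => /(_ Hi).
  by rewrite /= negbK (Htoss _ (ltn_ord i)); congr (tnth w _ v); apply/val_inj.
have Hj : exists2 j, (j < J)%N & toss w (4 + 2 * j) u1 != toss w (4 + 2 * j) u2.
  apply: contrapT => Hj; apply: Hno; right; left => i /mapP[j]; rewrite mem_iota => /= HjJ Ei.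
  apply/negPn/negP => Hne; apply: Hj; exists j => //.
  rewrite -Ei !(Htoss _ (ltn_ord i)); move: Hne; congr (~~ (tnth w _ _ == tnth w _ _)); exact/val_inj.
have HNw : (t0 < size w)%N by rewrite size_tuple.
have [T [HT /andP[T0 T1] Hdec HdeadT]] := Hrun w J Hj Hdead HNw.
exists T; split => //; apply/andP; split; last first.
  by apply: le_trans HBL; rewrite ler_nat (leq_trans T1).
rewrite mulrC ler_pdivrMr ?ltr0n //; apply: le_trans ln_le _; rewrite -natrM ler_nat.
have [HC|HC] := leqP (4 * C + 6) m1; last first.
  by apply: (@leq_trans (1 * (2 * (4 * C + 7)))); [lia | rewrite leq_mul2r T0 orbT].
suff Hm1T : (m1 < T)%N.
  by rewrite mulnC leq_mul // leq_pmulr.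
(* Termination by round [m1] would mean that all amoebots have shown tails within the first [m1]
   coins, the third rare event. *)
rewrite ltnNge; apply/negP => HTm; apply: Hno; right; right; split => // v.
have /hasP[i] := forallP HdeadT v; rewrite mem_iota add0n => /= Hi.
have HiN : (i < N)%N := leq_trans Hi (leq_trans HTm Hm1N).
by rewrite (Htoss _ HiN); exists (Ordinal HiN) => //=; exact: leq_trans HTm.
Qed.
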